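(* Let $n\ge1$, $\varepsilon\neq0$, let $\Omega\subseteq\mathbb{R}^{2n}$ be a bounded domain, $H\in L^\infty_{loc}(\Omega)$, and $u\in BV_{loc}(\Omega)$. Then the following are equivalent: (a) for every open $\tilde\Omega\Subset\Omega$ and every $v\in BV_{loc}(\Omega)$ with $\{u\ne v\}\Subset\tilde\Omega$, $$P_\varepsilon(E_u,\tilde\Omega\times\mathbb{R})+\int_{\tilde\Omega}Hu\,dz\le P_\varepsilon(E_v,\tilde\Omega\times\mathbb{R})+\int_{\tilde\Omega}Hv\,dz;$$ (b) $E_u$ is an $H$-minimizer in $\Omega\times\mathbb{R}$, i.e. for every open $A\Subset\Omega\times\mathbb{R}$ and every measurable $F$ with $E_u\,\Delta\,F\Subset A$, $$P_\varepsilon(E_u,A)+\int_{E_u\cap A}H\,dx\le P_\varepsilon(F,A)+\int_{F\cap A}H\,dx,$$ where $H(z,t):=H(z)$.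
   Context: $\mathbb{H}^n=\mathbb{R}^{2n+1}$ with points $(z,t)=(x,y,t)$ and vector fields $X_i=\partial_{x_i}+y_i\partial_t$, $Y_i=\partial_{y_i}-x_i\partial_t$, $T=\partial_t$; $g_\varepsilon$ is the Riemannian metric making $X_1,\dots,X_n,Y_1,\dots,Y_n,\varepsilon T$ orthonormal, with norm $|\cdot|_\varepsilon$. $P_\varepsilon(E,A)=\sup\{\int_E\operatorname{div}U\,dx:U\in C^1_c(A;T\mathbb{H}^n),\ \sup|U|_\varepsilon\le1\}$ ($\operatorname{div}$ Euclidean). $E_u=\{(z,t)\in\Omega\times\mathbb{R}:t<u(z)\}$. For $u\in W^{1,1}$, $P_\varepsilon(E_u,\tilde\Omega\times\mathbb{R})=\int_{\tilde\Omega}\sqrt{\varepsilon^2+|Du+X|^2}\,dz$ with $X(x,y)=(-y,x)$; in the paper condition (a) is written with this integral, understood for BV functions as $P_\varepsilon(E_u,\tilde\Omega\times\mathbb{R})$. *)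

(* Defs.v *)
From HB Require Import structures.
From mathcomp Require Import all_boot all_order all_algebra.
From mathcomp Require Import all_classical all_reals all_analysis.

Set Implicit Arguments.
Unset Strict Implicit.
Unset Printing Implicit Defensive.
Import Order.TTheory GRing.Theory Num.Theory.
Import numFieldNormedType.Exports.

Local Open Scope classical_set_scope.
Local Open Scope ring_scope.

(* Lebesgue measure on R^N = 'rV[R]_N, built as the Caratheodory      *)
(* restriction of the Lebesgue outer measure                          *)
(*   lambda^*(A) = inf { sum_k vol(B_k) | A ⊆ ⋃_k B_k, B_k boxes }.    *)

Section lebesgue_RN.
Variables (R : realType) (N : nat).

(* a copy of R^N in which every set is "measurable"; used only to feed *)
(* the library's outer-measure construction [mu_ext] with the class of *)
(* all subsets as admissible covering sets.                            *)
Definition allsets : Type := 'rV[R]_N.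
HB.instance Definition _ := Choice.on allsets.
HB.instance Definition _ := isPointed.Build allsets 0.
HB.instance Definition _ :=
  @isMeasurable.Build default_measure_display allsets setT
    I (fun _ _ => I) (fun _ _ => I).

Definition box (a b : 'rV[R]_N) : set 'rV[R]_N :=
  [set x | forall i, a ord0 i <= x ord0 i < b ord0 i].

Definition box_vol (a b : 'rV[R]_N) : R :=
  \prod_(i < N) Num.max (b ord0 i - a ord0 i) 0.

(* elementary volume: vol of a box (and 0 for the empty set);        *)
(* +oo for sets which are not boxes                                     *)
Definition box_content (A : set allsets) : \bar R :=
  ereal_inf [set x | (A = set0 /\ x = 0%E) \/
                     exists a b, A = box a b /\ x = (box_vol a b)%:E].

Lemma box_content_ge0 A : (0 <= box_content A)%E.
Proof.
apply: le_ereal_inf_tmp => _ [[_ ->]//|[a [b [_ ->]]]].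
rewrite lee_fin; apply: prodr_ge0 => i _.
by rewrite le_max lexx orbT.
Qed.

Lemma box_content0 : box_content set0 = 0%E.
Proof.
apply/eqP; rewrite eq_le box_content_ge0 andbT.
by apply: ereal_inf_lbound; left.
Qed.

Definition lebesgue_outer : set allsets -> \bar R :=
  mu_ext box_content.

HB.instance Definition _ := isOuterMeasure.Build R allsets
  lebesgue_outer (mu_ext0 box_content0 box_content_ge0)
  (mu_ext_ge0 box_content_ge0) (le_mu_ext box_content)
  (mu_ext_sigma_subadditive box_content_ge0).

Definition lebesgue_outerM : {outer_measure set allsets -> \bar R} :=
  lebesgue_outer.

Definition LebRN := caratheodory_type lebesgue_outerM.

(* Lebesgue measure on R^N (complete: defined on all Lebesgue measurable sets) *)
Definition lebRN : {measure set LebRN -> \bar R} :=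
  (lebesgue_outerM : set LebRN -> \bar R).

End lebesgue_RN.

Arguments LebRN : clear implicits.
Arguments lebRN : clear implicits.

Local Open Scope ereal_scope.

Section calculus.
Variable R : realType.
Local Open Scope ring_scope.

Definition basisv (N : nat) (i : 'I_N) : 'rV[R]_N := delta_mx ord0 i.

Definition euclid_norm (N : nat) (a : 'rV[R]_N) : R :=
  Num.sqrt (\sum_(i < N) a ord0 i ^+ 2).

Definition C1 (M K : nat) (U : 'rV[R]_M -> 'rV[R]_K) : Prop :=
  forall (j : 'I_K) (i : 'I_M),
    (forall p, derivable (fun q => U q ord0 j) p (basisv i)) /\
    continuous (fun p => 'D_(basisv i) (fun q => U q ord0 j) p).

Definition compact_support_in (M K : nat) (U : 'rV[R]_M -> 'rV[R]_K)
    (A : set 'rV[R]_M) : Prop :=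
  exists2 C : set 'rV[R]_M, compact C /\ C `<=` A & forall p, ~ C p -> U p = 0.

Definition divergence (M : nat) (U : 'rV[R]_M -> 'rV[R]_M) (p : 'rV[R]_M) : R :=
  \sum_(i < M) 'D_(basisv i) (fun q => U q ord0 i) p.

Definition compactly_contained (M : nat) (A B : set 'rV[R]_M) : Prop :=
  compact (closure A) /\ closure A `<=` B.

End calculus.

Section heisenberg.
Variable R : realType.
Local Open Scope ring_scope.
(* H^n = R^(2n+1) = 'rV_(n + n + 1); a point is (x, y, t) with       *)
(* x = first n coordinates, y = next n coordinates, t = last one.    *)
Variable n : nat.
Notation Hn := 'rV[R]_(n + n + 1).
Notation R2n := 'rV[R]_(n + n).

Definition hz (p : Hn) : R2n := lsubmx p.
Definition ht (p : Hn) : R := p ord0 (rshift (n + n) ord0).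
Definition hx (p : Hn) (i : 'I_n) : R := p ord0 (lshift 1 (lshift n i)).
Definition hy (p : Hn) (i : 'I_n) : R := p ord0 (lshift 1 (rshift n i)).

(* |a|_eps at the point p, for a tangent vector a given by its Euclidean *)
(* components: a = sum_i (alpha_i X_i + beta_i Y_i) + gamma (eps T) with  *)
(* X_i = d_{x_i} + y_i d_t, Y_i = d_{y_i} - x_i d_t, so that             *)
(* alpha_i = a_{x_i}, beta_i = a_{y_i},                                  *)
(* gamma = (a_t - sum_i (a_{x_i} y_i - a_{y_i} x_i)) / eps,              *)
(* and |a|_eps^2 = sum_i (alpha_i^2 + beta_i^2) + gamma^2.               *)
Definition norm_eps (eps : R) (p a : Hn) : R :=
  let gamma := (ht a - \sum_(i < n) (hx a i * hy p i - hy a i * hx p i)) / eps in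
  Num.sqrt (\sum_(i < n) (hx a i ^+ 2 + hy a i ^+ 2) + gamma ^+ 2).

Definition perimeter_eps (eps : R) (E A : set Hn) : \bar R :=
  ereal_sup [set (\int[lebRN R (n + n + 1)]_(p in E) (divergence U p)%:E)%E
            | U in [set U : Hn -> Hn | C1 U /\ compact_support_in U A /\
                                       forall p, norm_eps eps p (U p) <= 1]].

Definition subgraph (Omega : set R2n) (u : R2n -> R) : set Hn :=
  [set p | Omega (hz p) /\ ht p < u (hz p)].

Definition cylinder (A : set R2n) : set Hn := [set p | A (hz p)].

End heisenberg.

Section function_spaces.
Variable R : realType.
Local Open Scope ring_scope.
Variable N : nat.
Notation RN := 'rV[R]_N.
Notation leb := (lebRN R N).

Definition L1loc (Omega : set RN) (u : RN -> R) : Prop :=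
  measurable_fun (Omega : set (LebRN R N)) (u : LebRN R N -> R) /\
  forall K : set RN, compact K -> K `<=` Omega ->
    (\int[leb]_(z in K) `|u z|%:E < +oo)%E.

Definition Linfloc (Omega : set RN) (H : RN -> R) : Prop :=
  measurable_fun (Omega : set (LebRN R N)) (H : LebRN R N -> R) /\
  forall K : set RN, compact K -> K `<=` Omega ->
    exists M : R, {ae leb, forall z, K z -> `|H z| <= M}.

Definition total_variation (u : RN -> R) (A : set RN) : \bar R :=
  ereal_sup [set (\int[leb]_(z in A) (u z * divergence phi z)%:E)%E
            | phi in [set phi : RN -> RN | C1 phi /\ compact_support_in phi A /\
                                           forall z, euclid_norm (phi z) <= 1]].

Definition BVloc (Omega : set RN) (u : RN -> R) : Prop :=
  L1loc Omega u /\
  forall A : set RN, open A -> compactly_contained A Omega ->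
    (total_variation u A < +oo)%E.

End function_spaces.

(* Main.v *)
Require Import Defs.
From HB Require Import structures.
From mathcomp Require Import all_boot all_order all_algebra.
From mathcomp Require Import all_classical all_reals all_analysis.
From mathcomp Require Import measurable_realfun.
From mathcomp Require Import ring lra.
Import Order.TTheory GRing.Theory Num.Theory.
Import numFieldNormedType.Exports.
Set Implicit Arguments.
Unset Strict Implicit.
Unset Printing Implicit Defensive.
Local Open Scope classical_set_scope.
Local Open Scope ring_scope.

(* Let E_v be the subgraph of v.  Smoothing: given a test field U on a cylinder, replace
   1_{t < v} by a smooth step of j (v_d - t), v_d a mollification of v; the flux of U then
   becomes the flux int (v div phi + phi_t) of the t-independent field phi obtained by mollifying
   in z, and integrating in t, the components of U in the left-invariant frame weighted by the
   derivative of the step.  As xi(z) = (y, -x) is linear and the kernel is even, phi is again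
   admissible, by convexity of the norm.  So P(E_v) is controlled by t-independent fluxes.
   Rearrangement: conversely such a field, cut off in t, is a test field for any F which is a
   subgraph up to a bounded set, and its flux through F only sees the heights
   v(z) = int (1_F - 1_{t < 0}) dt; hence P(E_v) <= P(F), which gives (a) => (b).  For (b) => (a)
   one compares E_u with the set equal to E_v for |t| < k and to E_u elsewhere: cutting along
   t = k and t = -k costs at most a constant times the measure of {|u| + |v| > k - 1}, which
   tends to 0. *)

(** * Lebesgue measure on R^N *)

(** Perimeters may be infinite, so nothing is subtracted before finiteness is known: inequalities
    are stated between sums of perimeters and proved on pairs of test fields. Since [LebRN] is
    complete, vertical sections of a Lebesgue measurable competitor need not be measurable; it is
    replaced by a set measurable for the product, equal to it almost everywhere and to E_u off a
    compact set. In (a) => (b) the rearrangement lives on a cylinder W x R, W the projection of A,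
    while F is compared with E_u on A. The gluing inequality P(F, W x R) + P(E_u, A) <= P(F, A) +
    P(E_u, W x R) passes from one to the other; it also makes P(F, .) finite on cylinders, so that
    the height function is BV_loc and thus a competitor in (a). The curvature terms agree because
    both depend only on vertical integrals. In (b) => (a) the set E_v is not itself a competitor,
    since E_u and E_v may differ at unbounded heights; hence the truncation. The error is removed
    for one compactly supported test field at a time, before the supremum is taken. *)

Section outer.
Variables (R : realType) (N : nat).
Local Notation outer := (@lebesgue_outerM R N).
Local Open Scope ereal_scope.

(** [mu_ext] allows coverings by arbitrary sets; one that contains a non-box has infinite content,
    so it is enough to test coverings by boxes and empty sets. *)
Lemma le_outer (x : \bar R) (A : set 'rV[R]_N) :
  (forall F : (set 'rV[R]_N)^nat,
     (forall k, F k = set0 \/ exists a b, F k = box a b) ->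
     A `<=` \bigcup_k F k -> x <= \sum_(k <oo) @box_content R N (F k)) ->
  x <= outer A.
Proof.
move=> h; apply: le_ereal_inf_tmp => _ [F [mF AF] <-].
have [hF|] := pselect (forall k, F k = set0 \/ exists a b, F k = box a b).
  exact: h.
move=> /existsNP [k /not_orP [k0 kb]].
have Fk : @box_content R N (F k) = +oo.
  rewrite /box_content; set S := (X in ereal_inf X).
  suff -> : S = set0 by rewrite ereal_inf0.
  apply/seteqP; split => y //= -[[]//|[a [b [Fab _]]]].
  by apply: kb; exists a, b.
by rewrite (eseries_pinfty _ _ Fk) ?leey// => n _; rewrite gt_eqF// (lt_le_trans _ (box_content_ge0 _)).
Qed.

Lemma box_content_le (a b : 'rV[R]_N) : @box_content R N (box a b) <= (box_vol a b)%:E.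
Proof. by apply: ereal_inf_lbound; right; exists a, b. Qed.

Lemma outer_box_le (a b : 'rV[R]_N) : outer (box a b) <= (box_vol a b)%:E.
Proof.
apply: le_trans (box_content_le a b).
pose F : (set (allsets R N))^nat := bigcup2 (box a b) set0.
apply: ereal_inf_lbound; exists F.
  by split=> // x xab; exists 0%N.
rewrite nneseries_recl//; last by move=> *; exact: box_content_ge0.
by rewrite eseries_cond/= eseries0 ?adde0// => -[|[|k]]//= _ _; rewrite /F/= box_content0.
Qed.

(** Compare along a covering by boxes: the outer measure dominates, up to [c], every monotone
    countably subadditive [nu] controlled on boxes. Measurability, slab estimates and translation
    invariance all come from a suitable [nu]. *)
Lemma le_outer_sub (nu : set 'rV[R]_N -> \bar R) (c : R) (A : set 'rV[R]_N) :
  nu set0 = 0 -> (forall X, 0 <= nu X) ->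
  {homo nu : X Y / X `<=` Y >-> X <= Y} -> sigma_subadditive nu ->
  (0 < c)%R -> (forall a b, nu (box a b) <= c%:E * (box_vol a b)%:E) ->
  nu A <= c%:E * outer A.
Proof.
move=> nu0 nuge numon nusub c0 nubox.
rewrite -lee_pdivrMl//; apply: le_outer => F hF AF.
rewrite lee_pdivrMl// -nneseriesZl; last by move=> *; exact: box_content_ge0.
apply: (le_trans (numon _ _ AF)); apply: (le_trans (nusub F)).
apply: lee_nneseries => k _ //.
have [->|[a [b ->]]] := hF k; first by rewrite nu0 box_content0 mule0.
rewrite -lee_pdivrMl//; apply: le_ereal_inf_tmp => y.
move=> [[E ->]|[a' [b' [E ->]]]].
  by rewrite [box a b]E nu0 mule0.
by rewrite lee_pdivrMl// [box a b]E.
Qed.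

(** By [le_outer_sub], with [nu X] the sum over the two pieces of [X], the Caratheodory criterion
    reduces to boxes. *)
Lemma caratheodory_box (A : set 'rV[R]_N) :
  (forall a b, outer (box a b `&` A) + outer (box a b `\` A) <= (box_vol a b)%:E) ->
  measurable (A : set (LebRN R N)).
Proof.
move=> h; apply: le_caratheodory_measurable => X.
rewrite -[leRHS]mul1e.
pose nu X := outer (X `&` A) + outer (X `&` ~` A).
apply: (@le_outer_sub nu) => //.
- by rewrite /nu !set0I outer_measure0 adde0.
- by move=> Y; rewrite /nu adde_ge0// outer_measure_ge0.
- by move=> Y Z YZ; apply: leeD; apply: le_outer_measure; exact: setSI.
- move=> F; rewrite /nu nneseriesD; try by move=> *; exact: outer_measure_ge0.
  rewrite !setI_bigcupl.
  by apply: leeD; exact: outer_measure_sigma_subadditive.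
- by move=> a b; rewrite mul1e; exact: h.
Qed.

End outer.

Section boxes.
Variables (R : realType) (N : nat).
Local Notation outer := (@lebesgue_outerM R N).
Local Notation V := 'rV[R]_N.

Definition row_upd (a : V) (i : 'I_N) (c : R) : V :=
  \row_j (if j == i then c else a ord0 j).

(** Clamping the cut by [Num.min] and [Num.max] keeps the formula true when [c] lies outside the
    i-th side: one of the two boxes is then degenerate. *)
Lemma box_volD (a b : V) (i : 'I_N) (c : R) :
  box_vol a (row_upd b i (Num.min (b ord0 i) c)) +
  box_vol (row_upd a i (Num.max (a ord0 i) c)) b = box_vol a b.
Proof.
rewrite /box_vol (bigD1 i)//= [X in _ + X](bigD1 i)//= [RHS](bigD1 i)//= !mxE eqxx.
set P := \prod_(j < N | j != i) Num.max (b ord0 j - a ord0 j) 0.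
rewrite [X in _ * X + _](eq_bigr (fun j => Num.max (b ord0 j - a ord0 j) 0)); last first.
  by move=> j /negPf ji; rewrite mxE ji.
rewrite -/P [X in _ + _ * X](eq_bigr (fun j => Num.max (b ord0 j - a ord0 j) 0)); last first.
  by move=> j /negPf ji; rewrite mxE ji.
rewrite -/P -mulrDl; congr (_ * _).
rewrite !maxEle !minEle.
by repeat case: ifPn; rewrite -?ltNge => *; lra.
Qed.

Lemma measurable_halfspace (i : 'I_N) (c : R) :
  measurable ([set x : V | x ord0 i < c] : set (LebRN R N)).
Proof.
apply: caratheodory_box => a b.
have -> : box a b `&` [set x : V | x ord0 i < c] =
    box a (row_upd b i (Num.min (b ord0 i) c)).
  apply/seteqP; split => x /=.
    move=> [xab xc] j; rewrite !mxE; case: eqP => [->|_]; last exact: xab.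
    by have /andP[-> xb] := xab i; rewrite lt_min xb.
  move=> h; split=> [j|].
    have := h j; rewrite !mxE; case: eqP => [->|_//].
    by rewrite lt_min => /and3P[-> ->].
  by have := h i; rewrite !mxE eqxx lt_min => /and3P[].
have -> : box a b `\` [set x : V | x ord0 i < c] =
    box (row_upd a i (Num.max (a ord0 i) c)) b.
  apply/seteqP; split => x /=.
    move=> [xab /negP]; rewrite -leNgt => xc j; rewrite !mxE.
    case: eqP => [->|_]; last exact: xab.
    by have /andP[xb ->] := xab i; rewrite ge_max xb xc.
  move=> h; split=> [j|].
    have := h j; rewrite !mxE; case: eqP => [->|_//].
    by rewrite ge_max => /andP[/andP[-> _] ->].
  by have := h i; rewrite !mxE eqxx ge_max => /andP[/andP[_ ? _]]; apply/negP; rewrite -leNgt.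
rewrite -(box_volD a b i c) EFinD.
by apply: leeD; exact: outer_box_le.
Qed.

Lemma measurable_coord (i : 'I_N) :
  measurable_fun setT (fun x : LebRN R N => (x : V) ord0 i).
Proof.
apply: (measurability _ (RGenInftyO.measurableE R)) => //.
move=> _ [_ [r ->] <-]; rewrite setTI.
rewrite (_ : _ @^-1` _ = [set x : V | x ord0 i < r]); first exact: measurable_halfspace.
by apply/seteqP; split => x /=; rewrite in_itv.
Qed.

End boxes.

Section coordinatewise.
Context {R : realType} {N : nat} {d : measure_display} {T : measurableType d}.
Variable g : T -> 'rV[R]_N.
Hypothesis mg : forall i, measurable_fun setT (fun x => g x ord0 i).

Lemma measurable_preimage_box (a b : 'rV[R]_N) : measurable (g @^-1` box a b).
Proof.
rewrite (_ : _ @^-1` _ = \bigcap_(i in [set: 'I_N])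
    ((fun x => g x ord0 i) @^-1` `[a ord0 i, b ord0 i[)).
  apply: fin_bigcap_measurable => // i _.
  by rewrite -[X in measurable X]setTI; apply: mg => //; exact: measurable_itv.
apply/seteqP; split => x /=.
  by move=> h i _ /=; rewrite in_itv/=; exact: h.
by move=> h i; have := h i I; rewrite /= in_itv.
Qed.

(** An open set is a countable union of boxes with rational corners. Only the coordinates of [g] are
    assumed measurable, so the argument serves both [LebRN] and the product, whose sigma-algebras
    differ. *)
Lemma measurable_preimage_open (O : set 'rV[R]_N) : open O -> measurable (g @^-1` O).
Proof.
move=> oO.
pose toR (q : 'rV[rat]_N) : 'rV[R]_N := map_mx ratr q.
rewrite (_ : _ @^-1` _ = \bigcup_(ab in [set ab : 'rV[rat]_N * 'rV[rat]_N |
    box (toR ab.1) (toR ab.2) `<=` O]) (g @^-1` box (toR ab.1) (toR ab.2))).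
  rewrite bigcup_mkcond; apply: countable_bigcupT_measurable => [|ab].
    exact: countableP.
  by case: ifP => _; [exact: measurable_preimage_box|exact: measurable0].
apply/seteqP; split => [x /= Ogx|x [ab /= abO]]; last exact: abO.
have [e /= e0 egx] : exists2 e : R, 0 < e & forall y : 'rV[R]_N, (forall j, `|g x ord0 j - y ord0 j| < e) -> O y.
  have /nbhs_ballP[e /= e0 he] := open_nbhs_nbhs (conj oO Ogx).
  exists e => // y hy; apply: he; split=> // i j.
  by rewrite ord1; exact: hy.
have q1 j : exists q : rat, g x ord0 j - e < ratr q < g x ord0 j.
  have /rat_in_itvoo[q] : g x ord0 j - e < g x ord0 j by rewrite ltrBlDr ltrDl.
  by rewrite in_itv/= => ?; exists q.
have q2 j : exists q : rat, g x ord0 j < ratr q < g x ord0 j + e.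
  have /rat_in_itvoo[q] : g x ord0 j < g x ord0 j + e by rewrite ltrDl.
  by rewrite in_itv/= => ?; exists q.
have [q1f q1P] := choice q1; have [q2f q2P] := choice q2.
exists (\row_j q1f j, \row_j q2f j) => /=; last first.
  by move=> j; rewrite !mxE; have /andP[_ /ltW ->] := q1P j; have /andP[] := q2P j.
move=> y hy; apply: egx => j.
have := hy j; rewrite !mxE => /andP[h1 h2].
have /andP[h3 h4] := q1P j; have /andP[h5 h6] := q2P j.
by rewrite ltr_norml; apply/andP; split; lra.
Qed.

Lemma measurable_comp_continuous (k : 'rV[R]_N -> R) :
  continuous k -> measurable_fun setT (k \o g).
Proof.
move=> ck; apply: (measurability _ (RGenOpens.measurableE R)) => //.
move=> _ [_ [a [b ->]] <-]; rewrite setTI.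
have /= := @measurable_preimage_open (k @^-1` `]a, b[%classic).
apply; apply: open_comp => [x _|]; [exact: ck|exact: interval_open].
Qed.

Lemma measurable_preimage_closed (O : set 'rV[R]_N) : closed O -> measurable (g @^-1` O).
Proof.
move=> cO; rewrite -[X in measurable X]setCK; apply: measurableC.
exact: (measurable_preimage_open (closed_openC cO)).
Qed.

End coordinatewise.

Section leb_open.
Context {R : realType} {N : nat}.
Implicit Types A : set 'rV[R]_N.

Lemma measurable_box (a b : 'rV[R]_N) : measurable (box a b : set (LebRN R N)).
Proof. exact: (measurable_preimage_box (@measurable_coord R N)). Qed.

Lemma measurable_open A : open A -> measurable (A : set (LebRN R N)).
Proof. exact: (measurable_preimage_open (@measurable_coord R N)). Qed.

Lemma measurable_closed A : closed A -> measurable (A : set (LebRN R N)).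
Proof. exact: (measurable_preimage_closed (@measurable_coord R N)). Qed.

Lemma measurable_continuous (k : 'rV[R]_N -> R) :
  continuous k -> measurable_fun setT (k : LebRN R N -> R).
Proof. exact: (measurable_comp_continuous (@measurable_coord R N)). Qed.

End leb_open.

Section prod_coord.
Variables (R : realType) (N : nat).
Definition pz (q : 'rV[R]_(N + 1)) : 'rV[R]_N := lsubmx q.
Definition pt (q : 'rV[R]_(N + 1)) : R := q ord0 (rshift N ord0).
Definition mk (z : 'rV[R]_N) (t : R) : 'rV[R]_(N + 1) := row_mx z (t%:M).

Lemma pz_mk z t : pz (mk z t) = z.
Proof. by rewrite /pz /mk row_mxKl. Qed.

Lemma pt_mk z t : pt (mk z t) = t.
Proof. by rewrite /pt /mk row_mxEr mxE eqxx mulr1n. Qed.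

Lemma mkK q : mk (pz q) (pt q) = q.
Proof.
rewrite /mk -[RHS]hsubmxK; congr row_mx.
by apply/rowP => i; rewrite !mxE !ord1 eqxx mulr1n.
Qed.

Lemma pzE q i : pz q ord0 i = q ord0 (lshift 1 i).
Proof. by rewrite /pz mxE. Qed.

Lemma mkl z t i : mk z t ord0 (lshift 1 i) = z ord0 i.
Proof. by rewrite /mk row_mxEl. Qed.

Lemma mkr z t i : mk z t ord0 (rshift N i) = t.
Proof. by rewrite /mk row_mxEr mxE !ord1 eqxx mulr1n. Qed.

Lemma forall_split (P : 'I_(N + 1) -> Prop) :
  (forall j, P j) <-> (forall i, P (lshift 1 i)) /\ P (rshift N ord0).
Proof.
split=> [h|[h1 h2] j]; first by split.
by case: (split_ordP j) => k ->; [exact: h1|rewrite ord1].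
Qed.

Lemma box_split a b q :
  box a b q <-> box (pz a) (pz b) (pz q) /\ pt a <= pt q < pt b.
Proof.
rewrite /box/= forall_split; split => -[h1 h2]; split=> // i.
  by rewrite !pzE.
by have := h1 i; rewrite !pzE.
Qed.

Lemma box_vol_split a b :
  box_vol a b = box_vol (pz a) (pz b) * Num.max (pt b - pt a) 0.
Proof.
rewrite /box_vol big_split_ord/= big_ord1; congr (_ * _).
by apply: eq_bigr => i _; rewrite !pzE.
Qed.
End prod_coord.

Section sigma_finite_leb.
Variables (R : realType) (N : nat).

Definition bigbox (k : nat) : set 'rV[R]_N := box (const_mx (- k%:R)) (const_mx k%:R).

Lemma bigbox_bigcup : \bigcup_k bigbox k = setT.
Proof.
apply/seteqP; split => // x _.
exists (Num.truncn (\sum_i `|x ord0 i|)).+1 => // i; rewrite !mxE.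
have : `|x ord0 i| < (Num.truncn (\sum_i `|x ord0 i|)).+1%:R.
  apply: le_lt_trans (truncnS_gt _).
  by rewrite (bigD1 i)//= lerDl sumr_ge0.
by rewrite ltr_norml => /andP[/ltW -> ->].
Qed.

Lemma bigbox_nd : nondecreasing_seq bigbox.
Proof.
move=> m k mk; apply/subsetPset => x h i; have := h i; rewrite !mxE => /andP[h1 h2].
have mkR : m%:R <= k%:R :> R by rewrite ler_nat.
by apply/andP; split; [apply: le_trans h1; rewrite lerN2|exact: lt_le_trans mkR].
Qed.

Lemma leb_sigma_finite : sigma_finite setT (lebRN R N).
Proof.
exists bigbox; first by rewrite bigbox_bigcup.
move=> k; split; first exact: measurable_box.
by apply: le_lt_trans (outer_box_le _ _) _; rewrite ltry.
Qed.

(* A copy of [lebRN] carrying a sigma-finite structure; convertible to it as a measure. *)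
Definition lm (A : set (LebRN R N)) : \bar R := lebRN R N A.
HB.instance Definition _ := Measure.copy lm (lebRN R N).
HB.instance Definition _ := Measure_isSigmaFinite.Build _ _ _ lm leb_sigma_finite.

End sigma_finite_leb.
Arguments lm : clear implicits.
Arguments bigbox : clear implicits.

(** * Lebesgue measure in dimension N + 1 as a product measure *)

Section leb_prod.
Variables (R : realType) (N : nat).
Local Notation outer M := (@lebesgue_outerM R M).
Local Notation pz := (@pz R N).
Local Notation pt := (@pt R N).
Local Notation mk := (@mk R N).
Local Open Scope ereal_scope.

(** [le_outer_sub] applied to the outer measure of the slab as a function of its base. It holds for
    arbitrary [A], and so can serve to prove that [pz] is measurable. *)
Lemma outer_slab (A : set 'rV[R]_N) (s s' : R) : (s < s')%R ->
  outer (N + 1) [set q | A (pz q) /\ (s <= pt q < s')%R] <= (s' - s)%:E * outer N A.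
Proof.
move=> ss'.
pose nu X := outer (N + 1) [set q | X (pz q) /\ (s <= pt q < s')%R].
apply: (@le_outer_sub _ _ nu) => //.
- rewrite /nu (_ : [set _ | _] = set0) ?outer_measure0//.
  by apply/seteqP; split => // q [].
- by move=> X Y XY; apply: le_outer_measure => q [Xq ?]; split => //; exact: XY.
- move=> F; rewrite /nu.
  apply: le_trans (outer_measure_sigma_subadditive _ _).
  by apply: le_outer_measure => q [[k _ Fk] ?]; exists k.
- by rewrite subr_gt0.
- move=> a b; rewrite /nu.
  rewrite (_ : [set _ | _] = box (mk a s) (mk b s')); last first.
    by apply/seteqP; split => q; [move=> ?; apply/box_split|move/box_split]; rewrite !pz_mk !pt_mk.
  apply: le_trans (outer_box_le _ _) _.
  rewrite box_vol_split !pz_mk !pt_mk -EFinM lee_fin mulrC max_l//.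
  by rewrite subr_ge0 ltW.
Qed.

(** [outer_slab] bounds the two pieces into which a cylinder cuts a box by those into which [A] cuts
    the base of the box. *)
Lemma measurable_pz : measurable_fun setT (pz : LebRN R (N + 1) -> LebRN R N).
Proof.
move=> _ A mA; rewrite setTI; apply: caratheodory_box => a b.
rewrite box_vol_split.
have [ab|ab] := ltP (pt a) (pt b); last first.
  have -> : box a b = set0 by apply/seteqP; split => // q /box_split[_ /andP[]]; lra.
  rewrite set0I set0D !outer_measure0 adde0 lee_fin; apply: mulr_ge0.
    by apply: prodr_ge0 => i _; rewrite le_max lexx orbT.
  by rewrite le_max lexx orbT.
apply: (@le_trans _ _ ((pt b - pt a)%:E * outer N (box (pz a) (pz b) `&` A) +
  (pt b - pt a)%:E * outer N (box (pz a) (pz b) `\` A))).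
  apply: leeD; apply: le_trans (outer_slab _ ab); apply: le_outer_measure => q.
    by move=> [/box_split[? ?] Aq].
  by move=> [/box_split[? ?] Aq].
rewrite -ge0_muleDr; try exact: outer_measure_ge0.
rewrite -[X in _ * X](mA (box (pz a) (pz b))).
rewrite EFinM muleC max_l ?subr_ge0 ?(ltW ab)//.
by apply: lee_wpmul2r; [rewrite lee_fin subr_ge0 ltW|exact: outer_box_le].
Qed.

Lemma measurable_pt : measurable_fun setT (pt : LebRN R (N + 1) -> R).
Proof. exact: measurable_coord. Qed.

Definition split_pt (q : LebRN R (N + 1)) : LebRN R N * R := (pz q, pt q).

Lemma measurable_split_pt : measurable_fun setT split_pt.
Proof. by apply: measurable_fun_pair; [exact: measurable_pz|exact: measurable_pt]. Qed.

Local Notation m := (lm R N \x @lebesgue_measure R).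

Lemma measurable_mk : forall i, measurable_fun setT (fun x : LebRN R N * R => mk x.1 x.2 ord0 i).
Proof.
apply/forall_split; split => [i|].
  under eq_fun do rewrite mkl.
  exact: (measurableT_comp (@measurable_coord R N i)).
by under eq_fun do rewrite mkr; exact: measurable_snd.
Qed.

Lemma prod_box a b : m ((fun x => mk x.1 x.2) @^-1` box a b) =
  lm R N (box (pz a) (pz b)) * (Num.max (pt b - pt a) 0)%:E.
Proof.
rewrite (_ : _ @^-1` _ = box (pz a) (pz b) `*` `[pt a, pt b[%classic); last first.
  apply/seteqP; split => -[z t] /=; rewrite in_itv/=.
    by move/box_split; rewrite pz_mk pt_mk.
  by move=> h; apply/box_split; rewrite pz_mk pt_mk.
rewrite product_measure1E//; last exact: measurable_box.
congr (_ * _); apply: eq_trans (lebesgue_measure_itv `[pt a, pt b[) _.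
rewrite /= lte_fin.
case: ltP => h; first by rewrite max_l ?EFinD// subr_ge0 ltW.
by rewrite max_r// subr_le0.
Qed.

(** A covering by boxes in R^(N+1) is also a covering for the product measure, which on boxes is at
    most the volume. The reverse inequality is obtained later by passing to complements. *)
Lemma prod_le_outer (S : set (LebRN R N * R)) : measurable S ->
  m S <= outer (N + 1) (split_pt @^-1` S).
Proof.
move=> mS; apply: le_outer => F hF SF.
pose G k : set (LebRN R N * R) := (fun x => mk x.1 x.2) @^-1` F k.
have mG k : measurable (G k).
  have [E|[a [b E]]] := hF k; rewrite /G E; first by rewrite preimage_set0.
  exact: (measurable_preimage_box measurable_mk).
have mUG : measurable (\bigcup_k G k) by apply: bigcup_measurable => k _; exact: mG.
apply: (@le_trans _ _ (m (\bigcup_k G k))).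
  apply: le_measure; rewrite ?inE//.
  move=> [z t] Szt; have [|k _ Fk] := SF (mk z t).
    by rewrite /split_pt/= pz_mk pt_mk.
  by exists k.
apply: le_trans (@measure_sigma_subadditive _ _ _ m _ G mG mUG (@subset_refl _ _)) _.
apply: lee_nneseries => k _ //.
rewrite /G; have [->|[a [b ->]]] := hF k.
  by rewrite preimage_set0 measure0 box_content_ge0.
apply: le_ereal_inf_tmp => y [[E ->]|[a' [b' [E ->]]]].
  by rewrite [box a b]E preimage_set0 measure0.
rewrite [box a b]E.
suff : lm R N (box (pz a') (pz b')) * (Num.max (pt b' - pt a') 0)%:E <= (box_vol a' b')%:E.
  by rewrite -prod_box.
rewrite box_vol_split EFinM.
by apply: lee_wpmul2r; [rewrite lee_fin le_max lexx orbT|exact: outer_box_le].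
Qed.

End leb_prod.

Section leb_box.
Variable (R : realType).
Local Notation outer M := (@lebesgue_outerM R M).
Local Open Scope ereal_scope.

Lemma box_content_rv0 (F : set 'rV[R]_0) : F !=set0 -> 1 <= @box_content R 0 F.
Proof.
move=> [x Fx]; apply: le_ereal_inf_tmp => y [[E _]|[a [b [_ ->]]]].
  by move: Fx; rewrite E.
by rewrite /box_vol big_ord0.
Qed.

(** The lower bound goes by induction on the dimension: [prod_le_outer] compares with the product of
    the measure in dimension N and one-dimensional Lebesgue measure, in place of a Heine-Borel
    argument on coverings. *)
Lemma leb_box N (a b : 'rV[R]_N) : lm R N (box a b) = (box_vol a b)%:E.
Proof.
apply/eqP; rewrite eq_le outer_box_le/=.
elim: N a b => [|N].
  move=> a b; rewrite /box_vol big_ord0.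
  apply: le_outer => F hF boxF.
  have [k _ Fk] : (\bigcup_k F k) a by apply: boxF => -[].
  apply: (@le_trans _ _ (@box_content R 0 (F k))).
    by apply: box_content_rv0; exists a.
  apply: le_trans (nneseries_lim_ge k.+1 _); last by move=> *; exact: box_content_ge0.
  by rewrite big_nat_recr//= leeDr// sume_ge0// => *; exact: box_content_ge0.
rewrite -(addn1 N) => IH a b.
have := prod_le_outer (measurable_preimage_box (@measurable_mk R N) a b).
rewrite prod_box /= (_ : _ @^-1` _ = box a b); last first.
  by apply/seteqP; split => q /=; rewrite mkK.
apply: le_trans; rewrite box_vol_split EFinM.
by apply: lee_wpmul2r; [rewrite lee_fin le_max lexx orbT|exact: IH].
Qed.

End leb_box.

Section leb_pushforward.
Variables (R : realType) (N : nat).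
Local Open Scope ereal_scope.
Local Notation m := (lm R N \x @lebesgue_measure R).
Local Notation sp := (@split_pt R N).
Local Notation m' := (pushforward (lm R (N + 1)) sp).

Let Q k : set (LebRN R N * R) := (fun x => mk x.1 x.2) @^-1` bigbox R (N + 1) k.

Let mQ k : measurable (Q k).
Proof. exact: (measurable_preimage_box (@measurable_mk R N)). Qed.

Let spQ k : sp @^-1` Q k = bigbox R (N + 1) k.
Proof. by apply/seteqP; split => q /=; rewrite /Q/= mkK. Qed.

Let QE k : m (Q k) = lm R (N + 1) (bigbox R (N + 1) k).
Proof. by rewrite /Q prod_box !leb_box box_vol_split EFinM. Qed.

Let mspS S : measurable S -> measurable (sp @^-1` S).
Proof. by move=> mS; rewrite -[X in measurable X]setTI; exact: measurable_split_pt. Qed.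

(** [prod_le_outer] applies to [S] and to its complement in [Q k]; both sums have the same finite
    total, which forces equality. *)
Let prodQ S k : measurable S -> m (S `&` Q k) = lm R (N + 1) (sp @^-1` (S `&` Q k)).
Proof.
move=> mS.
have mSQ : measurable (S `&` Q k) by exact: measurableI.
have mQS : measurable (Q k `\` S) by exact: measurableD.
have h1 : m (S `&` Q k) <= lm R (N + 1) (sp @^-1` (S `&` Q k)) := prod_le_outer mSQ.
have h2 : m (Q k `\` S) <= lm R (N + 1) (sp @^-1` (Q k `\` S)) := prod_le_outer mQS.
have e1 : m (Q k) = m (S `&` Q k) + m (Q k `\` S).
  by rewrite addeC setIC; exact: (measureDI m (mQ k) mS).
have e2 : lm R (N + 1) (bigbox R (N + 1) k) =
    lm R (N + 1) (sp @^-1` (S `&` Q k)) + lm R (N + 1) (sp @^-1` (Q k `\` S)).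
  rewrite -spQ addeC.
  rewrite (setIC S) preimage_setI.
  exact: (measureDI (lm R (N + 1)) (mspS (mQ k)) (mspS mS)).
have fin : lm R (N + 1) (bigbox R (N + 1) k) \is a fin_num by rewrite leb_box.
move: (fin); rewrite e2 fin_numD => /andP[f1 f2].
move: (fin); rewrite -QE e1 fin_numD => /andP[f3 f4].
have := QE k; rewrite e1 e2.
move: h1 h2; rewrite -(fineK f1) -(fineK f2) -(fineK f3) -(fineK f4) -!EFinD !lee_fin => h1 h2 [].
by move=> h3; congr (_%:E); lra.
Qed.

Lemma leb_prod (S : set (LebRN R N * R)) : measurable S ->
  lm R (N + 1) (sp @^-1` S) = m S.
Proof.
move=> mS.
have SE : S = \bigcup_k (S `&` Q k).
  rewrite -setI_bigcupr -preimage_bigcup bigbox_bigcup preimage_setT setIT//.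
have ndQ : nondecreasing_seq (fun k => S `&` Q k).
  move=> i j ij; apply/subsetPset => x [Sx Qx]; split => //.
  by have /subsetPset := @bigbox_nd R (N + 1) _ _ ij; apply.
have mSQ k : measurable (S `&` Q k) by exact: measurableI.
have mU : measurable (\bigcup_k (S `&` Q k)) by rewrite -SE.
have := @nondecreasing_cvg_mu _ _ _ m (fun k => S `&` Q k) mSQ mU ndQ.
rewrite -SE => c1.
have mspSQ i : measurable (sp @^-1` (S `&` Q i)) by exact: mspS.
have mspU : measurable (\bigcup_k (sp @^-1` (S `&` Q k))).
  by rewrite -preimage_bigcup -SE; exact: mspS.
have ndspQ : nondecreasing_seq (fun k => sp @^-1` (S `&` Q k)).
  by move=> i j ij; apply/subsetPset; apply: preimage_subset; apply/subsetPset; exact: ndQ.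
have := @nondecreasing_cvg_mu _ _ _ (lm R (N + 1)) _ mspSQ mspU ndspQ.
rewrite -preimage_bigcup -SE => c2.
have E : lm R (N + 1) \o (fun k => sp @^-1` (S `&` Q k)) = m \o (fun k => S `&` Q k).
  by apply/funext => k; rewrite /comp prodQ.
rewrite E in c2.
exact: (cvg_unique _ c2 c1).
Qed.

End leb_pushforward.

(** * Real-valued integrals and Fubini *)

Section real_integral.
Context {R : realType} {d : measure_display} {T : measurableType d}.
Variable m : {measure set T -> \bar R}.
Implicit Types f g : T -> R.

Definition intg f := m.-integrable setT (EFin \o f).
Definition I f : R := \int[m]_x f x.

Lemma intg_measurable f : intg f -> measurable_fun setT f.
Proof. by move=> /measurable_int /measurable_EFinP. Qed.

Lemma intgE f : intg f -> (\int[m]_x (f x)%:E)%E = (I f)%:E.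
Proof. by move=> fi; rewrite /I /Rintegral fineK//; exact: integrable_fin_num. Qed.

Lemma intgP f : measurable_fun setT f -> (\int[m]_x `|f x|%:E < +oo)%E -> intg f.
Proof. by move=> mf h; apply/integrableP; split; [exact/measurable_EFinP|]. Qed.

Lemma intg_dom f g : measurable_fun setT f -> (forall x, `|f x| <= g x) -> intg g -> intg f.
Proof.
move=> mf fg gi; apply: (le_integrable measurableT _ _ gi).
  exact/measurable_EFinP.
by move=> x _ /=; rewrite lee_fin (le_trans (fg x))// ler_norm.
Qed.

Lemma intg_abs f : intg f -> intg (fun x => `|f x|).
Proof. by move=> fi; exact: (integrable_norm fi). Qed.

Lemma intgD f g : intg f -> intg g -> intg (fun x => f x + g x).
Proof. by move=> fi gi; exact: (integrableD measurableT fi gi). Qed.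

Lemma intgZ (c : R) f : intg f -> intg (fun x => c * f x).
Proof. by move=> fi; exact: (integrableZl measurableT c fi). Qed.

Lemma intgN f : intg f -> intg (fun x => - f x).
Proof. by move=> fi; rewrite /intg; under eq_fun do rewrite -mulN1r; exact: intgZ. Qed.

Lemma intgB f g : intg f -> intg g -> intg (fun x => f x - g x).
Proof. by move=> fi gi; apply: intgD => //; exact: intgN. Qed.

Lemma intg0 : intg (fun=> 0).
Proof. exact: integrable0. Qed.

Lemma intg_sum (J : Type) (s : seq J) (F : J -> T -> R) :
  (forall i, intg (F i)) -> intg (fun x => \sum_(i <- s) F i x).
Proof.
move=> h; elim: s => [|i s IH].
  by rewrite /intg; under eq_fun do rewrite big_nil; exact: intg0.
by rewrite /intg; under eq_fun do rewrite big_cons; exact: intgD.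
Qed.

Lemma ID f g : intg f -> intg g -> I (fun x => f x + g x) = I f + I g.
Proof. by move=> fi gi; exact: RintegralD. Qed.

Lemma IZ (c : R) f : intg f -> I (fun x => c * f x) = c * I f.
Proof. by move=> fi; exact: RintegralZl. Qed.

Lemma IN f : intg f -> I (fun x => - f x) = - I f.
Proof. by move=> fi; rewrite -[RHS]mulN1r -IZ//; congr I; apply/funext => x; rewrite mulN1r. Qed.

Lemma IB f g : intg f -> intg g -> I (fun x => f x - g x) = I f - I g.
Proof. by move=> fi gi; rewrite ID ?IN//; exact: intgN. Qed.

Lemma I0 : I (fun=> 0) = 0.
Proof. by rewrite /I /Rintegral integral0. Qed.

Lemma Isum (J : Type) (s : seq J) (F : J -> T -> R) : (forall i, intg (F i)) ->
  I (fun x => \sum_(i <- s) F i x) = \sum_(i <- s) I (F i).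
Proof.
move=> h; elim: s => [|i s IH].
  by rewrite big_nil -[RHS]I0; congr I; apply/funext => x; rewrite big_nil.
rewrite big_cons -IH -ID//; last exact: intg_sum.
by congr I; apply/funext => x; rewrite big_cons.
Qed.

Lemma I_ge0 f : (forall x, 0 <= f x) -> 0 <= I f.
Proof. by move=> h; apply: Rintegral_ge0. Qed.

Lemma I_le f g : intg f -> intg g -> (forall x, f x <= g x) -> I f <= I g.
Proof. by move=> fi gi h; apply: le_Rintegral. Qed.

Lemma I_norm f : intg f -> `|I f| <= I (fun x => `|f x|).
Proof. by move=> fi; exact: le_normr_Rintegral. Qed.

Lemma I_norm_le f g : intg f -> intg g -> (forall x, `|f x| <= g x) -> `|I f| <= I g.
Proof.
by move=> fi gi h; apply: (le_trans (I_norm fi)); apply: I_le => //; exact: intg_abs.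
Qed.

Lemma intg_indic (S : set T) : measurable S -> (m S < +oo)%E -> intg \1_S.
Proof.
move=> mS Soo; apply: intgP; first exact: measurable_indic.
under eq_integral => x _ do rewrite ger0_norm//.
by rewrite integral_indic// setIT.
Qed.

Lemma I_indic (S : set T) : measurable S -> I \1_S = fine (m S).
Proof. by move=> mS; rewrite /I /Rintegral integral_indic// setIT. Qed.

Lemma intg_bnd (S : set T) (M : R) f : measurable S -> (m S < +oo)%E ->
  measurable_fun setT f -> (forall x, `|f x| <= M * \1_S x) -> intg f.
Proof. by move=> mS Soo mf h; apply: (intg_dom mf h); apply: intgZ; exact: intg_indic. Qed.

Lemma I_dct (f_ : nat -> T -> R) f g : (forall n, measurable_fun setT (f_ n)) ->
  measurable_fun setT f -> {ae m, forall x, f_ n x @[n --> \oo] --> f x} ->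
  intg g -> (forall n x, `|f_ n x| <= g x) -> I (f_ n) @[n --> \oo] --> I f.
Proof.
move=> mf_ mf cf ig fg.
have mf_' n : measurable_fun setT (EFin \o f_ n) by exact/measurable_EFinP.
have mf' : measurable_fun setT (EFin \o f) by exact/measurable_EFinP.
have h1 : {ae m, forall x, setT x -> (EFin \o f_ n) x @[n --> \oo] --> (EFin \o f) x}.
  apply: filterS cf => x cx _; apply/fine_cvgP; split; first exact: nearW.
  exact: cx.
have h2 : {ae m, forall x n, setT x -> (`|(EFin \o f_ n) x| <= (EFin \o g) x)%E}.
  by apply/aeW => x n _; rewrite lee_fin.
have [fi _ h] := @dominated_convergence _ T R m setT measurableT _ _ _ mf_' mf' h1 ig h2.
apply: (@fine_cvg _ _ \oo _ (fun n => (\int[m]_x (f_ n x)%:E)%E)).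
by rewrite -/(I f) -intgE.
Qed.

Lemma I_eq_ae f g : measurable_fun setT f -> measurable_fun setT g ->
  {ae m, forall x, f x = g x} -> I f = I g.
Proof.
move=> mf mg fg; rewrite /I /Rintegral; congr fine.
apply: ae_eq_integral => //; try exact/measurable_EFinP.
by apply: filterS fg => x /= -> _.
Qed.

End real_integral.

Section measure_preserving.
Context {R : realType} {d d' : measure_display} {T : measurableType d} {T' : measurableType d'}.
Variables (m : {measure set T -> \bar R}) (m' : {measure set T' -> \bar R}) (phi : T -> T').
Hypothesis mphi : measurable_fun setT phi.
Hypothesis pres : forall S, measurable S -> m (phi @^-1` S) = m' S.

Lemma ge0_integral_pres (f : T' -> \bar R) : measurable_fun setT f -> (forall x, 0 <= f x)%E ->
  (\int[m]_x f (phi x) = \int[m']_y f y)%E.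
Proof.
move=> mf f0.
rewrite (eq_measure_integral (pushforward m phi)); last first.
  by move=> A mA _; rewrite -pres.
by rewrite [RHS]ge0_integral_pushforward ?preimage_setT// => x _; exact: f0.
Qed.

Lemma intg_pres (f : T' -> R) : measurable_fun setT f -> intg m' f <-> intg m (f \o phi).
Proof.
move=> mf.
have E : (\int[m]_x `|f (phi x)|%:E = \int[m']_y `|f y|%:E)%E.
  apply: (@ge0_integral_pres (fun y => `|f y|%:E)) => //.
  by apply/measurable_EFinP; exact: measurableT_comp.
split => /integrableP[_ h]; apply: intgP => //.
- exact: measurableT_comp.
- by rewrite /= E.
- by rewrite -E.
Qed.

Lemma I_pres (f : T' -> R) : measurable_fun setT f -> intg m' f -> I m (f \o phi) = I m' f.
Proof.
move=> mf fi; rewrite /I /Rintegral; congr fine.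
rewrite [RHS](eq_measure_integral (pushforward m phi)); last first.
  by move=> A mA _; rewrite -pres.
rewrite [RHS]integral_pushforward//; first exact/measurable_EFinP.
by rewrite preimage_setT; exact/intg_pres.
Qed.

End measure_preserving.

Section real_fubini.
Context {R : realType} {d1 d2 : measure_display}.
Context {T1 : measurableType d1} {T2 : measurableType d2}.
Variables (m1 : {sigma_finite_measure set T1 -> \bar R}).
Variables (m2 : {sigma_finite_measure set T2 -> \bar R}).
Local Notation m12 := (m1 \x m2)%E.

Lemma ae_fubini1 (f : T1 * T2 -> R) : intg m12 f ->
  {ae m1, forall x, (fubini_F m2 (EFin \o f) x = (I m2 (fun y => f (x, y)))%:E)%E}.
Proof.
move=> fi; apply: filterS (ae_integrable1 fi) => x hx.
by rewrite /fubini_F -intgE.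
Qed.

Lemma ae_fubini2 (f : T1 * T2 -> R) : intg m12 f ->
  {ae m2, forall y, (fubini_G m1 (EFin \o f) y = (I m1 (fun x => f (x, y)))%:E)%E}.
Proof.
move=> fi; apply: filterS (ae_integrable2 fi) => y hy.
by rewrite /fubini_G -intgE.
Qed.

Lemma measurable_I1 (f : T1 * T2 -> R) : intg m12 f ->
  measurable_fun setT (fun x => I m2 (fun y => f (x, y))).
Proof. by move=> fi; exact: (measurableT_comp (@fine_measurable R setT measurableT) (measurable_fubini_F fi)). Qed.

Lemma measurable_I2 (f : T1 * T2 -> R) : intg m12 f ->
  measurable_fun setT (fun y => I m1 (fun x => f (x, y))).
Proof. by move=> fi; exact: (measurableT_comp (@fine_measurable R setT measurableT) (measurable_fubini_G fi)). Qed.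

Lemma intg_I1 (f : T1 * T2 -> R) : intg m12 f -> intg m1 (fun x => I m2 (fun y => f (x, y))).
Proof.
move=> fi.
apply: intgP; first exact: measurable_I1.
have /integrableP[_] := integrable_fubini_F fi; apply: le_lt_trans.
rewrite le_eqVlt; apply/orP; left; apply/eqP; apply: ae_eq_integral => //.
- by apply/measurable_EFinP; apply: measurableT_comp => //; exact: measurable_I1.
- exact: (measurableT_comp _ (measurable_fubini_F fi)).
- by apply: filterS (ae_fubini1 fi) => x /= -> _.
Qed.

Lemma I_fubini1 (f : T1 * T2 -> R) : intg m12 f ->
  I m12 f = I m1 (fun x => I m2 (fun y => f (x, y))).
Proof.
move=> fi; rewrite [RHS]/I /Rintegral [LHS]/I /Rintegral -integral12_prod_meas1//; congr fine.
apply: ae_eq_integral => //.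
- exact: (measurable_fubini_F fi).
- by apply/measurable_EFinP; exact: measurable_I1.
- by apply: filterS (ae_fubini1 fi) => x /= -> _.
Qed.

Lemma I_fubini2 (f : T1 * T2 -> R) : intg m12 f ->
  I m12 f = I m2 (fun y => I m1 (fun x => f (x, y))).
Proof.
move=> fi; rewrite [RHS]/I /Rintegral [LHS]/I /Rintegral -integral21_prod_meas1//; congr fine.
apply: ae_eq_integral => //.
- exact: (measurable_fubini_G fi).
- by apply/measurable_EFinP; exact: measurable_I2.
- by apply: filterS (ae_fubini2 fi) => x /= -> _.
Qed.

Lemma I_fubini (f : T1 * T2 -> R) : intg m12 f ->
  I m1 (fun x => I m2 (fun y => f (x, y))) = I m2 (fun y => I m1 (fun x => f (x, y))).
Proof. by move=> fi; rewrite -I_fubini1// I_fubini2. Qed.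

(** Tonelli: an integrable bound on the inner integrals of the absolute value suffices. *)
Lemma intg_prod (f : T1 * T2 -> R) (g : T1 -> R) : measurable_fun setT f ->
  (forall x, \int[m2]_y `|f (x, y)|%:E <= (g x)%:E)%E -> intg m1 g -> intg m12 f.
Proof.
move=> mf fg gi; apply: intgP => //.
rewrite fubini_tonelli1//; last by apply/measurable_EFinP; exact: measurableT_comp.
have /integrableP[mg] := gi; apply: le_lt_trans.
apply: ge0_le_integral => //.
- by move=> x _; apply: integral_ge0.
- by apply: measurable_fun_fubini_tonelli_F => //; apply/measurable_EFinP; exact: measurableT_comp.
- by apply: measurableT_comp.
- move=> x _; apply: (le_trans (fg x)) => /=.
  by rewrite lee_fin ler_norm.
Qed.

Lemma intg_prodM (f : T1 -> R) (g : T2 -> R) : intg m1 f -> intg m2 g ->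
  intg m12 (fun x => f x.1 * g x.2).
Proof.
move=> fi gi; apply: (@intg_prod _ (fun x => `|f x| * I m2 (fun y => `|g y|))).
- apply: measurable_funM; apply: measurableT_comp => //.
    exact: intg_measurable fi.
  exact: intg_measurable gi.
- move=> x /=; rewrite intgE; last first.
    by apply/intg_abs/intgZ.
  rewrite lee_fin le_eqVlt; apply/orP; left; apply/eqP.
  rewrite -IZ; last exact: intg_abs.
  by congr I; apply/funext => y; rewrite normrM.
- rewrite /intg; under eq_fun do rewrite mulrC.
  by apply: intgZ; exact: intg_abs.
Qed.

End real_fubini.

(** * Translation invariance *)

Section translation.
Variables (R : realType) (N : nat).
Local Notation outer := (@lebesgue_outerM R N).
Local Notation V := 'rV[R]_N.
Local Open Scope ereal_scope.

Definition tr (h : V) (x : LebRN R N) : LebRN R N := ((x : V) + h)%R.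

Let outer_tr_le (h : V) (A : set V) : outer (tr h @^-1` A) <= outer A.
Proof.
rewrite -[leRHS]mul1e.
apply: (@le_outer_sub _ _ (fun X => outer (tr h @^-1` X))) => //.
- by rewrite preimage_set0 outer_measure0.
- by move=> X Y XY; apply: le_outer_measure; exact: preimage_subset.
- by move=> F; rewrite preimage_bigcup; exact: outer_measure_sigma_subadditive.
move=> a b; rewrite mul1e.
rewrite (_ : _ @^-1` _ = box (a - h)%R (b - h)%R); last first.
  by apply/seteqP; split => x xab i; have := xab i; rewrite !mxE lerBlDr ltrBrDr.
apply: le_trans (outer_box_le _ _) _; rewrite lee_fin /box_vol.
rewrite (eq_bigr (fun i => Num.max (b ord0 i - a ord0 i) 0))%R// => i _.
by rewrite !mxE; congr Num.max; ring.
Qed.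

Let trK (h : V) (A : set V) : tr (- h)%R @^-1` (tr h @^-1` A) = A.
Proof. by rewrite -comp_preimage; apply/seteqP; split => x; rewrite /tr/= subrK. Qed.

Lemma outer_tr (h : V) (A : set V) : outer (tr h @^-1` A) = outer A.
Proof.
apply/eqP; rewrite eq_le outer_tr_le/=.
by rewrite -{1}(trK h A) outer_tr_le.
Qed.

Lemma measurable_tr (h : V) : measurable_fun setT (tr h).
Proof.
move=> _ A mA; rewrite setTI.
change (caratheodory_measurable outer (tr h @^-1` A)) => X.
have XE : X = tr h @^-1` (tr (- h)%R @^-1` X).
  by rewrite -{1}(trK (- h)%R X) opprK.
rewrite XE -preimage_setI.
rewrite (_ : _ `&` ~` _ = tr h @^-1` ((tr (- h)%R @^-1` X) `&` ~` A))//.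
by rewrite !(outer_tr h); exact: mA.
Qed.

Lemma leb_tr (h : V) (S : set (LebRN R N)) : measurable S -> lm R N (tr h @^-1` S) = lm R N S.
Proof. by move=> _; exact: outer_tr. Qed.

Lemma I_tr (h : V) (f : LebRN R N -> R) : intg (lm R N) f ->
  I (lm R N) (fun x => f (tr h x)) = I (lm R N) f.
Proof.
by move=> fi; exact: (I_pres (measurable_tr h) (@leb_tr h) (intg_measurable fi) fi).
Qed.

Lemma intg_tr (h : V) (f : LebRN R N -> R) : intg (lm R N) f ->
  intg (lm R N) (fun x => f (tr h x)).
Proof.
by move=> fi; exact: (intg_pres (measurable_tr h) (@leb_tr h) (intg_measurable fi)).1.
Qed.

End translation.

Section hull.
Variables (R : realType) (M : nat).
Local Notation outer := (@lebesgue_outerM R M).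
Local Open Scope ereal_scope.

Lemma leb_outer_cover (A : set 'rV[R]_M) (e : R) : (0 < e)%R -> outer A < +oo ->
  exists F : (set 'rV[R]_M)^nat,
    [/\ A `<=` \bigcup_k F k, forall k, F k = set0 \/ exists a b, F k = box a b &
    outer (\bigcup_k F k) <= outer A + e%:E].
Proof.
move=> e0 Afin.
have Af : outer A \is a fin_num by rewrite ge0_fin_numE// outer_measure_ge0.
have [_ [F [mF AF] <-] hlt] := lb_ereal_inf_adherent e0 Af.
have hF : forall k, F k = set0 \/ exists a b, F k = box a b.
  apply: contrapT => /existsNP[k /not_orP[k0 kb]].
  move: hlt; rewrite ltNge => /negP; apply.
  rewrite (@eseries_pinfty _ _ _ k) ?leey//.
    by move=> j _; rewrite gt_eqF// (lt_le_trans _ (box_content_ge0 _)).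
  rewrite /box_content; set S := (X in ereal_inf X).
  suff -> : S = set0 by rewrite ereal_inf0.
  apply/seteqP; split => y //= -[[]//|[a [b [Fab _]]]].
  by apply: kb; exists a, b.
exists F; split => //.
apply: le_trans (ltW hlt); apply: le_trans (outer_measure_sigma_subadditive _ _) _.
apply: lee_nneseries => k _ //.
have [->|[a [b ->]]] := hF k; first by rewrite outer_measure0 box_content_ge0.
apply: le_ereal_inf_tmp => y [[E ->]|[a' [b' [E ->]]]].
  by rewrite [box a b]E outer_measure0.
by rewrite [box a b]E; exact: outer_box_le.
Qed.

(* A Borel hull; "Borel" is rendered by measurability of the preimage under
   every coordinatewise measurable map. *)
Lemma leb_hull (A : set 'rV[R]_M) : outer A < +oo ->
  exists S : set 'rV[R]_M, [/\ A `<=` S, outer S = outer A &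
    forall d (T : measurableType d) (g : T -> 'rV[R]_M),
      (forall i, measurable_fun setT (fun x => g x ord0 i)) -> measurable (g @^-1` S)].
Proof.
move=> Afin.
have /choice[F hF] : forall n : nat, exists F : (set 'rV[R]_M)^nat,
    [/\ A `<=` \bigcup_k F k, forall k, F k = set0 \/ exists a b, F k = box a b &
    outer (\bigcup_k F k) <= outer A + (n.+1%:R^-1)%:E].
  by move=> n; exact: leb_outer_cover.
exists (\bigcap_n \bigcup_k F n k); split.
- by move=> x Ax n _; have [h _ _] := hF n; exact: h.
- apply/eqP; rewrite eq_le; apply/andP; split; last first.
    by apply: le_outer_measure => x Ax n _; have [h _ _] := hF n; exact: h.
  apply/lee_addgt0Pr => e e0.
  have [n _ ne] := near_infty_natSinv_lt (PosNum e0).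
  have [_ _ h] := hF n.
  apply: (@le_trans _ _ (outer (\bigcup_k F n k))).
    by apply: le_outer_measure; exact: bigcap_inf.
  apply: (le_trans h); rewrite leeD2l// lee_fin ltW//.
  by have := ne n (leqnn n).
- move=> d T g mg; rewrite preimage_bigcap; apply: bigcapT_measurable => n.
  rewrite preimage_bigcup; apply: bigcup_measurable => k _.
  have [_ /(_ k)[->|[a [b ->]]] _] := hF n; first by rewrite preimage_set0.
  exact: measurable_preimage_box.
Qed.

End hull.

Section split_fubini.
Variables (R : realType) (N : nat).
Local Notation m := (lm R N \x @lebesgue_measure R)%E.
Implicit Type g : 'rV[R]_(N + 1) -> R.

(* [LebRN] is complete, so measurability on [LebRN R (N + 1)] does not imply measurability on the
   product, which Fubini requires. *)
Definition pmeas g := measurable_fun setT ((fun x => g (mk x.1 x.2)) : LebRN R N * R -> R).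

Let gE g : g = (fun x => g (mk x.1 x.2)) \o @split_pt R N.
Proof. by apply/funext => q /=; rewrite mkK. Qed.

Lemma pmeas_meas g : pmeas g -> measurable_fun setT (g : LebRN R (N + 1) -> R).
Proof. by move=> mg; rewrite (gE g); exact: (measurableT_comp mg (@measurable_split_pt R N)). Qed.

Lemma pmeas_continuous g : continuous g -> pmeas g.
Proof. exact: (measurable_comp_continuous (@measurable_mk R N)). Qed.

Lemma intg_split g : pmeas g ->
  intg (lm R (N + 1)) g <-> intg m (fun x => g (mk x.1 x.2)).
Proof.
move=> mg; rewrite {1}(gE g); apply: iff_sym.
exact: (@intg_pres _ _ _ _ _ (lm R (N + 1)) m _ (@measurable_split_pt R N) (@leb_prod R N) _ mg).
Qed.

Lemma I_split g : pmeas g -> intg (lm R (N + 1)) g ->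
  I (lm R (N + 1)) g = I m (fun x => g (mk x.1 x.2)).
Proof.
move=> mg gi; rewrite {1}(gE g).
apply: (@I_pres _ _ _ _ _ (lm R (N + 1)) m _ (@measurable_split_pt R N) (@leb_prod R N) _ mg).
exact/(intg_split mg).
Qed.

Lemma I_split1 g : pmeas g -> intg (lm R (N + 1)) g ->
  I (lm R (N + 1)) g = I (lm R N) (fun z => I (@lebesgue_measure R) (fun t => g (mk z t))).
Proof. by move=> mg gi; rewrite I_split// I_fubini1//; exact/(intg_split mg). Qed.

End split_fubini.

(** * A C^1 step function *)

Section step.
Variable R : realType.
Implicit Types s t x : R.

(** A quadratic remainder settles all points at once, including 0, where the positive part has a
    corner. *)
Lemma is_derive_estimate (f : R -> R) (x L C : R) :
  (forall h, `|f (x + h) - f x - L * h| <= C * h ^+ 2) -> is_derive x 1 f L.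
Proof.
move=> hf.
have C0 : 0 <= C by have := le_trans (normr_ge0 _) (hf 1); rewrite expr1n mulr1.
suff cv : h^-1 *: (f (h *: 1 + x) - f x) @[h --> 0^'] --> L.
  by apply: DeriveDef; [apply/cvg_ex; exists L|exact: cvg_lim].
apply/cvgrPdist_le => e e0; near=> h.
have h0 : h != 0 by near: h; exact: nbhs_dnbhs_neq.
have -> : L - h^-1 *: (f (h *: 1 + x) - f x) = - (h^-1 * (f (x + h) - f x - L * h)).
  by rewrite /GRing.scale/= mulr1 (addrC h); field.
rewrite normrN normrM normfV ler_pdivrMl ?normr_gt0//.
apply: (le_trans (hf h)); rewrite -real_normK ?num_real// expr2 mulrA.
rewrite mulrC ler_wpM2l//.
have : `|h| <= e / (C + 1).
  by near: h; apply: dnbhs0_le; rewrite divr_gt0// ltr_wpDl.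
rewrite ler_pdivlMr ?ltr_wpDl// => h1; apply: le_trans h1.
by rewrite mulrDr mulr1 mulrC lerDl.
Unshelve. all: by end_near. Qed.

Definition pp s : R := Num.max s 0.
Definition p2 s : R := pp s ^+ 2.

Lemma ppE s : (0 <= s /\ pp s = s) \/ (s <= 0 /\ pp s = 0).
Proof. by rewrite /pp; case: (leP s 0) => h; [right|left; split=> //; exact: ltW]. Qed.

Lemma pp_ge0 s : 0 <= pp s.
Proof. by case: (ppE s) => -[? ->]. Qed.

Lemma p2_ge0 s : 0 <= p2 s. Proof. exact: sqr_ge0. Qed.

Lemma is_derive_p2 x : is_derive x 1 p2 (2 * pp x).
Proof.
apply: (@is_derive_estimate _ _ _ 1) => h; rewrite mul1r /p2.
rewrite ler_norml; apply/andP; split;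
by case: (ppE x) => -[? ->]; case: (ppE (x + h)) => -[? ->]; nra.
Qed.

Lemma continuous_pp : continuous pp.
Proof. by move=> x; apply: continuous_max; [exact: cvg_id|exact: cvg_cst]. Qed.

Definition step_den s : R := p2 s + p2 (1 - s).
(** p(s) / (p(s) + p(1 - s)) with p the squared positive part: 0 for s <= 0, 1 for s >= 1, and C^1
    because the denominator never vanishes; [dstep] is the derivative in closed form. *)
Definition step s : R := p2 s / step_den s.
Definition dstep s : R := 2 * pp s * pp (1 - s) * (pp s + pp (1 - s)) / step_den s ^+ 2.

Lemma step_den_gt s : 1 / 2 <= step_den s.
Proof.
rewrite /step_den /p2; have := sqr_ge0 (s - 1 / 2).
case: (ppE s) => -[? ->]; case: (ppE (1 - s)) => -[? ->]; rewrite ?expr0n/= => ?.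
- by nra.
- by nra.
- by nra.
- by lra.
Qed.

Lemma step_den_gt0 s : 0 < step_den s.
Proof. by have := step_den_gt s; lra. Qed.

Lemma step0 s : s <= 0 -> step s = 0.
Proof. by move=> h; rewrite /step /p2 /pp max_r// expr0n/= mul0r. Qed.

Lemma step1 s : 1 <= s -> step s = 1.
Proof.
move=> h; rewrite /step /step_den /p2 {3}/pp max_r ?expr0n/= ?addr0; last by lra.
by rewrite divff// expf_neq0// /pp max_l; lra.
Qed.

Lemma step_ge0 s : 0 <= step s.
Proof. by apply: divr_ge0; [exact: p2_ge0|exact/ltW/step_den_gt0]. Qed.

Lemma step_le1 s : step s <= 1.
Proof. by rewrite /step ler_pdivrMr ?step_den_gt0// mul1r lerDl p2_ge0. Qed.

Lemma dstep_out s : s <= 0 \/ 1 <= s -> dstep s = 0.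
Proof.
move=> [h|h]; rewrite /dstep; first by rewrite {1}/pp max_r// mulr0 !mul0r.
by rewrite {2}/pp max_r ?mulr0 ?mul0r//; lra.
Qed.

Lemma dstep_ge0 s : 0 <= dstep s.
Proof.
by rewrite divr_ge0 ?sqr_ge0// mulr_ge0 ?addr_ge0 ?mulr_ge0 ?pp_ge0.
Qed.

Lemma dstep_le s : dstep s <= 8.
Proof.
have [h|/not_orP[/negP + /negP]] := pselect (s <= 0 \/ 1 <= s).
  by rewrite dstep_out//; lra.
rewrite -!ltNge => h0 h1.
rewrite /dstep ler_pdivrMr; last by rewrite exprn_gt0// step_den_gt0.
have := step_den_gt s; set D := step_den s => hD.
rewrite /pp !max_l; try by lra.
(* On 0 < s < 1 the numerator is at most 1/2 and the squared denominator at least 1/4. *)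
have : 1 / 4 <= D ^+ 2 by nra.
nra.
Qed.

Lemma is_derive_step_den x : is_derive x 1 step_den (2 * pp x + 2 * pp (1 - x) * -1).
Proof.
have h1 : is_derive x 1 (fun s => p2 (1 - s)) (2 * pp (1 - x) * -1).
  apply: (@is_derive1_comp _ p2 (fun s => 1 - s)); first exact: is_derive_p2.
  by rewrite -[X in is_derive _ _ _ X]sub0r; exact: is_deriveB.
have h2 := is_derive_p2 x.
exact: is_deriveD.
Qed.

Lemma is_derive_step x : is_derive x 1 step (dstep x).
Proof.
have h2 := is_derive_p2 x.
have h3 := is_derive_step_den x.
have D0 := step_den_gt0 x.
have h4 : is_derive x 1 (fun s => (step_den s)^-1)
    (- (step_den x) ^- 2 *: (2 * pp x + 2 * pp (1 - x) * -1)).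
  by apply: is_deriveV => //; rewrite gt_eqF.
have h5 := is_deriveM h2 h4.
apply: is_derive_eq h5 _.
rewrite /dstep /GRing.scale/= /step_den /p2; field.
by rewrite -/(p2 _) -/(p2 (1 - x)) -/(step_den x) gt_eqF.
Qed.

Lemma is_derive_continuous (f df : R -> R) :
  (forall x, is_derive x 1 f (df x)) -> continuous f.
Proof.
move=> h x; apply: differentiable_continuous; apply/derivable1_diffP.
by have [] := h x.
Qed.

Lemma continuous_dstep : continuous dstep.
Proof.
move=> x.
have c1 : pp s @[s --> x] --> pp x by exact: continuous_pp.
have c2 : pp (1 - s) @[s --> x] --> pp (1 - x).
  apply: (@continuous_comp _ _ _ (fun s => 1 - s) pp); last exact: continuous_pp.
  by apply: cvgB; [exact: cvg_cst|exact: cvg_id].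
apply: cvgM.
  by apply: cvgM; [apply: cvgM => //; apply: cvgM => //; exact: cvg_cst|exact: cvgD].
apply: cvgV; first by rewrite expf_neq0// gt_eqF// step_den_gt0.
have cd := is_derive_continuous is_derive_step_den.
by apply: (cvgM (cd x) (cd x)).
Qed.

Lemma continuous_step : continuous step.
Proof. exact: is_derive_continuous is_derive_step. Qed.

Lemma step_lip s t : `|step s - step t| <= 8 * `|s - t|.
Proof.
wlog st : s t / s < t.
  move=> H; have [|ts|->] := ltgtP s t; first exact: H.
    by rewrite distrC (distrC s); exact: H.
  by rewrite !subrr normr0 mulr0.
have [|c _ E] := @MVT R step dstep s t st (fun x _ => is_derive_step x).
  by apply: continuous_subspaceT; exact: continuous_step.
rewrite distrC E normrM (ger0_norm (dstep_ge0 c)) (distrC s).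
by rewrite ler_wpM2r ?dstep_le.
Qed.

End step.

Section on_sets.
Context {R : realType} {d : measure_display} {T : measurableType d}.
Variable m : {measure set T -> \bar R}.
Implicit Types (f : T -> R) (D : set T).

Lemma I_on D f : \int[m]_(x in D) f x = I m (fun x => f x * \1_D x).
Proof. by rewrite Rintegral_mkcond patch_indic. Qed.

Lemma integral_on D f : (\int[m]_(x in D) (f x)%:E = \int[m]_x (f x * \1_D x)%:E)%E.
Proof. by rewrite integral_mkcond epatch_indic. Qed.

Lemma intg_on D f : measurable D ->
  m.-integrable D (EFin \o f) <-> intg m (fun x => f x * \1_D x).
Proof. by move=> mD; rewrite integrable_mkcond// epatch_indic. Qed.

Lemma intg_indicM D f : measurable D -> intg m f -> intg m (fun x => f x * \1_D x).
Proof.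
move=> mD fi; apply: (@intg_dom _ _ _ m _ (fun x => `|f x|)).
- by apply: measurable_funM; [exact: intg_measurable fi|exact: measurable_indic].
- by move=> x; rewrite normrM indicE; case: (x \in D); rewrite /= ?normr1 ?mulr1// normr0 mulr0.
- exact: intg_abs.
Qed.

End on_sets.

Section ftc.
Variable R : realType.
Variables (f df : R -> R) (a : R).
Hypothesis fd : forall x : R, is_derive x 1 f (df x).
Hypothesis cdf : continuous df.
Hypothesis fa : forall t, t <= a -> f t = 0.
Hypothesis dfa : forall t, t <= a -> df t = 0.
Local Notation leb := (@lebesgue_measure R).

Lemma ftc_lt s : intg leb (fun t => df t * \1_[set t | t < s] t) /\
  I leb (fun t => df t * \1_[set t | t < s] t) = f s.
Proof.
have [sa|as_] := leP s a.
  have -> : (fun t => df t * \1_[set t | t < s] t) = fun=> 0.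
    apply/funext => t; rewrite indicE; case: (boolP (t \in _)); last by rewrite mulr0.
    by rewrite inE/= => ts; rewrite dfa ?mul0r//; lra.
  by rewrite I0 fa//; split => //; exact: intg0.
have -> : (fun t => df t * \1_[set t | t < s] t) = (fun t => df t * \1_(`[a, s[%classic) t).
  apply/funext => t; rewrite !indicE; have [ta|ta] := leP t a.
    by rewrite dfa// !mul0r.
  congr (_ * (nat_of_bool _)%:R); apply/idP/idP; rewrite !inE/= in_itv/=; first by move->; rewrite ltW.
  by case/andP.
have cc : {within `[a, s], continuous df} by exact: continuous_subspaceT.
have ic : leb.-integrable `[a, s] (EFin \o df).
  by apply: continuous_compact_integrable => //; exact: segment_compact.
have io : leb.-integrable `[a, s[ (EFin \o df).
  by apply: integrableS ic => //; apply: subset_itvl; rewrite bnd_simp.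
split; first exact/(intg_on leb df (measurable_itv _)).
rewrite -I_on Rintegral_itv_bndo_bndc// /Rintegral (@continuous_FTC2 _ df f)//.
- by rewrite -EFinB/= (fa (lexx a)) subr0.
- split.
  + by move=> x _; have [] := fd x.
  + by apply: cvg_at_right_filter; exact: (is_derive_continuous fd).
  + by apply: cvg_at_left_filter; exact: (is_derive_continuous fd).
- by move=> x _; rewrite derive1E; apply: derive_val.
Qed.

Lemma ftc_full b : (forall t, b <= t -> df t = 0) -> intg leb df /\ I leb df = f b.
Proof.
move=> dfb; have E : df = (fun t => df t * \1_[set t | t < b] t).
  apply/funext => t; rewrite indicE; case: (boolP (t \in _)); first by rewrite mulr1.
  by rewrite notin_setE/= => /negP; rewrite -leNgt => /dfb ->; rewrite mul0r.
by rewrite E; exact: ftc_lt.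
Qed.

End ftc.

Section step_integrals.
Variable R : realType.
Local Notation leb := (@lebesgue_measure R).

Lemma is_derive_affine (a b x : R) (f df : R -> R) :
  (forall y : R, is_derive y 1 f (df y)) -> is_derive x 1 (fun t => f (a * t + b)) (a * df (a * x + b)).
Proof.
move=> h; rewrite mulrC; apply: (@is_derive1_comp _ f (fun t => a * t + b)) => //.
have h2 : is_derive x 1 (fun t : R => a *: t + b) (a *: 1 + 0).
  by apply: is_deriveD.
by move: h2; rewrite addr0 [a *: 1]mulr1.
Qed.

Lemma continuous_affine (a b : R) (f : R -> R) : continuous f -> continuous (fun t => f (a * t + b)).
Proof.
move=> cf x; apply: (@continuous_comp _ _ _ (fun t => a * t + b) f); last exact: cf.
by apply: cvgD; [apply: cvgM; [exact: cvg_cst|exact: cvg_id]|exact: cvg_cst].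
Qed.

Lemma I_dstep_up (j b : R) : 0 < j ->
  intg leb (fun t => j * dstep (j * t + b)) /\ I leb (fun t => j * dstep (j * t + b)) = 1.
Proof.
move=> j0.
have := @ftc_full R (fun t => step (j * t + b)) (fun t => j * dstep (j * t + b)) (- b / j).
move=> /(_ _ _ _ _ ((1 - b) / j)) [].
- by move=> x; apply: is_derive_affine; exact: is_derive_step.
- move=> x; apply: cvgM; first exact: cvg_cst.
  exact: (continuous_affine (@continuous_dstep R)).
- by move=> t; rewrite ler_pdivlMr// => h; rewrite step0//; lra.
- by move=> t; rewrite ler_pdivlMr// => h; rewrite dstep_out ?mulr0//; left; lra.
- by move=> t; rewrite ler_pdivrMr// => h; rewrite dstep_out ?mulr0//; right; lra.
move=> h1 h2; split => //; rewrite h2 mulrCA divff ?gt_eqF// mulr1 subrK.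
by rewrite step1.
Qed.

Lemma I_dstep_down (j b : R) : 0 < j ->
  intg leb (fun t => j * dstep (b - j * t)) /\ I leb (fun t => j * dstep (b - j * t)) = 1.
Proof.
move=> j0.
have := @ftc_full R (fun t => 1 - step (- j * t + b)) (fun t => j * dstep (- j * t + b)) ((b - 1) / j).
move=> /(_ _ _ _ _ (b / j)) [].
- move=> x; rewrite -[X in is_derive _ _ _ X]opprK -sub0r -mulNr.
  by apply: is_deriveB; apply: is_derive_affine; exact: is_derive_step.
- move=> x; apply: cvgM; first exact: cvg_cst.
  exact: (continuous_affine (@continuous_dstep R)).
- by move=> t; rewrite ler_pdivlMr// => h; rewrite step1 ?subrr//; lra.
- by move=> t; rewrite ler_pdivlMr// => h; rewrite dstep_out ?mulr0//; right; lra.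
- by move=> t; rewrite ler_pdivrMr// => h; rewrite dstep_out ?mulr0//; left; lra.
have -> : (fun t => j * dstep (- j * t + b)) = (fun t => j * dstep (b - j * t)).
  by apply/funext => t; rewrite addrC mulNr.
move=> h1 h2; split => //; rewrite h2 step0 ?subr0//.
by rewrite mulNr mulrCA divff ?gt_eqF// mulr1 addNr.
Qed.

End step_integrals.

(** * C^1 functions on R^N *)

#[global] Instance rV_nbhs_pfilter (R : realType) (M : nat) (p : 'rV[R]_M) :
  ProperFilter (nbhs p).
Proof. exact: nbhs_pfilter. Qed.

Section lines.
Context {R : realType} {M : nat}.
Implicit Types (f : 'rV[R]_M -> R) (p v : 'rV[R]_M).

Lemma is_derive_line f p v (s d : R) :
  is_derive s 1 (fun h : R => f (h *: v + p)) d <-> is_derive (s *: v + p) v f d.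
Proof.
have E : (fun h : R => h^-1 *: (f (h *: v + (s *: v + p)) - f (s *: v + p))) =
    (fun h : R => h^-1 *: (((fun h : R => f (h *: v + p)) \o shift s) (h *: 1) -
                      (fun h : R => f (h *: v + p)) s)).
  apply/funext => h /=; congr (_ *: (f _ - _)).
  by rewrite addrA -scalerDl [h *: 1]mulr1.
split => -[h1 h2]; apply: DeriveDef.
- by rewrite /derivable /= E.
- by rewrite -h2 /derive /= E.
- by rewrite /derivable -E.
- by rewrite -h2 /derive -E.
Qed.

Lemma is_derive_line0 f p v (d : R) :
  is_derive (0 : R) 1 (fun h : R => f (h *: v + p)) d <-> is_derive p v f d.
Proof. by rewrite is_derive_line scale0r add0r. Qed.

Lemma line_mvt f (df : 'rV[R]_M -> R) v : (forall p, is_derive p v f (df p)) ->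
  forall p (s : R), exists c : R, `|c| <= `|s| /\ f (s *: v + p) - f p = s * df (c *: v + p).
Proof.
move=> fd p s; pose g (h : R) := f (h *: v + p).
have gd (x : R) : is_derive x 1 g (df (x *: v + p)) by apply/is_derive_line.
have cg := is_derive_continuous gd.
have g0 : f p = g 0 by rewrite /g scale0r add0r.
have [s0|s0|s0] := ltgtP 0 s; last first.
- by exists 0; rewrite -s0 scale0r add0r subrr mul0r.
- have [|c cin E] := @MVT R g _ s 0 s0 (fun x _ => gd x).
    exact: continuous_subspaceT.
  move: cin; rewrite in_itv/= => /andP[c1 c2].
  exists c; split; first by rewrite !ltr0_norm// lerN2 ltW.
  by rewrite g0 -/(g s) -[LHS]opprB E; ring.
- have [|c cin E] := @MVT R g _ 0 s s0 (fun x _ => gd x).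
    exact: continuous_subspaceT.
  move: cin; rewrite in_itv/= => /andP[c1 c2].
  exists c; split; first by rewrite !gtr0_norm// ltW.
  by rewrite g0 -/(g s) E; ring.
Qed.

End lines.

Section C1s.
Context {R : realType} {M : nat}.
Implicit Types (f g : 'rV[R]_M -> R) (p v : 'rV[R]_M).

(** The condition that [C1] puts on each component. Continuity of [f] is not part of it and is
    recovered in [C1s_continuous]. *)
Definition C1s f := forall i : 'I_M,
  (forall p, derivable f p (basisv R i)) /\ continuous (fun p => 'D_(basisv R i) f p).

Lemma C1s_intro f (df : 'I_M -> 'rV[R]_M -> R) :
  (forall i p, is_derive p (basisv R i) f (df i p)) -> (forall i, continuous (df i)) -> C1s f.
Proof.
move=> h c i; split => [p|]; first by have [] := h i p.
rewrite (_ : (fun p => _) = df i) //.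
by apply/funext => p; have [] := h i p.
Qed.

Lemma C1s_is_derive f i p : C1s f -> is_derive p (basisv R i) f ('D_(basisv R i) f p).
Proof. by move=> h; apply: DeriveDef => //; have [] := h i. Qed.

Lemma rV_ball_close (p q : 'rV[R]_M) (e : R) : 0 < e ->
  (forall j, `|p ord0 j - q ord0 j| < e) -> ball p e q.
Proof. by move=> e0 h; split => // i j; rewrite ord1; exact: h. Qed.

Lemma rV_nbhs (p : 'rV[R]_M) (A : set 'rV[R]_M) :
  nbhs p A <-> exists2 e : R, 0 < e & forall q : 'rV[R]_M, (forall j, `|p ord0 j - q ord0 j| < e) -> A q.
Proof.
split.
  move=> /nbhs_ballP[e /= e0 h]; exists e => // q hq.
  by apply: h; exact: rV_ball_close.
move=> [e e0 h]; apply/nbhs_ballP; exists e => // q [_ hq].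
by apply: h => j; exact: hq.
Qed.

(* Move from p to q one coordinate at a time, using the mean value theorem. *)
Lemma C1s_cvg f (p : 'rV[R]_M) : C1s f -> f q @[q --> p] --> f p.
Proof.
move=> hf.
pose hyb (k : nat) (q : 'rV[R]_M) : 'rV[R]_M :=
  \row_j (if (j < k)%N then q ord0 j else p ord0 j).
suff main k : (k <= M)%N -> f (hyb k q) @[q --> p] --> f p.
  have := main M (leqnn M).
  have -> // : (fun q => f (hyb M q)) = f; apply/funext => q; congr f.
  by apply/rowP => j; rewrite mxE ltn_ord.
elim: k => [_|k IH kM].
  have E0 : (fun q => f (hyb 0%N q)) = (fun=> f p).
    by apply/funext => q; congr f; apply/rowP => j; rewrite mxE.
  rewrite E0.
  exact: cvg_cst.
have cI := IH (ltnW kM); pose i := Ordinal kM.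
have cD : continuous (fun p => 'D_(basisv R i) f p) by have [] := hf i.
have /rV_nbhs[r r0 hr] : nbhs p [set q | `|'D_(basisv R i) f p - 'D_(basisv R i) f q| < 1].
  by have /cvgrPdist_lt := cD p; apply.
set L := `|'D_(basisv R i) f p| + 1.
have step (q : 'rV[R]_M) : (forall j, `|p ord0 j - q ord0 j| < r) ->
    `|f (hyb k.+1 q) - f (hyb k q)| <= `|p ord0 i - q ord0 i| * L.
  move=> hq.
  have -> : hyb k.+1 q = (q ord0 i - p ord0 i) *: basisv R i + hyb k q.
    apply/rowP => j; rewrite !mxE eqxx/= ltnS leq_eqVlt.
    have [->|ji] := eqVneq j i; first by rewrite eqxx ltnn/= mulr1 subrK.
    rewrite mulr0 add0r.
    by have -> : (nat_of_ord j == k) = false by apply: contraNF ji => /eqP jk; apply/eqP/val_inj.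
  have [c [hc ->]] := line_mvt (fun p => C1s_is_derive i p hf) (hyb k q) (q ord0 i - p ord0 i).
  rewrite normrM (distrC (q ord0 i)) ler_wpM2l//.
  rewrite -lerBlDl; apply: le_trans (lerB_dist _ _) _; rewrite distrC; apply/ltW/hr => j.
  rewrite !mxE eqxx/=.
  have [->|ji] := eqVneq j i.
    rewrite ltnn mulr1 opprD addrCA subrr addr0 normrN.
    by apply: le_lt_trans hc _; rewrite distrC.
  by rewrite mulr0 add0r; case: ifP => _; [exact: hq|rewrite subrr normr0].
apply/cvgrPdist_lt => e e0.
have L0 : 0 < L by rewrite ltr_wpDl.
have /rV_nbhs[r1 r10 hr1] : nbhs p [set q | `|f p - f (hyb k q)| < e / 2].
  by have /cvgrPdist_lt := cI; apply; lra.
apply/rV_nbhs; exists (Num.min (Num.min r r1) (e / 2 / L)).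
  by rewrite !lt_min r0 r10 !divr_gt0.
move=> q hq /=.
have h1 : forall j, `|p ord0 j - q ord0 j| < r.
  by move=> j; have := hq j; rewrite !lt_min => /andP[/andP[]].
have h2 : forall j, `|p ord0 j - q ord0 j| < r1.
  by move=> j; have := hq j; rewrite !lt_min => /andP[/andP[]].
have h3 : `|p ord0 i - q ord0 i| < e / 2 / L.
  by have := hq i; rewrite !lt_min => /andP[_].
have := step _ h1; have := hr1 _ h2 => /=.
move: h3; rewrite ltr_pdivlMr// => h3 h4 h5.
rewrite -(subrK (f (hyb k q)) (f p)) -addrA; apply: le_lt_trans (ler_normD _ _) _.
by rewrite (distrC (f (hyb k q))); lra.
Qed.

Lemma C1s_continuous f : C1s f -> continuous f.
Proof. by move=> hf p; exact: C1s_cvg. Qed.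

End C1s.

Section continuity.
Context {R : realType} {M : nat}.
Implicit Types (f g : 'rV[R]_M -> R).

Lemma cont_cst (c : R) : continuous ((fun=> c) : 'rV[R]_M -> R).
Proof. by move=> p; apply: (@cvg_cst R c _ _ (nbhs_filter p)). Qed.

Lemma cont_D f g : continuous f -> continuous g -> continuous (fun p => f p + g p).
Proof. by move=> cf cg p; apply: (@cvgD _ _ _ _ (nbhs_filter p)); [exact: cf|exact: cg]. Qed.

Lemma cont_N f : continuous f -> continuous (fun p => - f p).
Proof. by move=> cf p; apply: (@cvgN _ _ _ _ (nbhs_filter p)); exact: cf. Qed.

Lemma cont_B f g : continuous f -> continuous g -> continuous (fun p => f p - g p).
Proof. by move=> cf cg; apply: cont_D => //; exact: cont_N. Qed.

Lemma cont_M f g : continuous f -> continuous g -> continuous (fun p => f p * g p).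
Proof. by move=> cf cg p; apply: (@cvgM _ _ _ (nbhs_filter p)); [exact: cf|exact: cg]. Qed.

Lemma cont_sum (J : Type) (s : seq J) (F : J -> 'rV[R]_M -> R) :
  (forall i, continuous (F i)) -> continuous (fun p => \sum_(i <- s) F i p).
Proof.
move=> h; elim: s => [|i s IH].
  by under eq_fun do rewrite big_nil; exact: cont_cst.
by under eq_fun do rewrite big_cons; exact: cont_D.
Qed.

Lemma cont_coord (i : 'I_M) : continuous (fun p : 'rV[R]_M => p ord0 i).
Proof.
move=> p; apply/cvgrPdist_lt => e e0; apply/rV_nbhs; exists e => // q; exact.
Qed.

Lemma cont_comp (h : R -> R) f : continuous h -> continuous f -> continuous (fun p => h (f p)).
Proof. by move=> ch cf p; apply: (@continuous_comp _ _ _ f h p); [exact: cf|exact: ch]. Qed.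

Lemma cont_abs f : continuous f -> continuous (fun p => `|f p|).
Proof. by apply: cont_comp => x; exact: norm_continuous. Qed.

Lemma cont_epsP f : continuous f <-> forall (p : 'rV[R]_M) (e : R), 0 < e ->
  exists2 r : R, 0 < r & forall q : 'rV[R]_M, (forall j, `|p ord0 j - q ord0 j| < r) -> `|f p - f q| < e.
Proof.
split=> [cf p e e0|h p].
  by apply/rV_nbhs; have /cvgrPdist_lt := cf p; apply.
by apply/cvgrPdist_lt => e e0; apply/rV_nbhs; exact: h.
Qed.

Lemma compact_bound f (C : set 'rV[R]_M) : compact C -> continuous f ->
  exists2 B : R, 0 <= B & forall p, C p -> `|f p| <= B.
Proof.
move=> cC cf.
have /compact_bounded[B [_ hB]] : compact (f @` C).
  by apply: continuous_compact => //; exact: continuous_subspaceT.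
exists (`|B| + 1); first exact: addr_ge0.
by move=> p Cp; apply: (hB (`|B| + 1)); [rewrite (le_lt_trans (ler_norm _))// ltrDl|exists p].
Qed.

Lemma compact_in_bigbox (C : set 'rV[R]_M) : compact C -> exists k, C `<=` bigbox R M k.
Proof.
move=> cC.
have [|B B0 hB] := @compact_bound (fun p => \sum_i `|p ord0 i|) C cC.
  by apply: cont_sum => i; apply: cont_abs; exact: cont_coord.
exists (Num.truncn B).+1 => p Cp i; rewrite !mxE.
have : `|p ord0 i| < (Num.truncn B).+1%:R.
  apply: le_lt_trans (truncnS_gt _); apply: le_trans (hB _ Cp).
  rewrite [leRHS]ger0_norm; last by apply: sumr_ge0.
  by rewrite (bigD1 i)//= lerDl sumr_ge0.
by rewrite ltr_norml => /andP[/ltW -> ->].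
Qed.

Lemma rV_compact_closed (C : set 'rV[R]_M) : compact C -> closed C.
Proof. by apply: compact_closed; exact: norm_hausdorff. Qed.

Lemma leb_bigbox_fin k : (lm R M (bigbox R M k) < +oo)%E.
Proof. by rewrite /bigbox leb_box ltry. Qed.

Lemma leb_compact_fin (C : set 'rV[R]_M) : compact C -> (lm R M C < +oo)%E.
Proof.
move=> cC; have [k Ck] := compact_in_bigbox cC.
by apply: le_lt_trans (leb_bigbox_fin k); exact: le_outer_measure.
Qed.

Lemma leb_compact_measurable (C : set 'rV[R]_M) : compact C -> measurable (C : set (LebRN R M)).
Proof. by move=> cC; apply: measurable_closed; exact: rV_compact_closed. Qed.

Lemma supp_bound f (C : set 'rV[R]_M) : compact C -> continuous f -> (forall p, ~ C p -> f p = 0) ->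
  exists2 B : R, 0 <= B & forall p, `|f p| <= B * \1_C p.
Proof.
move=> cC cf f0; have [B B0 hB] := compact_bound cC cf; exists B => // p.
rewrite indicE; case: (boolP (p \in C)); first by rewrite inE mulr1 => /hB.
by rewrite notin_setE => /f0 ->; rewrite normr0 mulr0.
Qed.

Lemma intg_supp f (C : set 'rV[R]_M) : compact C -> continuous f -> (forall p, ~ C p -> f p = 0) ->
  intg (lm R M) f.
Proof.
move=> cC cf f0; have [B B0 hB] := supp_bound cC cf f0.
apply: (@intg_bnd _ _ (LebRN R M) (lm R M) C B f _ _ _ hB); [exact: leb_compact_measurable|exact: leb_compact_fin|exact: measurable_continuous].
Qed.

End continuity.

Section C1s_ops.
Context {R : realType} {M : nat}.
Implicit Types (f g : 'rV[R]_M -> R).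
Local Notation D i f := ('D_(basisv R i) f).

Lemma C1s_derivable f i p : C1s f -> derivable f p (basisv R i).
Proof. by move=> h; have [] := h i. Qed.

Lemma C1s_cont_partial f i : C1s f -> continuous (D i f).
Proof. by move=> h; have [] := h i. Qed.

Lemma C1s_cst (c : R) : C1s ((fun=> c) : 'rV[R]_M -> R).
Proof.
by apply: (@C1s_intro _ _ _ (fun=> fun=> 0)) => i; exact: cont_cst.
Qed.

Lemma is_derive_coord (i j : 'I_M) (p : 'rV[R]_M) :
  is_derive p (basisv R i) (fun q : 'rV[R]_M => q ord0 j) (j == i)%:R.
Proof.
have : is_derive (0 : R) 1 (fun h : R => (h *: basisv R i + p) ord0 j) (j == i)%:R.
  rewrite (_ : (fun h : R => _) = (fun h => (j == i)%:R * h + p ord0 j)); last first.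
    by apply/funext => h; rewrite !mxE eqxx/= mulrC.
  by have := @is_derive_affine R (j == i)%:R (p ord0 j) 0 id (fun=> 1) (fun y => is_derive_id _ _); rewrite mulr1.
exact: (@is_derive_line0 _ _ (fun q : 'rV[R]_M => q ord0 j) p (basisv R i) _).1.
Qed.

Lemma C1s_coord (j : 'I_M) : C1s (fun p : 'rV[R]_M => p ord0 j).
Proof.
apply: (@C1s_intro _ _ _ (fun i => fun=> (j == i)%:R)) => [i p|i]; first exact: is_derive_coord.
exact: cont_cst.
Qed.

Lemma C1s_D f g : C1s f -> C1s g -> C1s (fun p => f p + g p).
Proof.
move=> hf hg; apply: (@C1s_intro _ _ _ (fun i p => D i f p + D i g p)) => [i p|i].
  by apply: is_deriveD; exact: C1s_is_derive.
by apply: cont_D; exact: C1s_cont_partial.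
Qed.

Lemma D_M f g i p : C1s f -> C1s g ->
  D i (fun p => f p * g p) p = f p * D i g p + g p * D i f p.
Proof.
move=> hf hg.
by have [] := is_deriveM (C1s_is_derive i p hf) (C1s_is_derive i p hg).
Qed.

Lemma C1s_M f g : C1s f -> C1s g -> C1s (fun p => f p * g p).
Proof.
move=> hf hg; apply: (@C1s_intro _ _ _ (fun i p => f p * D i g p + g p * D i f p)) => [i p|i].
  exact: (is_deriveM (C1s_is_derive i p hf) (C1s_is_derive i p hg)).
by apply: cont_D; apply: cont_M; (exact: C1s_cont_partial || exact: C1s_continuous).
Qed.

Lemma C1s_sum (J : Type) (s : seq J) (F : J -> 'rV[R]_M -> R) :
  (forall i, C1s (F i)) -> C1s (fun p => \sum_(i <- s) F i p).
Proof.
move=> h; elim: s => [|i s IH].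
  by under eq_fun do rewrite big_nil; exact: C1s_cst.
by under eq_fun do rewrite big_cons; exact: C1s_D.
Qed.

Lemma is_derive_comp1 (h dh : R -> R) f i (d : R) p : (forall x : R, is_derive x 1 h (dh x)) ->
  is_derive p (basisv R i) f d -> is_derive p (basisv R i) (fun q => h (f q)) (dh (f p) * d).
Proof.
move=> hd /is_derive_line0 fd; apply/(is_derive_line0 (fun q => h (f q))).
have := @is_derive1_comp R h (fun s => f (s *: basisv R i + p)) 0 (dh (f p)) d.
by apply => //; rewrite scale0r add0r.
Qed.

Lemma C1s_comp (h dh : R -> R) f : (forall x : R, is_derive x 1 h (dh x)) -> continuous dh ->
  C1s f -> C1s (fun q => h (f q)).
Proof.
move=> hd cdh hf; apply: (@C1s_intro _ _ _ (fun i p => dh (f p) * D i f p)) => [i p|i].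
  by apply: is_derive_comp1 => //; exact: C1s_is_derive.
by apply: cont_M; [apply: cont_comp => //; exact: C1s_continuous|exact: C1s_cont_partial].
Qed.

Lemma D_comp (h dh : R -> R) f i p : (forall x : R, is_derive x 1 h (dh x)) ->
  C1s f -> D i (fun q => h (f q)) p = dh (f p) * D i f p.
Proof.
by move=> hd hf; have [] := is_derive_comp1 hd (C1s_is_derive i p hf).
Qed.

Lemma D_D f g i p : C1s f -> C1s g -> D i (fun p => f p + g p) p = D i f p + D i g p.
Proof.
move=> hf hg.
by have [] := is_deriveD (C1s_is_derive i p hf) (C1s_is_derive i p hg).
Qed.

Lemma D_supp f (C : set 'rV[R]_M) i p : closed C -> (forall p, ~ C p -> f p = 0) -> ~ C p ->
  D i f p = 0.
Proof.
move=> cC f0 nCp.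
have : \near p, f p = (fun=> 0) p.
  have : nbhs p (~` C) by apply: open_nbhs_nbhs; split => //; exact: closed_openC.
  by apply: filterS => q /f0.
by move=> /near_eq_derive -> //; exact: derive_cst.
Qed.

End C1s_ops.
Arguments C1s_cont_partial {R M f} i _.
Arguments C1s_derivable {R M f} i p _.
Arguments D_supp {R M f C} i {p} _ _ _.

(** * Mollification *)

Section int_partial.
Context {R : realType} {M : nat}.
Local Notation mu := (lm R M).
Local Notation D i f := ('D_(basisv R i) f).

(** Difference quotients of a compactly supported function integrate to 0 by translation invariance,
    and they converge dominatedly to the partial derivative. *)
Lemma I_D0 (f : 'rV[R]_M -> R) (C : set 'rV[R]_M) (i : 'I_M) : C1s f -> compact C ->
  (forall p, ~ C p -> f p = 0) -> I mu (D i f) = 0.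
Proof.
move=> hf cC f0.
have cf := C1s_continuous hf; have cD := C1s_cont_partial i hf.
have fi : intg mu f := intg_supp cC cf f0.
have D0 p : ~ C p -> D i f p = 0 := D_supp i (rV_compact_closed cC) f0.
have [B B0 hB] := supp_bound cC cD D0.
have [k Ck] := compact_in_bigbox cC.
pose u (n : nat) : R := n.+1%:R^-1.
have u0 n : 0 < u n by rewrite /u invr_gt0.
have u1 n : u n <= 1 by rewrite /u invf_le1// ler1n.
pose g n (x : LebRN R M) : R := (u n)^-1 * (f (tr (u n *: basisv R i) x) - f x).
have ftri n : intg mu (fun x => f (tr (u n *: basisv R i) x)) := intg_tr _ fi.
have g0 n : I mu (g n) = 0.
  by rewrite /g IZ ?IB ?I_tr ?subrr ?mulr0//; exact: intgB.
suff cv : I mu (g n) @[n --> \oo] --> I mu (D i f).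
  have cv0 : I mu (g n) @[n --> \oo] --> (0 : R).
    by under eq_fun do rewrite g0; exact: cvg_cst.
  exact: (cvg_unique _ cv cv0).
(* By the mean value theorem the quotients are bounded by [B]; as the increments are at most 1, they
   vanish outside the box enlarged by 1. *)
apply: (@I_dct _ _ _ mu g (D i f) (fun x => B * \1_(bigbox R M k.+1) x)).
- by move=> n; apply: (intg_measurable (m := mu)); apply: intgZ; exact: intgB.
- exact: measurable_continuous.
- apply/aeW => x.
  have /cvg_ex[l hl] := C1s_derivable i x hf.
  have -> : D i f x = l by exact: cvg_lim hl.
  have -> : (fun n => g n x) = (fun n => (u n)^-1 *: (f (u n *: basisv R i + x) - f x)).
    by apply/funext => n; rewrite /g /tr [in RHS](addrC (u n *: basisv R i)).
  apply: ((cvgr_dnbhsP _ _ _).1 hl u); split=> [n|]; first by rewrite gt_eqF.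
  exact: cvg_harmonic.
- apply: intgZ; apply: intg_indic; first exact: measurable_box.
  exact: leb_bigbox_fin.
- move=> n x; rewrite /g /tr.
  have [c [hc]] := line_mvt (fun p => C1s_is_derive i p hf) x (u n).
  rewrite (addrC (u n *: _)) => ->; rewrite mulrA mulVf ?gt_eqF// mul1r.
  apply: le_trans (hB _) _; rewrite ler_wpM2l// !indicE ler_nat.
  case: (boolP (_ \in C)) => //; rewrite inE => /Ck hk.
  rewrite (_ : _ \in _)// inE => j; have := hk j; rewrite !mxE eqxx/= -natr1.
  have : `|c * (j == i)%:R| <= 1.
    rewrite normrM; apply: (@le_trans _ _ (`|c| * 1)).
      by rewrite ler_wpM2l//; case: (j == i); rewrite /= ?normr1 ?normr0.
    by rewrite mulr1; apply: le_trans hc _; rewrite gtr0_norm.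
  by rewrite ler_norml => /andP[h1 h2] /andP[h3 h4]; apply/andP; split; lra.
Qed.

End int_partial.

Section kconv.
Context {R : realType} {N : nat} {d : measure_display} {T : measurableType d}.
Variables (m : {measure set T -> \bar R}) (pi : T -> 'rV[R]_N).
Hypothesis mpi : forall i, measurable_fun setT (fun q => pi q ord0 i).
Variable h : T -> R.
Hypothesis hi : intg m h.
Local Notation D i f := ('D_(basisv R i) f).
Implicit Types (k : 'rV[R]_N -> R) (z : 'rV[R]_N).

(* Mollification when [pi] is the identity; with [pi = pz] the variable [t] is also integrated out. *)
Definition kconv k z : R := I m (fun q => k (z - pi q) * h q).

Lemma measurable_shift z i : measurable_fun setT (fun q => (z - pi q) ord0 i).
Proof.
under eq_fun do rewrite !mxE.
by apply: measurable_funB; [exact: measurable_cst|exact: mpi].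
Qed.

Lemma measurable_kern k z : continuous k -> measurable_fun setT (fun q => k (z - pi q)).
Proof. by move=> ck; exact: (measurable_comp_continuous (measurable_shift z) ck). Qed.

Section bounded_kernel.
Variables (k : 'rV[R]_N -> R) (B : R).
Hypotheses (ck : continuous k) (kB : forall w, `|k w| <= B).

Lemma kconv_intg z : intg m (fun q => k (z - pi q) * h q).
Proof.
apply: (@intg_dom _ _ _ m _ (fun q => B * `|h q|)).
- by apply: measurable_funM; [exact: measurable_kern|exact: intg_measurable hi].
- by move=> q; rewrite normrM ler_wpM2r.
- by apply: intgZ; exact: intg_abs.
Qed.

(** A failure of continuity yields a sequence tending to [z] along which [kconv k] stays at distance
    [e]; dominated convergence, which is stated for sequences, excludes it. *)
Lemma kconv_continuous : continuous (kconv k).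
Proof.
apply/cont_epsP => z e e0.
apply: contrapT => hn.
have /choice[y hy] : forall n : nat, exists q : 'rV[R]_N,
    (forall j, `|z ord0 j - q ord0 j| < n.+1%:R^-1) /\ e <= `|kconv k z - kconv k q|.
  move=> n; apply: contrapT => /forallNP hq; apply: hn; exists n.+1%:R^-1 => // q hz.
  by rewrite ltNge; apply/negP => he; exact: (hq q).
have cv : kconv k (y n) @[n --> \oo] --> kconv k z.
  apply: (@I_dct _ _ _ m _ _ (fun q => B * `|h q|)).
  - by move=> n; exact: intg_measurable (kconv_intg _).
  - exact: intg_measurable (kconv_intg _).
  - apply/aeW => q; apply: cvgM; last exact: cvg_cst.
    apply/cvgrPdist_lt => e1 e10.
    have [r r0 hr] := (cont_epsP k).1 ck (z - pi q) e1 e10.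
    have [n0 _ hn0] := near_infty_natSinv_lt (PosNum r0).
    exists n0 => // n /= hnn; apply: hr => j; rewrite !mxE.
    rewrite [X in `|X|](_ : _ = z ord0 j - y n ord0 j); last by ring.
    have [/(_ j) h1 _] := hy n; apply: (lt_trans h1).
    exact: (hn0 n hnn).
  - by apply: intgZ; exact: intg_abs.
  - by move=> n q; rewrite normrM ler_wpM2r.
have /cvgrPdist_lt/(_ e e0)[n0 _ hn0] := cv.
have [_] := hy n0; rewrite leNgt => /negP; apply.
exact: (hn0 n0 (leqnn n0)).
Qed.

End bounded_kernel.

(** Differentiation under the integral sign along the line through [z]; the interval ]-1, 1[ is just
    a neighbourhood of the parameter 0. *)
Lemma kconv_is_derive k (B B' : R) i z : C1s k -> (forall w, `|k w| <= B) -> (forall w : 'rV[R]_N, `|D i k w| <= B') ->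
  is_derive z (basisv R i) (kconv k) (kconv (D i k) z).
Proof.
move=> hk kB DB; apply/is_derive_line0.
pose f (s : R) q := k (s *: basisv R i + z - pi q) * h q.
have fd (q : T) (s : R) : is_derive s 1 (f ^~ q) (D i k (s *: basisv R i + z - pi q) * h q).
  rewrite mulrC; apply: is_derive_eq.
    rewrite /f; under eq_fun do rewrite mulrC.
    apply: is_deriveZ; under eq_fun do rewrite -addrA.
    by apply/is_derive_line; rewrite addrA; exact: C1s_is_derive.
  by [].
have fi s : intg m (f s) by exact: (kconv_intg (C1s_continuous hk) kB).
have int01 : `](-1 : R), 1[%classic 0 by rewrite /= in_itv/= ltrN10 ltr01.
have Gi : m.-integrable setT (EFin \o (fun q => `|B' * h q|)).
  by apply: (intg_abs (m := m)); exact: intgZ.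
have fi' x : `](-1 : R), 1[%classic x -> m.-integrable setT (EFin \o f x) by move=> _; exact: fi.
have fd' x q : `](-1 : R), 1[%classic x -> setT q -> derivable (f ^~ q) x 1.
  by move=> _ _; have [] := fd q x.
have dfE q s : derive1 (f ^~ q) s = D i k (s *: basisv R i + z - pi q) * h q.
  by rewrite derive1E; have [] := fd q s.
have fb x q : `](-1 : R), 1[%classic x -> setT q -> `|derive1 (f ^~ q) x| <= `|B' * h q|.
  move=> _ _; rewrite dfE !normrM ler_wpM2r//.
  by apply: le_trans (DB _) _; exact: ler_norm.
have d1 := @derivable_under_integral R d T m f setT measurableT 0 (-1) 1 int01 fi' fd' _
  (fun q => normr_ge0 _) Gi fb.
have d2 := @differentiation_under_integral R d T m f setT measurableT 0 (-1) 1 int01 fi' fd' _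
  (fun q => normr_ge0 _) Gi fb.
apply: DeriveDef => //.
rewrite -derive1E; apply: (eq_trans d2).
rewrite /kconv /I; apply: eq_Rintegral => q _.
by apply: (eq_trans (dfE q 0)); rewrite scale0r add0r.
Qed.

Lemma kconv_C1s k (C : set 'rV[R]_N) : C1s k -> compact C -> (forall w, ~ C w -> k w = 0) ->
  C1s (kconv k) /\ forall i z, D i (kconv k) z = kconv (D i k) z.
Proof.
move=> hk cC k0.
have cle (S : set 'rV[R]_N) (B : R) w : 0 <= B -> B * \1_S w <= B.
  by move=> B0; rewrite indicE; case: (w \in S); rewrite ?mulr1 ?mulr0.
have [B B0 kB] := supp_bound cC (C1s_continuous hk) k0.
have DB i : exists B' : R, forall w, `|D i k w| <= B'.
  have D0 p : ~ C p -> D i k p = 0 := D_supp i (rV_compact_closed cC) k0.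
  have [B' B'0 hB'] := supp_bound cC (C1s_cont_partial i hk) D0.
  by exists B' => w; apply: le_trans (hB' w) _; exact: cle.
have kB' w : `|k w| <= B by apply: le_trans (kB w) _; exact: cle.
have dE i z : is_derive z (basisv R i) (kconv k) (kconv (D i k) z).
  by have [B' hB'] := DB i; exact: kconv_is_derive kB' hB'.
split; last by move=> i z; have [] := dE i z.
apply: (C1s_intro dE) => i; have [B' hB'] := DB i.
by apply: kconv_continuous hB'; exact: C1s_cont_partial.
Qed.

End kconv.

Section mollifier.
Context {R : realType} {N : nat}.
Implicit Types (w z : 'rV[R]_N) (dl : R).
Local Notation mu := (lm R N).
Local Notation D i f := ('D_(basisv R i) f).

Definition sqn w : R := \sum_i w ord0 i ^+ 2.
Definition cube dl : set 'rV[R]_N := [set w | forall i, `|w ord0 i| <= dl].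

Lemma compact_cube dl : compact (cube dl).
Proof.
have -> : cube dl = [set w : 'rV[R]_N | forall i, `[- dl, dl]%classic (w ord0 i)].
  by apply/seteqP; split => w h i; have := h i; rewrite /= in_itv/= ler_norml.
by apply: (@rV_compact R N (fun=> `[- dl, dl]%classic)) => i; exact: segment_compact.
Qed.

Lemma C1s_sqn : C1s sqn.
Proof. by apply: C1s_sum => i; under eq_fun do rewrite expr2; apply: C1s_M; exact: C1s_coord. Qed.

Lemma is_derive_sqn i w : is_derive w (basisv R i) sqn (2 * w ord0 i).
Proof.
suff <- : D i sqn w = 2 * w ord0 i by exact: C1s_is_derive C1s_sqn.
rewrite (_ : sqn = \sum_j (fun w : 'rV[R]_N => w ord0 j * w ord0 j)); last first.
  by apply/funext => x; rewrite fct_sumE /sqn; apply: eq_bigr => j _; rewrite expr2.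
rewrite derive_sum; last by move=> j; apply: C1s_derivable; apply: C1s_M; exact: C1s_coord.
rewrite (bigD1 i)//= big1 ?addr0 => [|j ji].
  rewrite D_M; try exact: C1s_coord.
  by have [_ ->] := is_derive_coord i i w; rewrite eqxx/= !mulr1; ring.
rewrite D_M; try exact: C1s_coord.
by have [_ ->] := is_derive_coord i j w; rewrite (negbTE ji)/= !mulr0 addr0.
Qed.

(** The squared positive part of dl^2 - |w|^2, a radial C^1 bump vanishing off the ball of radius
    dl. Being an explicit power, it has first moments that are integrals of derivatives. *)
Definition rho dl w : R := p2 (dl ^+ 2 - sqn w).

Lemma C1s_arg dl : C1s (fun w => dl ^+ 2 - sqn w).
Proof.
under eq_fun do rewrite -mulN1r.
by apply: C1s_D; [exact: C1s_cst|apply: C1s_M; [exact: C1s_cst|exact: C1s_sqn]].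
Qed.

Lemma is_derive_arg dl i w : is_derive w (basisv R i) (fun w => dl ^+ 2 - sqn w) (- (2 * w ord0 i)).
Proof.
rewrite -[X in is_derive _ _ _ X]sub0r; apply: is_deriveB; last exact: is_derive_sqn.
Qed.

Lemma C1s_rho dl : C1s (rho dl).
Proof.
have c : continuous (fun s : R => 2 * pp s).
  by move=> x; apply: cvgM; [exact: cvg_cst|exact: continuous_pp].
exact: (C1s_comp (@is_derive_p2 R) c (C1s_arg dl)).
Qed.

Lemma rho_ge0 dl w : 0 <= rho dl w. Proof. exact: p2_ge0. Qed.

Lemma sqn_ge dl w i : 0 <= dl -> dl < `|w ord0 i| -> dl ^+ 2 <= sqn w.
Proof.
move=> dl0 h; rewrite /sqn (bigD1 i)//=; apply: (@le_trans _ _ (w ord0 i ^+ 2)).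
  by rewrite -(real_normK (num_real (w ord0 i))) lerXn2r ?nnegrE ?(ltW h)// normr_ge0.
by rewrite lerDl sumr_ge0// => j _; exact: sqr_ge0.
Qed.

Lemma rho_out dl w : 0 <= dl -> ~ cube dl w -> rho dl w = 0.
Proof.
move=> dl0 /existsNP[i /negP]; rewrite -ltNge => h.
have := sqn_ge dl0 h; rewrite /rho /p2 => h2.
by rewrite /pp max_r ?expr0n//; lra.
Qed.

Lemma rho_even dl w : rho dl (- w) = rho dl w.
Proof. by rewrite /rho /sqn; congr (p2 (_ - _)); apply: eq_bigr => i _; rewrite mxE sqrrN. Qed.

Lemma is_derive_p3 (x : R) : is_derive x 1 (fun s : R => s * p2 s) (3 * p2 x).
Proof.
apply: is_derive_eq (is_deriveM (is_derive_id x 1) (is_derive_p2 x)) _.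
rewrite /GRing.scale/= /p2.
by case: (ppE x) => -[? ->]; ring.
Qed.

Lemma continuous_p2 : continuous (@p2 R).
Proof. exact: is_derive_continuous (@is_derive_p2 R). Qed.

Lemma intg_rhoM dl (f : 'rV[R]_N -> R) : 0 <= dl -> continuous f -> intg mu (fun w => rho dl w * f w).
Proof.
move=> dl0 cf.
apply: (intg_supp (@compact_cube dl)).
  by apply: cont_M => //; exact: C1s_continuous (C1s_rho dl).
by move=> p /(rho_out dl0) ->; rewrite mul0r.
Qed.

Lemma intg_rho dl : 0 <= dl -> intg mu (rho dl).
Proof.
move=> dl0; apply: (intg_supp (@compact_cube dl)); last by move=> p; exact: rho_out.
exact: C1s_continuous (C1s_rho dl).
Qed.

(* rho_dl(w) w_i is, up to a constant, the i-th partial of (dl^2 - |w|^2)_+^3 *)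
Lemma rho_moment dl i : 0 <= dl -> I mu (fun w => rho dl w * w ord0 i) = 0.
Proof.
move=> dl0; pose G w := (fun s : R => s * p2 s) (dl ^+ 2 - sqn w).
have hG : C1s G.
  have c : continuous (fun s : R => 3 * p2 s).
    by move=> x; apply: cvgM; [exact: cvg_cst|exact: continuous_p2].
  exact: (C1s_comp is_derive_p3 c (C1s_arg dl)).
have DG w : D i G w = -6 * (rho dl w * w ord0 i).
  have [_ ->] := is_derive_comp1 is_derive_p3 (is_derive_arg dl i w).
  by rewrite /rho; ring.
have G0 w : ~ cube dl w -> G w = 0.
  by move=> /(rho_out dl0) h; rewrite /G -/(rho dl w) h mulr0.
have := I_D0 i hG (@compact_cube dl) G0.
rewrite (_ : D i G = fun w => -6 * (rho dl w * w ord0 i)); last by apply/funext.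
rewrite IZ; last by apply: intg_rhoM => //; exact: cont_coord.
by move/eqP; rewrite mulf_eq0 => /orP[|/eqP//]; rewrite oppr_eq0 pnatr_eq0.
Qed.

Lemma rho_mass dl : 0 < dl -> 0 < I mu (rho dl).
Proof.
move=> dl0.
(* The sum of N squares of size at most e^2 is then at most (dl/2)^2; dividing by N + 1 covers N =
   0. *)
pose e : R := dl / 2 / N.+1%:R.
have e0 : 0 < e by rewrite !divr_gt0.
have eN : e * N.+1%:R = dl / 2 by rewrite /e divfK.
have hb w : box (const_mx (- e)) (const_mx e) w -> (dl ^+ 2 / 2) ^+ 2 <= rho dl w.
  move=> h.
  have hs : sqn w <= dl ^+ 2 / 4.
    apply: (@le_trans _ _ (\sum_(i < N) e ^+ 2)).
      apply: ler_sum => i _; have := h i; rewrite !mxE => /andP[h1 h2].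
      by nra.
    rewrite sumr_const card_ord -(mulr_natr (e ^+ 2)).
    have : e ^+ 2 * N%:R <= e ^+ 2 * N.+1%:R ^+ 2.
      rewrite ler_wpM2l ?sqr_ge0// -natrX ler_nat.
      by rewrite expnS expn1 (leq_trans (leqnSn N))// leq_pmulr.
    by rewrite -exprMn eN (_ : (dl / 2) ^+ 2 = dl ^+ 2 / 4); [lra|field].
  rewrite /rho /p2 lerXn2r ?nnegrE ?pp_ge0//; first by rewrite divr_ge0// sqr_ge0.
  by rewrite /pp le_max; apply/orP; left; have := sqr_ge0 dl; lra.
have ir := intg_rho (ltW dl0).
pose B := box (const_mx (- e) : 'rV[R]_N) (const_mx e).
have mB : measurable (B : set (LebRN R N)) := measurable_box _ _.
have Boo : (mu B < +oo)%E by rewrite /B leb_box ltry.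
have iB : intg mu \1_B := intg_indic mB Boo.
apply: (@lt_le_trans _ _ (I mu (fun w => (dl ^+ 2 / 2) ^+ 2 * \1_B w))).
  rewrite (IZ _ iB) (I_indic mu mB).
  rewrite mulr_gt0 ?exprn_gt0 ?divr_gt0 ?exprn_gt0//.
  rewrite [ltRHS](congr1 fine (leb_box _ _))/= /box_vol; apply: prodr_gt0 => i _.
  by rewrite !mxE lt_max opprK addr_gt0.
apply: I_le => //; first exact: intgZ.
move=> w; rewrite indicE; case: (boolP (w \in B)); last by rewrite mulr0 rho_ge0.
by rewrite inE mulr1 => /hb.
Qed.

Definition mol dl w : R := (I mu (rho dl))^-1 * rho dl w.

Lemma C1s_mol dl : C1s (mol dl).
Proof. by apply: C1s_M; [exact: C1s_cst|exact: C1s_rho]. Qed.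

Lemma mol_ge0 dl w : 0 < dl -> 0 <= mol dl w.
Proof. by move=> dl0; rewrite mulr_ge0 ?rho_ge0// invr_ge0 ltW// rho_mass. Qed.

Lemma mol_out dl w : 0 <= dl -> ~ cube dl w -> mol dl w = 0.
Proof. by move=> dl0 /(rho_out dl0) h; rewrite /mol h mulr0. Qed.

Lemma mol_even dl w : mol dl (- w) = mol dl w.
Proof. by rewrite /mol rho_even. Qed.

Lemma molC dl w z : mol dl (w - z) = mol dl (z - w).
Proof. by rewrite -mol_even opprB. Qed.

(** The derivative of an even kernel is odd; in [zflux_ph] this sign turns a derivative of the
    averaged field into minus a derivative of the mollified function. *)
Lemma D_mol_odd dl i w : D i (mol dl) (- w) = - D i (mol dl) w.
Proof.
have E x : D i (mol dl) x = (I mu (rho dl))^-1 * (2 * pp (dl ^+ 2 - sqn x) * - (2 * x ord0 i)).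
  rewrite /mol D_M; [|exact: C1s_cst|exact: C1s_rho].
  rewrite derive_cst mulr0 addr0; congr (_ * _).
  by have [_ ->] := is_derive_comp1 (@is_derive_p2 R) (is_derive_arg dl i x).
rewrite !E mxE (_ : sqn (- w) = sqn w); first by ring.
by apply: eq_bigr => j _; rewrite mxE sqrrN.
Qed.

Lemma intg_mol dl : 0 < dl -> intg mu (mol dl).
Proof.
by move=> dl0; apply: intgZ; apply: intg_rho; exact: ltW.
Qed.

Lemma I_mol dl : 0 < dl -> I mu (mol dl) = 1.
Proof.
move=> dl0; rewrite /mol IZ; first by rewrite mulVf// gt_eqF// rho_mass.
by apply: intg_rho; exact: ltW.
Qed.

Lemma I_mol_shift dl y : 0 < dl ->
  intg mu (fun z : LebRN R N => mol dl ((z : 'rV[R]_N) - y)) /\ I mu (fun z : LebRN R N => mol dl ((z : 'rV[R]_N) - y)) = 1.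
Proof.
move=> dl0; split.
  exact: (intg_tr (- y) (intg_mol dl0)).
by rewrite -(I_mol dl0); exact: (I_tr (- y) (intg_mol dl0)).
Qed.

(** The kernel has mass 1 and is centred, so averaging a coordinate around [y] gives back its value
    at [y] exactly. Applied to the linear [xi], it leaves no commutator error in [zflux_ph]. *)
Lemma mol_moment dl y i : 0 < dl ->
  intg mu (fun z : LebRN R N => mol dl ((z : 'rV[R]_N) - y) * (z : 'rV[R]_N) ord0 i) /\
  I mu (fun z : LebRN R N => mol dl ((z : 'rV[R]_N) - y) * (z : 'rV[R]_N) ord0 i) = y ord0 i.
Proof.
move=> dl0.
pose f (w : LebRN R N) := mol dl w * ((w : 'rV[R]_N) ord0 i).
have fi : intg mu f.
  rewrite /f /mol; under eq_fun do rewrite -mulrA.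
  by apply: intgZ; apply: intg_rhoM; [exact: ltW|exact: cont_coord].
have f0 : I mu f = 0.
  rewrite /f /mol; under eq_fun do rewrite -mulrA.
  rewrite IZ; last by apply: intg_rhoM; [exact: ltW|exact: cont_coord].
  by rewrite rho_moment ?mulr0// ltW.
have [h1 h2] := I_mol_shift y dl0.
have E : (fun z : LebRN R N => mol dl ((z : 'rV[R]_N) - y) * (z : 'rV[R]_N) ord0 i) =
    (fun z : LebRN R N => f (tr (- y) z) + y ord0 i * mol dl ((z : 'rV[R]_N) - y)).
  by apply/funext => z; rewrite /f /tr !mxE; ring.
have fti := intg_tr (- y) fi.
rewrite E; split; first by apply: intgD => //; exact: intgZ.
by rewrite ID//; [rewrite I_tr// f0 add0r IZ// h2 mulr1|exact: intgZ].
Qed.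

End mollifier.

(** * Convergence of mollifications in L^1 *)

Section l1_approx.
Context {R : realType} {N : nat}.
Local Notation mu := (lm R N).
Local Notation mm := (lm R N \x lm R N)%E.
Local Notation V := 'rV[R]_N.
Implicit Types (f g : LebRN R N -> R) (dl e : R).

Lemma intg_prod2 {d1 d2} {T1 : measurableType d1} {T2 : measurableType d2}
    (m1 : {sigma_finite_measure set T1 -> \bar R}) (m2 : {sigma_finite_measure set T2 -> \bar R})
    (F : T1 * T2 -> R) (g : T2 -> R) : measurable_fun setT F ->
  (forall y, (\int[m1]_x `|F (x, y)|%:E <= (g y)%:E)%E) -> intg m2 g -> intg (m1 \x m2)%E F.
Proof.
move=> mF Fg gi; apply: intgP => //.
rewrite fubini_tonelli2//; last by apply/measurable_EFinP; exact: measurableT_comp.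
have /integrableP[mg] := gi; apply: le_lt_trans.
apply: ge0_le_integral => //.
- by move=> x _; apply: integral_ge0.
- by apply: measurable_fun_fubini_tonelli_G => //; apply/measurable_EFinP; exact: measurableT_comp.
- by apply: measurableT_comp.
- by move=> y _; apply: (le_trans (Fg y)); rewrite /= lee_fin ler_norm.
Qed.

Definition shear (x : LebRN R N * LebRN R N) : V := (x.1 : V) - (x.2 : V).

Lemma measurable_shear i : measurable_fun setT (fun x => shear x ord0 i).
Proof.
under eq_fun do rewrite !mxE.
apply: measurable_funB.
  exact: (measurableT_comp (@measurable_coord R N i) measurable_fst).
exact: (measurableT_comp (@measurable_coord R N i) measurable_snd).
Qed.

Lemma measurable_mol2 dl : measurable_fun setT (fun x => mol dl (shear x)).
Proof.
exact: (measurable_comp_continuous measurable_shear (C1s_continuous (C1s_mol dl))).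
Qed.

Lemma int_mol_l dl (y : V) (c : R) : 0 < dl ->
  (\int[mu]_x `|mol dl ((x : V) - y) * c|%:E = `|c|%:E)%E.
Proof.
move=> dl0; have [h1 h2] := I_mol_shift y dl0.
have E : (fun x : LebRN R N => `|mol dl ((x : V) - y) * c|) =
    (fun x : LebRN R N => `|c| * mol dl ((x : V) - y)).
  by apply/funext => x; rewrite normrM ger0_norm ?mol_ge0// mulrC.
have hi : intg mu (fun x : LebRN R N => `|mol dl ((x : V) - y) * c|) by rewrite E; exact: intgZ.
by rewrite (intgE hi) E IZ// h2 mulr1.
Qed.

Lemma int_mol_r dl (y : V) (c : R) : 0 < dl ->
  (\int[mu]_x `|mol dl (y - (x : V)) * c|%:E = `|c|%:E)%E.
Proof.
move=> dl0; rewrite -(@int_mol_l dl y c dl0).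
by congr (integral _ _ _); apply/funext => x; rewrite molC.
Qed.

Lemma intg_mol1 dl f : 0 < dl -> intg mu f ->
  intg mm (fun x => mol dl (shear x) * f x.1) /\
  I mm (fun x => mol dl (shear x) * f x.1) = I mu f.
Proof.
move=> dl0 fi.
have mf := intg_measurable fi.
have h : intg mm (fun x => mol dl (shear x) * f x.1).
  apply: (@intg_prod _ _ _ _ _ mu mu _ (fun x => `|f x|)).
  - apply: measurable_funM; first exact: measurable_mol2.
    exact: (measurableT_comp mf measurable_fst).
  - by move=> x; have h := @int_mol_r dl (x : V) (f x) dl0; rewrite h.
  - exact: intg_abs.
split=> //; rewrite (I_fubini1 h); congr I; apply/funext => x.
have [h1 h2] := I_mol_shift (x : V) dl0.
have E : (fun y : LebRN R N => mol dl (shear (x, y)) * f x) =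
    (fun y : LebRN R N => f x * mol dl ((y : V) - (x : V))).
  by apply/funext => y; rewrite mulrC /shear/= molC.
by rewrite E (IZ _ h1) h2 mulr1.
Qed.

Lemma intg_mol2 dl f : 0 < dl -> intg mu f ->
  intg mm (fun x => mol dl (shear x) * f x.2) /\
  I mm (fun x => mol dl (shear x) * f x.2) = I mu f.
Proof.
move=> dl0 fi.
have mf := intg_measurable fi.
have h : intg mm (fun x => mol dl (shear x) * f x.2).
  apply: (@intg_prod2 _ _ _ _ mu mu _ (fun x => `|f x|)).
  - apply: measurable_funM; first exact: measurable_mol2.
    exact: (measurableT_comp mf measurable_snd).
  - by move=> x; have h := @int_mol_l dl (x : V) (f x) dl0; rewrite h.
  - exact: intg_abs.
split=> //; rewrite (I_fubini2 h); congr I; apply/funext => x.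
have [h1 h2] := I_mol_shift (x : V) dl0.
have E : (fun y : LebRN R N => mol dl (shear (y, x)) * f x) =
    (fun y : LebRN R N => f x * mol dl ((y : V) - (x : V))).
  by apply/funext => y; rewrite mulrC.
by rewrite E (IZ _ h1) h2 mulr1.
Qed.

(** Integrated, this bounds the L^1 distance between [f] and its mollification ([kconv_mol_l1]). It
    involves only increments of [f], which makes it easy to estimate for sums, limits and
    indicators. *)
Definition osc_int dl f (x : LebRN R N * LebRN R N) : R := mol dl (shear x) * `|f x.2 - f x.1|.
Definition osc dl f : R := I mm (osc_int dl f).

Lemma osc_intg dl f : 0 < dl -> intg mu f -> intg mm (osc_int dl f).
Proof.
move=> dl0 fi; have mf := intg_measurable fi.
have [h1 _] := intg_mol1 dl0 (intg_abs fi).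
have [h2 _] := intg_mol2 dl0 (intg_abs fi).
apply: (intg_dom _ _ (intgD h2 h1)).
  apply: measurable_funM; first exact: measurable_mol2.
  apply: measurableT_comp => //; apply: measurable_funB.
    exact: (measurableT_comp mf measurable_snd).
  exact: (measurableT_comp mf measurable_fst).
move=> x /=; rewrite /osc_int normrM normr_id ger0_norm ?mol_ge0// -mulrDr.
by rewrite ler_wpM2l ?mol_ge0//; exact: ler_normB.
Qed.

Lemma osc_le dl f (g1 g2 : LebRN R N -> R) : 0 < dl -> intg mu f -> intg mu g1 -> intg mu g2 ->
  (forall y z, `|f y - f z| <= `|g1 y - g1 z| + `|g2 y - g2 z|) ->
  osc dl f <= osc dl g1 + osc dl g2.
Proof.
move=> dl0 fi g1i g2i h; rewrite /osc -ID; try exact: osc_intg.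
apply: I_le; [exact: osc_intg|by apply: intgD; exact: osc_intg|].
by move=> x; rewrite /osc_int -mulrDr ler_wpM2l ?mol_ge0.
Qed.

Lemma osc_norm dl f : 0 < dl -> intg mu f -> osc dl f <= 2 * I mu (fun x => `|f x|).
Proof.
move=> dl0 fi.
have [h1 e1] := intg_mol1 dl0 (intg_abs fi).
have [h2 e2] := intg_mol2 dl0 (intg_abs fi).
rewrite mulr2n mulrDl mul1r -{1}e2 -e1 -ID//.
apply: I_le; [exact: osc_intg|exact: intgD|].
move=> x; rewrite /osc_int -mulrDr ler_wpM2l ?mol_ge0//.
exact: ler_normB.
Qed.

Lemma osc_ge0 dl f : 0 < dl -> 0 <= osc dl f.
Proof. by move=> dl0; apply: I_ge0 => x; rewrite mulr_ge0 ?mol_ge0. Qed.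

Definition small_osc f := forall e, 0 < e ->
  exists2 d0 : R, 0 < d0 & forall dl, 0 < dl -> dl < d0 -> osc dl f <= e.

Lemma small_osc2 f (g1 g2 : LebRN R N -> R) : intg mu f -> intg mu g1 -> intg mu g2 ->
  (forall y z, `|f y - f z| <= `|g1 y - g1 z| + `|g2 y - g2 z|) ->
  small_osc g1 -> small_osc g2 -> small_osc f.
Proof.
move=> fi g1i g2i h s1 s2 e e0.
have [d1 d10 h1] := s1 (e / 2) ltac:(lra).
have [d2 d20 h2] := s2 (e / 2) ltac:(lra).
exists (Num.min d1 d2); first by rewrite lt_min d10.
move=> dl dl0; rewrite lt_min => /andP[l1 l2].
apply: le_trans (osc_le dl0 fi g1i g2i h) _.
by have := h1 _ dl0 l1; have := h2 _ dl0 l2; lra.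
Qed.

(** [osc] is at most twice the L^1 norm, so smallness passes through L^1 approximation. *)
Lemma small_osc_lim f : intg mu f ->
  (forall e, 0 < e -> exists g, [/\ intg mu g, small_osc g & I mu (fun x => `|f x - g x|) <= e]) ->
  small_osc f.
Proof.
move=> fi h e e0.
have [g [gi sg hg]] := h (e / 4) ltac:(lra).
have [d1 d10 h1] := sg (e / 2) ltac:(lra).
exists d1 => // dl dl0 l1.
have fgi := intgB fi gi.
apply: le_trans (osc_le dl0 fi gi fgi _) _.
  move=> y z; rewrite [X in `|X|](_ : _ = (g y - g z) + ((f y - g y) - (f z - g z))); last by ring.
  exact: ler_normD.
by have := osc_norm dl0 fgi; have := h1 _ dl0 l1; lra.
Qed.

Lemma small_oscZ (c : R) f : intg mu f -> small_osc f -> small_osc (fun x => c * f x).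
Proof.
move=> fi sf e e0.
have [d1 d10 h1] := sf (e / (`|c| + 1)) ltac:(by rewrite divr_gt0// ltr_wpDl).
exists d1 => // dl dl0 l1.
have -> : osc dl (fun x => c * f x) = `|c| * osc dl f.
  rewrite /osc -IZ; last exact: osc_intg.
  by congr I; apply/funext => x; rewrite /osc_int -mulrBr normrM mulrCA.
have := h1 _ dl0 l1; rewrite ler_pdivlMr ?ltr_wpDl// => h2.
apply: le_trans h2; rewrite mulrC ler_wpM2l ?osc_ge0//.
by rewrite lerDl.
Qed.

Lemma cont_box_vol (a b : V) : continuous (fun s : R =>
  box_vol (\row_i (a ord0 i - s)) (\row_i (b ord0 i + s)) : R).
Proof.
rewrite /box_vol; elim: (index_enum _) => [|i r IH] s.
  rewrite (_ : (fun s : R => _) = fun=> 1); first exact: cvg_cst.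
  by apply/funext => x; rewrite big_nil.
pose g (x : R) := Num.max (b ord0 i + x - (a ord0 i - x)) 0.
pose G (x : R) := \prod_(j <- r) Num.max ((\row_i (b ord0 i + x)) ord0 j -
  (\row_i (a ord0 i - x)) ord0 j) 0.
rewrite (_ : (fun s : R => _) = fun x => g x * G x); last first.
  by apply/funext => x; rewrite big_cons /g !mxE.
apply: (@cvgM _ _ _ _ g G); last exact: IH.
apply: (@continuous_comp _ _ _ (fun x : R => b ord0 i + x - (a ord0 i - x)) (@pp R)).
  by apply: cvgB; [apply: cvgD; [exact: cvg_cst|exact: cvg_id]|apply: cvgB; [exact: cvg_cst|exact: cvg_id]].
exact: continuous_pp.
Qed.

Lemma intg_box (a b : V) : intg mu \1_(box a b : set (LebRN R N)).
Proof.
have h : (mu (box a b : set (LebRN R N)) < +oo)%E by rewrite leb_box ltry.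
exact: (intg_indic (measurable_box a b) h).
Qed.

Lemma I_box (a b : V) : I mu \1_(box a b : set (LebRN R N)) = box_vol a b.
Proof. exact: (eq_trans (I_indic mu (measurable_box a b)) (congr1 fine (leb_box a b))). Qed.

(** Within the radius of the kernel the indicator changes only in the shell between a shrunken and
    an enlarged box, and the volume of the shell tends to 0 by continuity in the margin. *)
Lemma small_osc_box (a b : V) : small_osc \1_(box a b : set (LebRN R N)).
Proof.
move=> e e0.
pose Bp (s : R) : set (LebRN R N) := box (\row_i (a ord0 i - s)) (\row_i (b ord0 i + s)).
pose vol (s : R) : R := box_vol (\row_i (a ord0 i - s)) (\row_i (b ord0 i + s)).
have [d0 d00 hd0] : exists2 d0 : R, 0 < d0 & forall s, `|s| < d0 -> `|vol 0 - vol s| < e / 2.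
  have /cvgrPdist_lt/(_ (e / 2) ltac:(lra))/nbhs_ballP[d0 /= d00 h] := @cont_box_vol a b 0.
  exists d0 => // s hs; apply: h; rewrite /ball/= sub0r normrN//.
exists (d0 / 2); first lra.
move=> dl dl0 ldl.
have iB s : intg mu \1_(Bp s) := intg_box _ _.
have ibox : intg mu \1_(box a b : set (LebRN R N)).
  exact: intg_box.
(* The margin exceeds the kernel radius [dl], and [dl < d0 / 2] keeps it below [d0]. *)
set s := 2 * dl.
have sd0 : `|s| < d0 by rewrite gtr0_norm /s; lra.
have sd0' : `|- s| < d0 by rewrite normrN.
have hle : osc dl \1_(box a b : set (LebRN R N)) <=
    I mm (fun x => mol dl (shear x) * (\1_(Bp s) x.1 - \1_(Bp (- s)) x.1)).
  have iBB := intgB (iB s) (iB (- s)).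
  apply: I_le; [exact: osc_intg|by have [] := intg_mol1 dl0 iBB|].
  move=> [y z]; rewrite /osc_int/=.
  have [c|nc] := pselect (cube dl (shear (y, z))); last first.
    by rewrite (mol_out (ltW dl0) nc) !mul0r.
  rewrite ler_wpM2l ?mol_ge0//.
  have cc i : `|(y : V) ord0 i - (z : V) ord0 i| <= dl by have := c i; rewrite /shear !mxE.
  have sub1 : Bp (- s) y -> Bp s y.
    by move=> h i; have := h i; rewrite !mxE /s => /andP[? ?]; apply/andP; split; lra.
  have sub2 : Bp (- s) y -> box a b z.
    move=> h i; have := h i; rewrite !mxE /s => /andP[? ?].
    by have := cc i; rewrite ler_norml => /andP[? ?]; apply/andP; split; lra.
  have sub3 : Bp (- s) y -> box a b y.
    by move=> h i; have := h i; rewrite !mxE /s => /andP[? ?]; apply/andP; split; lra.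
  have sub4 : box a b z -> Bp s y.
    move=> h i; have := h i; rewrite !mxE /s => /andP[? ?].
    by have := cc i; rewrite ler_norml => /andP[? ?]; apply/andP; split; lra.
  have sub5 : box a b y -> Bp s y.
    by move=> h i; have := h i; rewrite !mxE /s => /andP[? ?]; apply/andP; split; lra.
  have ind (A : set (LebRN R N)) x : \1_A x = (if `[< A x >] then 1 else 0) :> R.
    by rewrite indicE; case: asboolP => h; [rewrite mem_set|rewrite memNset].
  rewrite !ind; repeat case: asboolP; rewrite ?subrr ?subr0 ?sub0r ?normrN ?normr1 ?normr0 ?ler01 //; tauto.
apply: (le_trans hle).
have [_ ->] := intg_mol1 dl0 (intgB (iB s) (iB (- s))).
rewrite (IB (iB s) (iB (- s))) /Bp !I_box -/(vol s) -/(vol (- s)).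
have := hd0 _ sd0; have := hd0 _ sd0'; rewrite !ltr_norml => /andP[? ?] /andP[? ?]; lra.
Qed.

End l1_approx.

Lemma measurable_abs {R : realType} {d} {T : measurableType d} (f : T -> R) :
  measurable_fun setT f -> measurable_fun setT (fun x => `|f x|).
Proof. by move=> mf; exact: measurableT_comp. Qed.

Section l1_approx2.
Context {R : realType} {N : nat}.
Local Notation mu := (lm R N).
Local Notation V := 'rV[R]_N.
Implicit Types (f g : LebRN R N -> R) (dl e : R) (A B : set (LebRN R N)).

Lemma indicE_asbool (T : Type) (A : set T) x : \1_A x = (if `[< A x >] then 1 else 0) :> R.
Proof. by rewrite indicE; case: asboolP => h; [rewrite mem_set|rewrite memNset]. Qed.

Lemma indicU_diff (T : Type) (A B : set T) x y :
  `|\1_(A `|` B) x - \1_(A `|` B) y| <= `|\1_A x - \1_A y| + `|\1_B x - \1_B y| :> R.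
Proof.
rewrite !indicE !in_setU.
by case: (x \in A); case: (x \in B); case: (y \in A); case: (y \in B);
  rewrite /= ?subrr ?subr0 ?sub0r ?normrN ?normr1 ?normr0; lra.
Qed.

Definition osc_set A := [/\ measurable A, (mu A < +oo)%E & small_osc \1_A].

Lemma osc_set0 : osc_set set0.
Proof.
split; [exact: measurable0|by rewrite measure0|].
have z0 : intg mu (\1_set0 : LebRN R N -> R) by apply: intg_indic; [exact: measurable0|rewrite measure0].
move=> e e0; exists 1 => // dl dl0 _; apply: (le_trans (osc_norm dl0 z0)).
rewrite (_ : (fun x => _) = fun=> 0); first by rewrite I0 mulr0 ltW.
by apply/funext => x; rewrite indicE in_set0 normr0.
Qed.

Lemma osc_setU A B : osc_set A -> osc_set B -> osc_set (A `|` B).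
Proof.
move=> [mA Aoo sA] [mB Boo sB].
have mAB : measurable (A `|` B) by exact: measurableU.
have ABoo : (mu (A `|` B) < +oo)%E.
  by apply: (@le_lt_trans _ _ (mu A + mu B)%E); [exact: measureU2|exact: lte_add_pinfty].
split=> //; apply: (small_osc2 (intg_indic mAB ABoo) (intg_indic mA Aoo) (intg_indic mB Boo)) => //.
by move=> y z; exact: indicU_diff.
Qed.

Lemma osc_set_bigU (F : nat -> set (LebRN R N)) n : (forall k, osc_set (F k)) ->
  osc_set (\big[setU/set0]_(k < n) F k).
Proof.
move=> h; elim: n => [|n IH]; first by rewrite big_ord0; exact: osc_set0.
by rewrite big_ord_recr/=; exact: osc_setU.
Qed.

(** Cover [A] by boxes with excess measure at most e/2, then keep finitely many of them, losing at
    most e/2 again. *)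
Lemma osc_set_fin A : measurable A -> (mu A < +oo)%E -> osc_set A.
Proof.
move=> mA Aoo; split => //.
apply: small_osc_lim; first exact: intg_indic.
move=> e e0.
have Af : mu A \is a fin_num by rewrite ge0_fin_numE// measure_ge0.
have e20 : 0 < e / 2 by lra.
have [F [AF hF hlt]] : exists F : (set V)^nat,
    [/\ A `<=` \bigcup_k F k, forall k, F k = set0 \/ exists a b, F k = box a b &
    (mu (\bigcup_k F k) <= mu A + (e / 2)%:E)%E].
  have [F [AF hF hlt]] := @leb_outer_cover R N A (e / 2) e20 Aoo.
  by exists F.
have oF k : osc_set (F k).
  have [->|[a [b ->]]] := hF k; first exact: osc_set0.
  by split; [exact: measurable_box|rewrite leb_box ltry|exact: small_osc_box].
have mF k : measurable (F k : set (LebRN R N)) by have [] := oF k.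
pose U := \bigcup_k F k; pose Un n := \big[setU/set0]_(k < n) F k.
have mU : measurable (U : set (LebRN R N)) by exact: bigcup_measurable.
have Uoo : (mu U < +oo)%E by apply: le_lt_trans hlt _; rewrite lte_add_pinfty// ltry.
have Uf : mu U \is a fin_num by rewrite ge0_fin_numE// measure_ge0.
have oUn n : osc_set (Un n) by exact: osc_set_bigU.
have UnU n : Un n `<=` U by rewrite /Un -bigcup_mkord; apply: bigcup_sub => k _; exact: bigcup_sup.
have cv : (mu (Un n) @[n --> \oo] --> mu U)%E.
  have mUn n : measurable (Un n : set (LebRN R N)) by have [] := oUn n.
  have UE : U = \bigcup_n Un n.
    apply/seteqP; split => x.
      by move=> [k _ Fk]; exists k.+1 => //; rewrite /Un big_ord_recr/=; right.
    by move=> [n _] /UnU.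
  have mUU : measurable (\bigcup_n Un n : set (LebRN R N)) by rewrite -UE.
  rewrite UE; apply: (@nondecreasing_cvg_mu _ _ _ mu Un mUn mUU).
  move=> i j ij; apply/subsetPset => x; rewrite /Un -!bigcup_mkord => -[k /= ki Fk].
  by exists k => //=; exact: leq_trans ij.
have [n hn] : exists n, fine (mu U) - fine (mu (Un n)) < e / 2.
  rewrite -(fineK Uf) in cv.
  have cv' : fine (mu (Un n)) @[n --> \oo] --> fine (mu U) by exact: fine_cvg cv.
  have /cvgrPdist_lt/(_ (e / 2) e20)[n0 _ h] := cv'.
  by exists n0; have := h n0 (leqnn n0); rewrite ltr_norml => /andP[].
have [mUn Unoo sUn] := oUn n.
have iA := intg_indic mA Aoo; have iU := intg_indic mU Uoo; have iUn := intg_indic mUn Unoo.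
exists \1_(Un n); split => //.
apply: (@le_trans _ _ (I mu (fun x => (\1_U x - \1_A x) + (\1_U x - \1_(Un n) x)))).
  apply: I_le; [by apply: intg_abs; exact: intgB|by apply: intgD; exact: intgB|].
  move=> x; rewrite !indicE_asbool.
  have h1 : A x -> U x by exact: AF.
  have h2 : Un n x -> U x by exact: UnU.
  by repeat case: asboolP => ?; rewrite ?subrr ?subr0 ?sub0r ?normrN ?normr1 ?normr0 ?addr0 ?add0r ?ler01//;
    try tauto; lra.
rewrite (ID (intgB iU iA) (intgB iU iUn)) (IB iU iA) (IB iU iUn) !I_indic//.
have hUA : fine (mu U) <= fine (mu A) + e / 2.
  by rewrite -lee_fin EFinD !fineK.
by move: hn hUA; set a := fine _; set b := fine _; set c := fine _; lra.
Qed.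

Lemma small_osc_sum (J : Type) (s : seq J) (F : J -> LebRN R N -> R) :
  (forall i, intg mu (F i) /\ small_osc (F i)) -> small_osc (fun x => \sum_(i <- s) F i x).
Proof.
move=> h; elim: s => [|i s IH].
  move=> e e0; exists 1 => // dl dl0 _.
  have i0 : intg mu (fun x : LebRN R N => \sum_(i <- [::]) F i x).
    by apply: intg_sum => i; have [] := h i.
  apply: (le_trans (osc_norm dl0 i0)).
  rewrite (_ : (fun x => _) = fun=> 0); first by rewrite I0 mulr0 ltW.
  by apply/funext => x; rewrite big_nil normr0.
have [fi sf] := h i.
have si : intg mu (fun x : LebRN R N => \sum_(i <- s) F i x).
  by apply: intg_sum => j; have [] := h j.
apply: (@small_osc2 _ _ _ (F i) (fun x => \sum_(i <- s) F i x)) => //.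
  by apply: intg_sum => j; have [] := h j.
move=> y z; rewrite !big_cons.
rewrite [X in `|X|](_ : _ = (F i y - F i z) + (\sum_(j <- s) F j y - \sum_(j <- s) F j z)).
  exact: ler_normD.
by ring.
Qed.

Import HBSimple.

(** A simple function is a finite combination of indicators of its level sets; those of nonzero
    levels have finite measure by Chebyshev's inequality. *)
Lemma small_osc_sfun (g : {sfun LebRN R N >-> R}) : intg mu g -> small_osc g.
Proof.
move=> gi.
have gE : (g : LebRN R N -> R) = fun x => \sum_(y <- finmap.enum_fset (fset_set (range g))) y * \1_(g @^-1` [set y]) x.
  apply/funext => x; rewrite fimfunE fsbig_finite//=.
rewrite gE; apply: small_osc_sum => y.
have mgy : measurable (g @^-1` [set y]) by exact: measurable_funPTI.
have [->|y0] := eqVneq y 0.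
  rewrite (_ : (fun x => _) = fun=> 0); last by apply/funext => x; rewrite mul0r.
  split; first exact: intg0.
  move=> e e0; exists 1 => // dl dl0 _.
  apply: (le_trans (osc_norm dl0 (intg0 mu))).
  rewrite (_ : (fun x => _) = fun=> 0); first by rewrite I0 mulr0 ltW.
  by apply/funext => x; rewrite normr0.
have fin : (mu (g @^-1` [set y]) < +oo)%E.
  have yg : intg mu (fun x => `|y|^-1 * `|g x|) by apply: intgZ; exact: intg_abs.
  have : intg mu \1_(g @^-1` [set y]).
    apply: (intg_dom _ _ yg); first exact: measurable_indic.
    move=> x; rewrite indicE_asbool; case: asboolP => /= [->|_].
      by rewrite normr1 mulVf// normr_eq0.
    by rewrite normr0 mulr_ge0// invr_ge0.
  move=> /integrableP[_]; under eq_integral do rewrite /= ger0_norm//.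
  by rewrite integral_indic// setIT.
have [_ _ sg] := osc_set_fin mgy fin.
split; first by apply: intgZ; exact: intg_indic.
by apply: small_oscZ => //; exact: intg_indic.
Qed.

Lemma small_osc_intg f : intg mu f -> small_osc f.
Proof.
move=> fi; apply: small_osc_lim => // e e0.
have [g_ [gi _ cg]] := approximation_sfun_integrable measurableT fi.
have fgi n : intg mu (fun x => f x - g_ n x) by apply: intgB => //; exact: gi.
have E n : (\int[mu]_z `|(f z)%:E - (g_ n z)%:E| = (I mu (fun z => `|f z - g_ n z|))%:E)%E.
  by rewrite -intgE//; apply: intg_abs.
move: cg; under eq_fun do rewrite E.
move=> /fine_cvgP[_] /cvgrPdist_le/(_ e e0)[n _ hn].
exists (g_ n); split; [exact: gi|by apply: small_osc_sfun; exact: gi|].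
have := hn n (leqnn n); rewrite /= sub0r normrN; apply: le_trans; exact: ler_norm.
Qed.

Lemma kconv_mol_intg dl f (z : V) : 0 < dl -> intg mu f ->
  intg mu (fun q : LebRN R N => mol dl (z - (q : V)) * f q).
Proof.
move=> dl0 fi.
have [B B0 hB] := supp_bound (@compact_cube R N dl) (C1s_continuous (C1s_mol dl)) (fun p => mol_out (ltW dl0)).
apply: (@kconv_intg R N _ _ mu id (@measurable_coord R N) f fi (mol dl) B).
  exact: C1s_continuous (C1s_mol dl).
move=> w; apply: le_trans (hB w) _.
by rewrite indicE; case: (_ \in _); rewrite ?mulr1 ?mulr0.
Qed.

(** Since the kernel has mass 1, the difference is the average of f(y) - f(z); Fubini identifies the
    integrated bound with [osc]. *)
Lemma kconv_mol_l1 dl f : 0 < dl -> intg mu f ->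
  I mu (fun z => `|kconv mu id f (mol dl) z - f z|) <= osc dl f.
Proof.
move=> dl0 fi; have oi := osc_intg dl0 fi.
rewrite /osc (I_fubini1 oi).
have hz (z : LebRN R N) : `|kconv mu id f (mol dl) z - f z| <= I mu (fun y => osc_int dl f (z, y)).
  have h1 := kconv_mol_intg (z : V) dl0 fi.
  have h2 : intg mu (fun q : LebRN R N => mol dl ((z : V) - (q : V))).
    by under eq_fun do rewrite molC; have [] := I_mol_shift (z : V) dl0.
  have e2 : I mu (fun q : LebRN R N => mol dl ((z : V) - (q : V))) = 1.
    by under eq_fun do rewrite molC; have [] := I_mol_shift (z : V) dl0.
  have h3 : intg mu (fun q : LebRN R N => mol dl ((z : V) - (q : V)) * f q - f z * mol dl ((z : V) - (q : V))).
    by apply: intgB => //; exact: intgZ.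
  have -> : kconv mu id f (mol dl) z - f z =
      I mu (fun q : LebRN R N => mol dl ((z : V) - (q : V)) * f q - f z * mol dl ((z : V) - (q : V))).
    by rewrite (IB h1 (intgZ (f z) h2)) (IZ _ h2) e2 mulr1.
  apply: (le_trans (I_norm h3)); rewrite le_eqVlt; apply/orP; left; apply/eqP.
  congr I; apply/funext => q; rewrite /osc_int/= [f z * _]mulrC -mulrBr normrM ger0_norm//.
  exact: mol_ge0.
have ci : intg mu (fun z => I mu (fun y => osc_int dl f (z, y))) := intg_I1 oi.
apply: I_le => //.
apply: (intg_dom _ _ ci); last by move=> z; rewrite normr_id; exact: hz.
apply: measurable_abs; apply: measurable_funB; last exact: intg_measurable fi.
apply: measurable_continuous.
have [c _] := kconv_C1s (@measurable_coord R N) fi (C1s_mol dl) (@compact_cube R N dl) (fun p => mol_out (ltW dl0)).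
exact: C1s_continuous.
Qed.

Lemma kconv_mol_cvg f : intg mu f -> forall e, 0 < e ->
  exists2 d0 : R, 0 < d0 & forall dl, 0 < dl -> dl < d0 ->
    I mu (fun z => `|kconv mu id f (mol dl) z - f z|) <= e.
Proof.
move=> fi e e0; have [d0 d00 h] := small_osc_intg fi e0.
by exists d0 => // dl dl0 dl1; apply: le_trans (h _ dl0 dl1); exact: kconv_mol_l1.
Qed.

End l1_approx2.

(** * Test fields and perimeter *)

Section fields.
Context {R : realType} {M : nat}.
Local Notation mu := (lm R M).
Implicit Types (U V : 'rV[R]_M -> 'rV[R]_M) (g : 'rV[R]_M -> R) (C A : set 'rV[R]_M).
Local Notation D i f := ('D_(basisv R i) f).

Lemma C1_coord U j : C1 U -> C1s (fun q => U q ord0 j).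
Proof. by move=> h; exact: h. Qed.

Lemma C1_mul g U : C1s g -> C1 U -> C1 (fun p => g p *: U p).
Proof.
move=> hg hU j.
rewrite (_ : (fun q => _) = fun q => g q * U q ord0 j); last by apply/funext => q; rewrite mxE.
by apply: C1s_M => //; exact: C1_coord.
Qed.

Lemma C1_add U V : C1 U -> C1 V -> C1 (fun p => U p + V p).
Proof.
move=> hU hV j.
rewrite (_ : (fun q => _) = fun q => U q ord0 j + V q ord0 j); last by apply/funext => q; rewrite mxE.
by apply: C1s_D; exact: C1_coord.
Qed.

Lemma div_add U V p : C1 U -> C1 V -> divergence (fun p => U p + V p) p = divergence U p + divergence V p.
Proof.
move=> hU hV; rewrite /divergence -big_split/=; apply: eq_bigr => i _.
have -> : (fun q => (U q + V q) ord0 i) = (fun q => U q ord0 i + V q ord0 i).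
  by apply/funext => q; rewrite mxE.
exact: (D_D i p (C1_coord i hU) (C1_coord i hV)).
Qed.

Lemma div_mul g U p : C1s g -> C1 U ->
  divergence (fun p => g p *: U p) p = g p * divergence U p + \sum_i U p ord0 i * D i g p.
Proof.
move=> hg hU; rewrite /divergence big_distrr/= -big_split/=; apply: eq_bigr => i _.
have -> : (fun q => (g q *: U q) ord0 i) = (fun q => g q * U q ord0 i).
  by apply/funext => q; rewrite mxE.
exact: (D_M i p hg (C1_coord i hU)).
Qed.

Lemma div_cont U : C1 U -> continuous (divergence U).
Proof. by move=> hU; apply: cont_sum => i; exact: (C1s_cont_partial i (C1_coord i hU)). Qed.

Lemma div_supp U C : C1 U -> compact C -> (forall p, ~ C p -> U p = 0) ->
  forall p, ~ C p -> divergence U p = 0.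
Proof.
move=> hU cC U0 p nC; rewrite /divergence big1// => i _.
apply: (D_supp i (rV_compact_closed cC)) nC => q /U0 ->.
by rewrite mxE.
Qed.

Lemma div_intg U C : C1 U -> compact C -> (forall p, ~ C p -> U p = 0) -> intg mu (divergence U).
Proof. by move=> hU cC U0; apply: (intg_supp cC (div_cont hU)); exact: div_supp. Qed.

Lemma I_div0 U C : C1 U -> compact C -> (forall p, ~ C p -> U p = 0) -> I mu (divergence U) = 0.
Proof.
move=> hU cC U0.
have h0 i p : ~ C p -> U p ord0 i = 0 by move=> /U0 ->; rewrite mxE.
rewrite /divergence Isum; first by rewrite big1// => i _; exact: (I_D0 i (C1_coord i hU) cC (h0 i)).
move=> i; apply: (intg_supp cC (C1s_cont_partial i (C1_coord i hU))).
by move=> p; exact: (D_supp i (rV_compact_closed cC) (h0 i)).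
Qed.

Lemma I_div_parts g U C : C1s g -> C1 U -> compact C -> (forall p, ~ C p -> U p = 0) ->
  I mu (fun p => g p * divergence U p) = - I mu (fun p => \sum_i U p ord0 i * D i g p).
Proof.
move=> hg hU cC U0.
have h0 p : ~ C p -> g p *: U p = 0 by move=> /U0 ->; rewrite scaler0.
have := I_div0 (C1_mul hg hU) cC h0.
rewrite (_ : divergence _ = fun p => g p * divergence U p + \sum_i U p ord0 i * D i g p); last first.
  by apply/funext => p; exact: div_mul.
rewrite ID; first by move/eqP; rewrite addr_eq0 => /eqP.
  apply: (intg_supp cC (cont_M (C1s_continuous hg) (div_cont hU))) => p nC.
  by rewrite (div_supp hU cC U0 nC) mulr0.
apply: (intg_supp cC).
  apply: cont_sum => i; apply: cont_M; last exact: C1s_cont_partial.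
  exact: C1s_continuous (C1_coord i hU).
by move=> p /U0 ->; rewrite big1// => i _; rewrite mxE mul0r.
Qed.

End fields.

Section frame.
Context {R : realType} {N : nat}.
Variables (eps : R) (sg : 'I_N -> R) (pm : 'I_N -> 'I_N).
Hypothesis eps0 : eps != 0.
Local Notation mu1 := (lm R (N + 1)).
Local Notation Hn := 'rV[R]_(N + 1).
Local Notation V := 'rV[R]_N.
Implicit Types (E F A B C : set Hn) (U W : Hn -> Hn) (z : V) (a b : Hn).

(* The horizontal frame: X_i = d_i + xi_i d_t, with xi_i(z) = sg_i z_(pm i). *)
Definition xi (i : 'I_N) z : R := sg i * z ord0 (pm i).
(** Coefficient of eps T when [a] is written in the frame X_i, eps T at a point over [z]; [nrm2] is
    the square of the resulting norm. *)
Definition gam z a : R := (pt a - \sum_i pz a ord0 i * xi i z) / eps.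
Definition nrm2 z a : R := \sum_i pz a ord0 i ^+ 2 + gam z a ^+ 2.

Definition Test A U := C1 U /\ compact_support_in U A /\ forall p, nrm2 (pz p) (U p) <= 1.
Definition flux E U : R := I mu1 (fun p => divergence U p * \1_E p).
(** [perimeter_eps] with a squared norm and a real-valued integral; the two agree on measurable sets
    ([perimeterE]). *)
Definition per E A : \bar R := ereal_sup [set (flux E U)%:E | U in Test A].

Lemma ptD a b : pt (a + b) = pt a + pt b. Proof. by rewrite /pt mxE. Qed.
Lemma ptZ (s : R) a : pt (s *: a) = s * pt a. Proof. by rewrite /pt mxE. Qed.

Lemma gam_lin z a b (s r : R) : gam z (s *: a + r *: b) = s * gam z a + r * gam z b.
Proof.
rewrite /gam ptD !ptZ.
rewrite (_ : \sum_i _ = s * (\sum_i pz a ord0 i * xi i z) + r * (\sum_i pz b ord0 i * xi i z)).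
  by field.
rewrite !big_distrr -big_split/=; apply: eq_bigr => i _.
by rewrite !pzE !mxE; ring.
Qed.

Lemma sqr_convex (s x y : R) : 0 <= s <= 1 -> (s * x + (1 - s) * y) ^+ 2 <= s * x ^+ 2 + (1 - s) * y ^+ 2.
Proof.
move=> /andP[s0 s1]; rewrite -subr_ge0.
rewrite (_ : _ - _ = s * (1 - s) * (x - y) ^+ 2); last by ring.
by apply: mulr_ge0; [apply: mulr_ge0 => //; rewrite subr_ge0|exact: sqr_ge0].
Qed.

Lemma nrm2_convex z a b (s : R) : 0 <= s <= 1 -> nrm2 z a <= 1 -> nrm2 z b <= 1 ->
  nrm2 z (s *: a + (1 - s) *: b) <= 1.
Proof.
move=> s01 na nb; have /andP[s0 s1] := s01.
apply: (@le_trans _ _ (s * nrm2 z a + (1 - s) * nrm2 z b)); last first.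
  have s1' : 0 <= 1 - s by rewrite subr_ge0.
  have := ler_wpM2l s0 na; have := ler_wpM2l s1' nb; lra.
rewrite /nrm2 gam_lin !mulrDr addrACA; apply: lerD; last exact: sqr_convex.
rewrite !big_distrr -big_split/=; apply: ler_sum => i _.
by rewrite !pzE !mxE; exact: sqr_convex.
Qed.

Lemma nrm20 z : nrm2 z 0 = 0.
Proof.
rewrite /nrm2 /gam big1; last by move=> i _; rewrite pzE mxE expr0n.
rewrite big1; last by move=> i _; rewrite pzE mxE mul0r.
by rewrite /pt mxE subrr mul0r expr0n addr0.
Qed.

Lemma nrm2_scale z a (s : R) : 0 <= s <= 1 -> nrm2 z a <= 1 -> nrm2 z (s *: a) <= 1.
Proof.
move=> s01 na; have := @nrm2_convex z a 0 s s01 na; rewrite scaler0 addr0; apply.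
by rewrite nrm20.
Qed.

Lemma Test0 A : Test A (fun=> 0).
Proof.
split; first by move=> j; under eq_fun do rewrite mxE; exact: C1s_cst.
split; last by move=> p; rewrite nrm20.
by exists set0 => //; split; [exact: compact0|].
Qed.

Lemma flux_intg E U C : measurable (E : set (LebRN R (N + 1))) -> C1 U -> compact C ->
  (forall p, ~ C p -> U p = 0) -> intg mu1 (fun p => divergence U p * \1_E p).
Proof. by move=> mE hU cC U0; apply: intg_indicM => //; exact: (div_intg hU cC U0). Qed.

Lemma flux_add E U W C C' : measurable (E : set (LebRN R (N + 1))) -> C1 U -> compact C ->
  (forall p, ~ C p -> U p = 0) -> C1 W -> compact C' -> (forall p, ~ C' p -> W p = 0) ->
  flux E (fun p => U p + W p) = flux E U + flux E W.
Proof.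
move=> mE hU cC U0 hW cC' W0; rewrite /flux -ID; try exact: flux_intg.
- by congr I; apply/funext => p; rewrite div_add// mulrDl.
- exact: (flux_intg mE hU cC U0).
- exact: (flux_intg mE hW cC' W0).
Qed.

Lemma per_ub E A U : Test A U -> ((flux E U)%:E <= per E A)%E.
Proof. by move=> h; apply: ereal_sup_ubound; exists U. Qed.

Lemma per_le E A (x : \bar R) : (forall U, Test A U -> ((flux E U)%:E <= x)%E) -> (per E A <= x)%E.
Proof. by move=> h; apply: ge_ereal_sup => _ [U TU <-]; exact: h. Qed.

Lemma flux0 E : flux E (fun=> 0) = 0.
Proof.
rewrite /flux (_ : (fun p => _) = fun=> 0) ?I0//; apply/funext => p.
rewrite /divergence big1 ?mul0r// => i _.
rewrite (_ : (fun q => _) = fun=> 0); last by apply/funext => q; rewrite mxE.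
exact: derive_cst.
Qed.

Lemma per_ge0 E A : (0 <= per E A)%E.
Proof. by have := per_ub E (Test0 A); rewrite flux0. Qed.

(** Bounds a sum of two suprema by treating pairs of fields, also when the right-hand side is
    infinite; when [x] is finite, pairing with the zero field shows that the first perimeter is
    finite and can be subtracted. *)
Lemma per2_le E1 A1 E2 A2 (x : \bar R) :
  (forall U W, Test A1 U -> Test A2 W -> ((flux E1 U + flux E2 W)%:E <= x)%E) ->
  (per E1 A1 + per E2 A2 <= x)%E.
Proof.
case: x => [x| |] h; [|by rewrite leey|by have := h _ _ (Test0 A1) (Test0 A2); rewrite leeNy_eq].
have h1 W : Test A2 W -> (per E1 A1 <= (x - flux E2 W)%:E)%E.
  move=> TW; apply: per_le => U TU; have := h U W TU TW; rewrite !lee_fin => ?; lra.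
have f1 : per E1 A1 \is a fin_num.
  rewrite ge0_fin_numE ?per_ge0//; apply: le_lt_trans (h1 _ (Test0 A2)) _; exact: ltry.
have h2 : (per E2 A2 <= (x - fine (per E1 A1))%:E)%E.
  apply: per_le => W TW; have := h1 W TW; rewrite -(fineK f1) !lee_fin => ?; lra.
apply: (@le_trans _ _ (per E1 A1 + (x - fine (per E1 A1))%:E)%E); first exact: leeD2l.
by rewrite -{1}(fineK f1) -EFinD lee_fin; lra.
Qed.

Lemma Test_sub A B U : A `<=` B -> Test A U -> Test B U.
Proof.
move=> AB [h1 [[C [cC CA] U0] h3]]; split=> //; split => //; exists C => //.
by split => //; exact: subset_trans AB.
Qed.

Lemma per_mono E A B : A `<=` B -> (per E A <= per E B)%E.
Proof. by move=> AB; apply: per_le => U TU; apply: per_ub; exact: Test_sub TU. Qed.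

(** Fields supported in disjoint regions add up to an admissible field, since at each point one of
    them vanishes. *)
Lemma per_superadd E A1 A2 A : measurable (E : set (LebRN R (N + 1))) -> A1 `<=` A -> A2 `<=` A ->
  A1 `&` A2 = set0 -> (per E A1 + per E A2 <= per E A)%E.
Proof.
move=> mE s1 s2 dis; apply: per2_le => U W [hU [[C [cC CA] U0] nU]] [hW [[C' [cC' CA'] W0] nW]].
rewrite -(flux_add mE hU cC U0 hW cC' W0); apply: per_ub; split; first exact: C1_add.
split.
  exists (C `|` C'); first by split; [exact: compactU|move=> p [/CA/s1|/CA'/s2]].
  by move=> p /not_orP[/U0 -> /W0 ->]; rewrite addr0.
move=> p; have [Cp|/U0 ->] := pselect (C p); last by rewrite add0r.
have [C'p|/W0 ->] := pselect (C' p); last by rewrite addr0.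
have : (A1 `&` A2) p by split; [exact: CA|exact: CA'].
by rewrite dis.
Qed.

End frame.

(** * Cutoff functions and gluing *)

Section cutoff.
Context {R : realType} {M : nat}.
Local Notation mu := (lm R M).
Local Notation D i f := ('D_(basisv R i) f).
Implicit Types (K A : set 'rV[R]_M) (d : R).

Definition fat d K : set 'rV[R]_M := [set q | exists2 k, K k & cube d (q - k)].

Lemma compact_fat d K : compact K -> compact (fat d K).
Proof.
move=> cK.
have -> : fat d K = (fun x : 'rV[R]_M * 'rV[R]_M => x.1 + x.2) @` (K `*` cube d).
  apply/seteqP; split => q.
    by move=> [k Kk ck]; exists (k, q - k) => //=; rewrite addrC subrK.
  by move=> [[k w] /= [Kk cw] <-]; exists k => //; rewrite [k + w]addrC addrK.
apply: continuous_compact; last exact: compact_setX cK (@compact_cube R M d).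
apply: continuous_subspaceT => x A /rV_nbhs[r r0 hr].
pose ball2 (y : 'rV[R]_M) := [set p : 'rV[R]_M | forall j, `|y ord0 j - p ord0 j| < r / 2].
have nb y : nbhs y (ball2 y) by apply/rV_nbhs; exists (r / 2) => //; lra.
exists (ball2 x.1, ball2 x.2); first by split; exact: nb.
move=> [p q] [/= hp hq]; apply: hr => j; rewrite !mxE.
rewrite [X in `|X|](_ : _ = (x.1 ord0 j - p ord0 j) + (x.2 ord0 j - q ord0 j)); last by ring.
by apply: le_lt_trans (ler_normD _ _) _; have := hp j; have := hq j; lra.
Qed.

Lemma cube_sub d d' : d <= d' -> cube d `<=` (cube d' : set 'rV[R]_M).
Proof. by move=> dd w h i; exact: le_trans (h i) dd. Qed.

Lemma fat_sub d d' K : d <= d' -> fat d K `<=` fat d' K.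
Proof. by move=> dd q [k Kk ck]; exists k => //; exact: cube_sub ck. Qed.

Lemma sub_fat d K : 0 <= d -> K `<=` fat d K.
Proof. by move=> d0 q Kq; exists q => // i; rewrite subrr mxE normr0. Qed.

Lemma fat_fat d d' K q w : fat d K q -> cube d' (w - q) -> fat (d + d') K w.
Proof.
move=> [k Kk ck] cw; exists k => // i; have := ck i; have := cw i; rewrite !mxE.
rewrite [w ord0 i - k ord0 i](_ : _ = (w ord0 i - q ord0 i) + (q ord0 i - k ord0 i)); last by ring.
by move=> h1 h2; apply: le_trans (ler_normD _ _) _; lra.
Qed.

Lemma fat_nbhs d K q : 0 < d -> K q -> nbhs q (fat d K).
Proof.
move=> d0 Kq; apply/rV_nbhs; exists d => // p hp; exists q => // i.
by rewrite !mxE distrC ltW.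
Qed.

Lemma fat_in_open K A : compact K -> open A -> K `<=` A -> exists2 d : R, 0 < d & fat d K `<=` A.
Proof.
move=> /compact_near_coveringP cK oA KA.
pose P (d : R) (q : 'rV[R]_M) : Prop := forall w, cube d w -> A (q + w).
have nc : \forall d \near 0^'+, K `<=` P d.
  apply: cK => q Kq.
  have /rV_nbhs[r r0 hr] : nbhs q A by apply: open_nbhs_nbhs; split => //; exact: KA.
  have h1 : nbhs q [set p : 'rV[R]_M | forall j, `|q ord0 j - p ord0 j| < r / 2].
    by apply/rV_nbhs; exists (r / 2) => //; lra.
  have h2 : \forall d \near 0^'+, d < r / 2 by apply: nbhs_right_lt; lra.
  exists ([set p : 'rV[R]_M | forall j, `|q ord0 j - p ord0 j| < r / 2], [set d : R | d < r / 2]).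
    by split.
  move=> [p d] [/= hp hd] w cw; apply: hr => j; rewrite mxE.
  rewrite opprD addrA; apply: le_lt_trans (ler_normB _ _) _.
  by have := cw j; have := hp j; rewrite /=; lra.
near (0:R)^'+ => d.
exists d => //; move=> q [k Kk ck].
have hP : K `<=` P d by near: d.
by have := hP k Kk _ ck; rewrite addrC subrK.
Unshelve. all: by end_near. Qed.

(* [eta] is the mollified indicator of a neighbourhood of [K]. *)
Lemma cutoff K A : compact K -> open A -> K `<=` A ->
  exists (eta : 'rV[R]_M -> R) (C : set 'rV[R]_M),
    [/\ C1s eta, forall p, 0 <= eta p <= 1, compact C /\ C `<=` A /\ (forall p, ~ C p -> eta p = 0) &
      forall p, K p -> eta p = 1 /\ forall i, D i eta p = 0].
Proof.
move=> cK oA KA; have [d d0 dA] := fat_in_open cK oA KA.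
(* Mollifying the d/2-thickening at radius d/4 gives the value 1 on the d/4-thickening, hence zero
   derivatives on [K], and the value 0 off the 3d/4-thickening. *)
pose S : set (LebRN R M) := fat (d / 2) K.
have cS : compact (fat (d / 2) K) by exact: compact_fat.
have mS : measurable S := leb_compact_measurable cS.
have iS : intg mu \1_S := intg_indic mS (leb_compact_fin cS).
have d40 : 0 < d / 4 by lra.
pose eta := kconv mu id \1_S (mol (d / 4)).
have [hC _] := kconv_C1s (@measurable_coord R M) iS (C1s_mol (d / 4)) (@compact_cube R M (d / 4))
  (fun p => mol_out (ltW d40)).
have im z : intg mu (fun q : LebRN R M => mol (d / 4) (z - (q : 'rV[R]_M))) /\
    I mu (fun q : LebRN R M => mol (d / 4) (z - (q : 'rV[R]_M))) = 1.
  have [h1 h2] := I_mol_shift (z : 'rV[R]_M) d40.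
  by split; under eq_fun do rewrite molC.
have iK z : intg mu (fun q : LebRN R M => mol (d / 4) (z - (q : 'rV[R]_M)) * \1_S q).
  exact: kconv_mol_intg.
have eta1 p : fat (d / 4) K p -> eta p = 1.
  move=> fp; rewrite -(im p).2 /eta /kconv; congr I; apply/funext => q.
  have [cq|nq] := pselect (cube (d / 4) (p - (q : 'rV[R]_M))); last by rewrite mol_out ?mul0r// ltW.
  rewrite indicE mem_set ?mulr1// /S (_ : d / 2 = d / 4 + d / 4); last by lra.
  by apply: fat_fat fp _ => i; have := cq i; rewrite !mxE distrC.
exists eta, (fat d K); split.
- exact: hC.
- move=> p; apply/andP; split.
    by apply: I_ge0 => q; rewrite mulr_ge0 ?mol_ge0.
  rewrite -(im p).2; apply: I_le; [exact: iK|exact: (im p).1|].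
  by move=> q; rewrite ler_piMr ?mol_ge0// indicE lern1; case: (_ \in _).
- split; first exact: compact_fat.
  split => // p np; rewrite /eta /kconv (_ : (fun q => _) = fun=> 0) ?I0//; apply/funext => q.
  rewrite indicE_asbool; case: asboolP => Sq; last by rewrite mulr0.
  rewrite mol_out ?mul0r ?ltW// => cq; apply: np.
  apply: (@fat_sub (d / 2 + d / 4)); first by lra.
  exact: fat_fat Sq cq.
- move=> p Kp; split; first by apply: eta1; apply: sub_fat Kp; exact: ltW.
  move=> i.
  have : \near p, eta p = (fun=> 1) p.
    by apply: filterS (fat_nbhs d40 Kp) => q; exact: eta1.
  by move=> /near_eq_derive -> //; exact: derive_cst.
Qed.

End cutoff.

Section glue.
Context {R : realType} {N : nat}.
Variables (eps : R) (sg : 'I_N -> R) (pm : 'I_N -> 'I_N).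
Hypothesis eps0 : eps != 0.
Local Notation mu1 := (lm R (N + 1)).
Local Notation Hn := 'rV[R]_(N + 1).
Local Notation per := (per eps sg pm).
Local Notation Test := (Test eps sg pm).
Implicit Types (E F A B K : set Hn).

(* Exchange the two test fields inside and outside a neighbourhood of K. *)
Lemma per_glue E F A B K : measurable (E : set (LebRN R (N + 1))) ->
  measurable (F : set (LebRN R (N + 1))) -> open A -> A `<=` B -> compact K -> K `<=` A ->
  (forall p, ~ K p -> E p <-> F p) -> (per F B + per E A <= per F A + per E B)%E.
Proof.
move=> mE mF oA AB cK KA EF.
have [eta [C [hC e01 [cC [CA C0]] eK]]] := cutoff cK oA KA.
apply: per2_le => U W [hU [[CU [cCU CUB] U0] nU]] [hW [[CW [cCW CWA] W0] nW]].
pose eta' p := 1 - eta p.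
have hC' : C1s eta'.
  rewrite (_ : eta' = fun p => 1 + -1 * eta p).
    by apply: C1s_D; [exact: C1s_cst|apply: C1s_M => //; exact: C1s_cst].
  by apply/funext => p; rewrite /eta' mulN1r.
have D' i p : 'D_(basisv R i) eta' p = - 'D_(basisv R i) eta p.
  rewrite (_ : eta' = fun p => 1 + -1 * eta p); last by apply/funext => q; rewrite /eta' mulN1r.
  rewrite D_D; [|exact: C1s_cst|by apply: C1s_M => //; exact: C1s_cst].
  rewrite derive_cst add0r D_M//; last exact: C1s_cst.
  by rewrite derive_cst mulr0 addr0 mulN1r.
(* Both mixtures of [U] and [W] are pointwise convex combinations, hence admissible; [mix U W] is
   supported in [A] because [eta] and [W] are. *)
pose mix (X Y : Hn -> Hn) p := eta p *: X p + eta' p *: Y p.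
have dmix X Y p : C1 X -> C1 Y -> divergence (mix X Y) p = eta p * divergence X p +
    \sum_i X p ord0 i * 'D_(basisv R i) eta p + (eta' p * divergence Y p -
    \sum_i Y p ord0 i * 'D_(basisv R i) eta p).
  move=> hX hY; rewrite /mix div_add; try exact: C1_mul.
  rewrite !div_mul//; congr (_ + (_ + _)).
  by rewrite -sumrN; apply: eq_bigr => i _; rewrite D' mulrN.
have Tmix (X Y : Hn -> Hn) (S CX CY : set Hn) : C1 X -> C1 Y -> compact CX -> compact CY -> CY `<=` S -> A `<=` S ->
    (forall p, ~ CY p -> Y p = 0) ->
    (forall p, nrm2 eps sg pm (pz p) (X p) <= 1) ->
    (forall p, nrm2 eps sg pm (pz p) (Y p) <= 1) -> Test S (mix X Y).
  move=> hX hY cX cY YS AS Y0 nX nY; split.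
    by apply: C1_add; exact: C1_mul.
  split; last by move=> p; apply: nrm2_convex.
  exists (C `|` CY); first by split; [exact: compactU|move=> p [/CA/AS|/YS]].
  by move=> p /not_orP[/C0 h /Y0 h']; rewrite /mix h h' scale0r scaler0 addr0.
have T1 : Test A (mix U W) := Tmix U W A CU CW hU hW cCU cCW CWA (@subset_refl _ A) W0 nU nW.
have T2 : Test B (mix W U) := Tmix W U B CW CU hW hU cCW cCU CUB AB U0 nW nU.
have E1 : flux F U + flux E W = flux F (mix U W) + flux E (mix W U).
  have fi (S : set Hn) (X : Hn -> Hn) (A' : set Hn) : measurable (S : set (LebRN R (N + 1))) -> Test A' X ->
      intg mu1 (fun p => divergence X p * \1_S p).
    by move=> mS [hX [[CX [cX _] X0] _]]; exact: (flux_intg mS hX cX X0).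
  rewrite /flux -(ID (flux_intg mF hU cCU U0) (flux_intg mE hW cCW W0)) -(ID (fi _ _ _ mF T1) (fi _ _ _ mE T2)).
  (* On [K] one has eta = 1 with zero gradient, so [mix U W] carries div U and [mix W U] carries div
     W. Off [K] the two sets agree and the gradient terms cancel. *)
  congr I; apply/funext => p; rewrite !dmix//.
  have [Kp|nK] := pselect (K p).
    have [e1 De] := eK p Kp.
    have z (X : Hn -> Hn) : \sum_i X p ord0 i * 'D_(basisv R i) eta p = 0.
      by rewrite big1// => i _; rewrite De mulr0.
    by rewrite !z /eta' e1; ring.
  have -> : \1_F p = \1_E p :> R.
    by rewrite !indicE_asbool; congr (if _ then _ else _); apply: asbool_equiv_eq; apply: iff_sym; exact: EF.
  by rewrite /eta'; ring.
rewrite E1 EFinD; apply: leeD; exact: per_ub.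
Qed.

End glue.

Section pz_calculus.
Context {R : realType} {N : nat}.
Local Notation D i f := ('D_(basisv R i) f).
Implicit Types (f : 'rV[R]_N -> R) (p : 'rV[R]_(N + 1)).

Lemma pz_line_l (h : R) (i : 'I_N) p : pz (h *: basisv R (lshift 1 i) + p) = h *: basisv R i + pz p.
Proof. by apply/rowP => j; rewrite !mxE !eqxx/= (inj_eq (@lshift_inj _ _)). Qed.

Lemma pz_line_r (h : R) p : pz (h *: basisv R (rshift N (ord0 : 'I_1)) + p) = pz p.
Proof. by apply/rowP => j; rewrite !mxE !eqxx/= eq_lrshift mulr0 add0r. Qed.

Lemma is_derive_pz_l f i p (d : R) : is_derive (pz p) (basisv R i) f d ->
  is_derive p (basisv R (lshift 1 i)) (fun q => f (pz q)) d.
Proof.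
move=> /is_derive_line0 h; apply/(is_derive_line0 (fun q => f (pz q))).
by under eq_fun do rewrite pz_line_l.
Qed.

Lemma is_derive_pz_r f p : is_derive p (basisv R (rshift N (ord0 : 'I_1))) (fun q => f (pz q)) 0.
Proof.
apply/(is_derive_line0 (fun q => f (pz q))).
by under eq_fun do rewrite pz_line_r; exact: is_derive_cst.
Qed.

Lemma cont_pz f : continuous f -> continuous (fun p : 'rV[R]_(N + 1) => f (pz p)).
Proof.
move=> cf; apply/cont_epsP => p e e0.
have [r r0 hr] := (cont_epsP f).1 cf (pz p) e e0.
by exists r => // q hq; apply: hr => j; rewrite !pzE.
Qed.

Lemma cont_pt : continuous (@pt R N).
Proof. exact: cont_coord. Qed.

Lemma C1s_pz f : C1s f -> C1s (fun p : 'rV[R]_(N + 1) => f (pz p)).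
Proof.
move=> hf.
pose df (j : 'I_(N + 1)) (p : 'rV[R]_(N + 1)) : R := if fintype.split j is inl i then D i f (pz p) else 0.
have h1 j p : is_derive p (basisv R j) (fun p => f (pz p)) (df j p).
  rewrite /df; case: (split_ordP j) => k ->.
    by apply: is_derive_pz_l; exact: C1s_is_derive.
  by rewrite ord1; exact: is_derive_pz_r.
apply: (C1s_intro h1) => j; rewrite /df; case: (fintype.split j) => k.
  exact: (cont_pz (C1s_cont_partial k hf)).
exact: cont_cst.
Qed.

Lemma D_pz_l f i p : C1s f -> D (lshift 1 i) (fun q => f (pz q)) p = D i f (pz p).
Proof. by move=> hf; have [] := is_derive_pz_l (C1s_is_derive i (pz p) hf). Qed.

Lemma D_pz_r f p : D (rshift N (ord0 : 'I_1)) (fun q => f (pz q)) p = 0.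
Proof. by have [] := is_derive_pz_r f p. Qed.

Lemma compact_pz (C : set 'rV[R]_(N + 1)) : compact C -> compact (@pz R N @` C).
Proof.
move=> cC; apply: continuous_compact => //; apply: continuous_subspaceT => p A /rV_nbhs[r r0 hr].
by apply/rV_nbhs; exists r => // q hq; apply: hr => j; rewrite !pzE.
Qed.

Lemma sum_split (F : 'I_(N + 1) -> R) : \sum_i F i = \sum_(i < N) F (lshift 1 i) + F (rshift N ord0).
Proof. by rewrite big_split_ord/= big_ord1. Qed.

Lemma measurable_pz_coord i : measurable_fun setT (fun q : LebRN R (N + 1) => pz q ord0 i).
Proof. by under eq_fun do rewrite pzE; exact: measurable_coord. Qed.

End pz_calculus.

Section kernel_fubini.
Context {R : realType} {N : nat}.
Local Notation mu := (lm R N).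
Local Notation mu1 := (lm R (N + 1)).

Lemma cont_shift (k : 'rV[R]_N -> R) (c : 'rV[R]_N) : continuous k -> continuous (fun z : 'rV[R]_N => k (z - c)).
Proof.
move=> ck; apply/cont_epsP => p e e0.
have [r r0 hr] := (cont_epsP k).1 ck (p - c) e e0.
exists r => // q hq; apply: hr => j; rewrite !mxE.
by rewrite [X in `|X|](_ : _ = p ord0 j - q ord0 j)//; ring.
Qed.

Lemma measurable_zq : forall i, measurable_fun setT
  (fun x : LebRN R N * LebRN R (N + 1) => ((x.1 : 'rV[R]_N) - pz x.2) ord0 i).
Proof.
move=> i; under eq_fun do rewrite !mxE.
apply: measurable_funB.
  exact: (measurableT_comp (@measurable_coord R N i) measurable_fst).
exact: (measurableT_comp (@measurable_coord R (N + 1) (lshift 1 i)) measurable_snd).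
Qed.

(** Transposition: averaging [h] against the kernel and pairing with [f] equals averaging [f]
    against the reflected kernel and pairing with [h]. *)
Lemma kernel_fubini (k : 'rV[R]_N -> R) (B : R) (f : LebRN R N -> R) (h : LebRN R (N + 1) -> R) :
  continuous k -> (forall w, `|k w| <= B) -> intg mu f -> intg mu1 h ->
  intg mu (fun z => f z * kconv mu1 (@pz R N) h k z) /\
  I mu (fun z => f z * kconv mu1 (@pz R N) h k z) =
  I mu1 (fun q => h q * I mu (fun z : LebRN R N => k ((z : 'rV[R]_N) - pz q) * f z)).
Proof.
move=> ck kB fi hi.
pose F (x : LebRN R N * LebRN R (N + 1)) : R := f x.1 * (k ((x.1 : 'rV[R]_N) - pz x.2) * h x.2).
have mk2 : measurable_fun setT (fun x : LebRN R N * LebRN R (N + 1) => k ((x.1 : 'rV[R]_N) - pz x.2)).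
  exact: (measurable_comp_continuous measurable_zq ck).
have Fi : intg (mu \x mu1)%E F.
  apply: (intg_dom _ _ (intgZ B (intg_prodM (intg_abs fi) (intg_abs hi)))).
    apply: measurable_funM; first exact: (measurableT_comp (intg_measurable fi) measurable_fst).
    by apply: measurable_funM => //; exact: (measurableT_comp (intg_measurable hi) measurable_snd).
  move=> x; rewrite /F !normrM mulrCA ler_wpM2r ?mulr_ge0//.
have E1 z : I mu1 (fun q => F (z, q)) = f z * kconv mu1 (@pz R N) h k z.
  by rewrite -IZ//; apply: (kconv_intg measurable_pz_coord hi ck kB).
have c1 := intg_I1 Fi.
split; first by move: c1; rewrite /intg; under eq_fun do rewrite E1.
transitivity (I mu (fun z => I mu1 (fun q => F (z, q)))).
  by congr I; apply/funext => z; rewrite E1.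
rewrite (I_fubini Fi); congr I; apply/funext => q; rewrite /F/=.
have mkf : measurable_fun setT (fun z : LebRN R N => k ((z : 'rV[R]_N) - pz q)).
  exact: (measurable_continuous (@cont_shift k (pz q) ck)).
have hi2 : intg mu (fun z : LebRN R N => k ((z : 'rV[R]_N) - pz q) * f z).
  apply: (intg_dom _ _ (intgZ B (intg_abs fi))).
    exact: (measurable_funM mkf (intg_measurable fi)).
  by move=> z; rewrite normrM ler_wpM2r.
by rewrite -(IZ (h q) hi2); congr I; apply/funext => z; ring.
Qed.

End kernel_fubini.

(** * Smoothing a subgraph *)

Section smoothing.
Context {R : realType} {N : nat}.
Variables (eps : R) (sg : 'I_N -> R) (pm : 'I_N -> 'I_N).
Hypothesis eps0 : eps != 0.
Local Notation mu := (lm R N).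
Local Notation mu1 := (lm R (N + 1)).
Local Notation Hn := 'rV[R]_(N + 1).
Local Notation V := 'rV[R]_N.
Local Notation xi := (xi sg pm).
Local Notation nrm2 := (nrm2 eps sg pm).
Local Notation D i f := ('D_(basisv R i) f).
Local Notation pz := (@pz R N).
Local Notation pt := (@pt R N).

Definition Testz (A : set V) (phi : V -> Hn) : Prop :=
  [/\ forall j, C1s (fun z => phi z ord0 j),
    exists2 C : set V, compact C /\ C `<=` A & forall z, ~ C z -> phi z = 0 &
    forall z, nrm2 z (phi z) <= 1].

Definition divz (phi : V -> Hn) (z : V) : R := \sum_i D i (fun z => phi z ord0 (lshift 1 i)) z.
(** The flux through {t < v} of the t-independent field [phi] cut off far below: integrating div_z
    phi up to height v leaves v div_z phi, the constant part dropping out as div_z phi has integral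
    0, and the lower cutoff contributes the vertical component. *)
Definition zflux (v : V -> R) (phi : V -> Hn) : R := I mu (fun z => v z * divz phi z + pt (phi z)).

Lemma cont_xi i : continuous (xi i).
Proof. by apply: cont_M; [exact: cont_cst|exact: cont_coord]. Qed.

Lemma C1s_xi i : C1s (xi i).
Proof. by apply: C1s_M; [exact: C1s_cst|exact: C1s_coord]. Qed.

Section one_step.
Variables (U : Hn -> Hn) (C : set Hn) (vt : LebRN R N -> R) (dl j : R).
Hypotheses (hU : C1 U) (cC : compact C) (U0 : forall p, ~ C p -> U p = 0).
Hypothesis nU : forall p, nrm2 (pz p) (U p) <= 1.
Hypotheses (vti : intg mu vt) (dl0 : 0 < dl) (j0 : 0 < j).
Let w := kconv mu id vt (mol dl).
Let ml := (@mol R N dl).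
Let cml : continuous ml. Proof. exact: C1s_continuous (C1s_mol dl). Qed.

Let mlB : exists B : R, (forall y, `|ml y| <= B) /\ forall i y, `|D i ml y| <= B.
Proof.
have cle (S : set V) (B : R) y : 0 <= B -> B * \1_S y <= B.
  by move=> B0; rewrite indicE; case: (y \in S); rewrite ?mulr1 ?mulr0.
have m0 y : ~ cube dl y -> ml y = 0 by exact: mol_out (ltW dl0).
have [B B0 kB] := supp_bound (@compact_cube R N dl) cml m0.
have /choice[Bi hBi] i : exists B' : R, 0 <= B' /\ forall y, `|D i ml y| <= B'.
  have [B' B'0 hB'] := supp_bound (@compact_cube R N dl) (C1s_cont_partial i (C1s_mol dl))
    (fun p => D_supp i (rV_compact_closed (@compact_cube R N dl)) m0).
  by exists B'; split => // y; apply: le_trans (hB' y) _; exact: cle.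
exists (B + \sum_i Bi i); split => [y|i y].
  apply: (le_trans (kB y)); apply: (le_trans (cle _ _ _ B0)).
  by rewrite lerDl sumr_ge0// => i _; have [] := hBi i.
apply: (le_trans (proj2 (hBi i) y)); rewrite (bigD1 i)//= addrCA lerDl addr_ge0//.
by rewrite sumr_ge0// => k _; have [] := hBi k.
Qed.

Let hw : C1s w /\ forall i z, D i w z = kconv mu id vt (D i ml) z.
Proof.
exact: (kconv_C1s (@measurable_coord R N) vti (C1s_mol dl) (@compact_cube R N dl)
  (fun p => mol_out (ltW dl0))).
Qed.

(** [step (ramp q)] is a smoothed indicator of {t < w}; its transition takes place in the layer of
    thickness 1/j below the graph of w. *)
Definition ramp (q : Hn) : R := j * w (pz q) - j * pt q.

Let rampE : ramp = fun q => j * w (pz q) + (- j) * pt q.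
Proof. by apply/funext => q; rewrite /ramp mulNr. Qed.

Let hwp : C1s (fun q : Hn => w (pz q)). Proof. exact: (C1s_pz hw.1). Qed.
Let hpt : C1s pt. Proof. exact: (@C1s_coord R (N + 1) (rshift N ord0)). Qed.
Let hjw : C1s (fun q : Hn => j * w (pz q)).
Proof. exact: (C1s_M (@C1s_cst R (N + 1) j) hwp). Qed.
Let hjt : C1s (fun q : Hn => (- j) * pt q).
Proof. exact: (C1s_M (@C1s_cst R (N + 1) (- j)) hpt). Qed.

Lemma C1s_ramp : C1s ramp.
Proof. by rewrite rampE; exact: (C1s_D hjw hjt). Qed.

Let D_ramp m q : D m ramp q = j * D m (fun q : Hn => w (pz q)) q + (- j) * D m pt q.
Proof.
rewrite rampE (D_D m q hjw hjt) (D_M m q (@C1s_cst R (N + 1) j) hwp) (D_M m q (@C1s_cst R (N + 1) (- j)) hpt).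
by rewrite !derive_cst !mulr0 !addr0.
Qed.

Lemma D_ramp_l i q : D (lshift 1 i) ramp q = j * D i w (pz q).
Proof.
apply: (eq_trans (D_ramp (lshift 1 i) q)); rewrite (D_pz_l i q hw.1).
have [_ h] := is_derive_coord (lshift 1 i) (rshift N (ord0 : 'I_1)) q.
by rewrite h eq_rlshift mulr0 addr0.
Qed.

Lemma D_ramp_r q : D (rshift N (ord0 : 'I_1)) ramp q = - j.
Proof.
apply: (eq_trans (D_ramp (rshift N ord0) q)); rewrite D_pz_r.
have [_ h] := is_derive_coord (rshift N (ord0 : 'I_1)) (rshift N (ord0 : 'I_1)) q.
by rewrite h eqxx mulr0 add0r mulr1.
Qed.

Definition hker (q : Hn) : R := j * dstep (ramp q).

Lemma cont_hker : continuous hker.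
Proof.
by apply: cont_M; [exact: cont_cst|apply: (cont_comp (@continuous_dstep R)); exact: C1s_continuous C1s_ramp].
Qed.

Lemma hker_ge0 q : 0 <= hker q. Proof. by rewrite mulr_ge0 ?dstep_ge0// ltW. Qed.

Lemma hker_t z : intg (@lebesgue_measure R) (fun t => hker (mk z t)) /\
  I (@lebesgue_measure R) (fun t => hker (mk z t)) = 1.
Proof.
rewrite (_ : (fun t => hker (mk z t)) = fun t => j * dstep (j * w z - j * t)).
  exact: I_dstep_down (j * w z) j0.
by apply/funext => t; rewrite /hker /ramp pz_mk pt_mk.
Qed.

Definition Hc (m : 'I_(N + 1)) (q : Hn) : R := hker q * U q ord0 m.
(** eps times the vertical frame coefficient of [U], weighted by [hker]; the components
    [Hc (lshift 1 i)] are the weighted horizontal ones. *)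
Definition gc (q : Hn) : R := Hc (rshift N ord0) q - \sum_i Hc (lshift 1 i) q * xi i (pz q).

(** Integration by parts against the smoothed indicator, whose gradient is [hker] times (D w,
    -1). *)
Lemma step_parts : I mu1 (fun q => step (ramp q) * divergence U q) =
  I mu1 (fun q => Hc (rshift N ord0) q - \sum_i Hc (lshift 1 i) q * D i w (pz q)).
Proof.
have hs : C1s (fun q => step (ramp q)).
  exact: (C1s_comp (@is_derive_step R) (@continuous_dstep R) C1s_ramp).
rewrite (I_div_parts hs hU cC U0) -IN; last first.
  apply: (intg_supp cC).
    apply: cont_sum => i; apply: cont_M; last exact: C1s_cont_partial.
    exact: C1s_continuous (C1_coord i hU).
  by move=> p /U0 ->; rewrite big1// => i _; rewrite mxE mul0r.
congr I; apply/funext => q; rewrite sum_split opprD addrC; congr (_ + _).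
  rewrite (D_comp (rshift N ord0) q (@is_derive_step R) C1s_ramp) D_ramp_r /Hc /hker; ring.
congr (- _); apply: eq_bigr => i _.
by rewrite (D_comp (lshift 1 i) q (@is_derive_step R) C1s_ramp) D_ramp_l /Hc /hker; ring.
Qed.

Lemma Hc_cont m : continuous (Hc m).
Proof. by apply: cont_M; [exact: cont_hker|exact: C1s_continuous (C1_coord m hU)]. Qed.

Lemma Hc_out m p : ~ C p -> Hc m p = 0.
Proof. by move=> /U0 h; rewrite /Hc h mxE mulr0. Qed.

Lemma Hc_intg m : intg mu1 (Hc m).
Proof. exact: (intg_supp cC (@Hc_cont m) (fun p => @Hc_out m p)). Qed.

Lemma gc_out p : ~ C p -> gc p = 0.
Proof.
by move=> nC; rewrite /gc (Hc_out _ nC) big1 ?subr0// => i _; rewrite (Hc_out _ nC) mul0r.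
Qed.

Lemma gc_intg : intg mu1 gc.
Proof.
apply: (intg_supp cC) => [|p]; last exact: gc_out.
apply: cont_B; first exact: Hc_cont.
by apply: cont_sum => i; apply: cont_M; [exact: Hc_cont|apply: cont_pz; exact: cont_xi].
Qed.

Definition al (i : 'I_N) (z : V) : R := kconv mu1 pz (Hc (lshift 1 i)) ml z.
Definition gm (z : V) : R := kconv mu1 pz gc ml z.
(** The averaged frame coefficients are reassembled in the frame at [z], not in the frames at the
    points averaged over; this is what makes the norm bound a matter of convexity. *)
Definition ph (z : V) : Hn := mk (\row_i al i z) (gm z + \sum_i al i z * xi i z).

Let kc h (hi : intg mu1 h) := kconv_C1s measurable_pz_coord hi (C1s_mol dl) (@compact_cube R N dl)
  (fun p => mol_out (ltW dl0)).

Lemma ph_C1s m : C1s (fun z => ph z ord0 m).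
Proof.
have ha i : C1s (al i) by have [] := kc (Hc_intg (lshift 1 i)).
have hg : C1s gm by have [] := kc gc_intg.
case: (split_ordP m) => i ->.
  have -> : (fun z => ph z ord0 (lshift 1 i)) = al i.
    by apply/funext => z; rewrite /ph mkl mxE.
  exact: (ha i).
have -> : (fun z => ph z ord0 (rshift N i)) = fun z => gm z + \sum_i al i z * xi i z.
  by apply/funext => z; rewrite /ph mkr.
exact: (C1s_D hg (C1s_sum (index_enum 'I_N) (fun k => C1s_M (ha k) (C1s_xi k)))).
Qed.

Let K := fat dl (pz @` C).

Lemma kc_out (h : Hn -> R) z : (forall p, ~ C p -> h p = 0) -> ~ K z -> kconv mu1 pz h ml z = 0.
Proof.
move=> h0 nK; rewrite /kconv (_ : (fun q => _) = fun=> 0) ?I0//; apply/funext => q.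
have [Cq|/h0 ->] := pselect (C q); last by rewrite mulr0.
rewrite /ml mol_out ?mul0r ?ltW// => cq; apply: nK; exists (pz q) => //.
Qed.

Lemma ph_out z : ~ K z -> ph z = 0.
Proof.
move=> nK; have a0 i : al i z = 0 by apply: kc_out => // p; exact: Hc_out.
have g0 : gm z = 0 by apply: kc_out => // p; exact: gc_out.
apply/rowP => m; rewrite [RHS]mxE; case: (split_ordP m) => i ->; first by rewrite /ph mkl mxE a0.
by rewrite /ph mkr g0 add0r big1// => k _; rewrite a0 mul0r.
Qed.

Let mlh (z : V) : intg mu1 (fun q => ml (z - pz q) * hker q) /\
  I mu1 (fun q => ml (z - pz q) * hker q) = 1.
Proof.
pose g (q : Hn) := ml (z - pz q) * hker q.
have cg : continuous g.
  apply: cont_M; last exact: cont_hker.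
  have h : continuous (fun y : V => ml (z - y)).
    by under eq_fun do rewrite /ml molC; exact: cont_shift.
  exact: (cont_pz h).
have pg := pmeas_continuous cg.
have im : intg mu (fun y : LebRN R N => ml (z - (y : V))) /\ I mu (fun y : LebRN R N => ml (z - (y : V))) = 1.
  have [h1 h2] := I_mol_shift z dl0.
  by rewrite /ml; split; under eq_fun do rewrite molC.
have gi : intg mu1 g.
  have hb (y : LebRN R N) : (\int[@lebesgue_measure R]_t `|g (mk y t)|%:E <= (ml (z - (y : V)))%:E)%E.
    have [h1 h2] := hker_t (y : V).
    have E : (fun t : R => `|g (mk y t)|) = fun t => ml (z - (y : V)) * hker (mk y t).
      apply/funext => t; rewrite /g pz_mk normrM !ger0_norm ?hker_ge0//.
      by rewrite /ml mol_ge0.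
    have hi : intg (@lebesgue_measure R) (fun t : R => `|g (mk y t)|) by rewrite E; exact: intgZ.
    by rewrite /= (intgE hi) E (IZ _ h1) h2 mulr1.
  have gi := @intg_prod R _ _ _ _ mu (@lebesgue_measure R) _ (fun y : LebRN R N => ml (z - (y : V))) pg hb im.1.

  exact: ((intg_split pg).2 gi).
split => //; rewrite (I_split1 pg gi) -im.2; congr I; apply/funext => y.
have [h1 h2] := hker_t (y : V).
under [X in I _ X]eq_fun do rewrite /g pz_mk.
by rewrite (IZ _ h1) h2 mulr1.
Qed.

(* [hker], times the mollifier, is a probability density in [q] (see [mlh]), and the field is
   bounded by 1 at each [q]: pair the mean with itself and use AM-GM. *)
Lemma ph_norm z : nrm2 z (ph z) <= 1.
Proof.
have az i : pz (ph z) ord0 i = al i z by rewrite /ph pz_mk mxE.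
have gE : gam eps sg pm z (ph z) = gm z / eps.
  rewrite /gam /ph pt_mk; congr (_ / _); apply/eqP; rewrite subr_eq; apply/eqP; congr (_ + _).
  by apply: eq_bigr => i _; rewrite pz_mk mxE.
have [B [mB _]] := mlB.
have aE i : intg mu1 (fun q => ml (z - pz q) * Hc (lshift 1 i) q).
  exact: (kconv_intg measurable_pz_coord (Hc_intg _) cml mB).
have gI : intg mu1 (fun q => ml (z - pz q) * gc q).
  exact: (kconv_intg measurable_pz_coord gc_intg cml mB).
set S := nrm2 z (ph z).
have SE : S = \sum_i al i z * al i z + (gm z / eps) * (gm z / eps).
  by rewrite /S /nrm2 gE -expr2; congr (_ + _); apply: eq_bigr => i _; rewrite az expr2.
have [mi m1] := mlh z.
pose F q := \sum_i al i z * (ml (z - pz q) * Hc (lshift 1 i) q) + gm z / eps / eps * (ml (z - pz q) * gc q).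
have Fi : intg mu1 F by apply: intgD; [apply: intg_sum => i; exact: intgZ|exact: intgZ].
have FE : I mu1 F = S.
  rewrite /F ID; [|by apply: intg_sum => i; exact: intgZ|exact: intgZ].
  rewrite Isum; last by move=> i; exact: intgZ.
  have gmE : I mu1 (fun q => ml (z - pz q) * gc q) = gm z by [].
  rewrite (IZ _ gI) SE gmE; congr (_ + _); last by field.
  by apply: eq_bigr => i _; rewrite (IZ _ (aE i)).
have hF q : F q <= (S + 1) / 2 * (ml (z - pz q) * hker q).
  pose Gq := gam eps sg pm (pz q) (U q).
  have -> : F q = ml (z - pz q) * hker q * (\sum_i al i z * pz (U q) ord0 i + gm z / eps * Gq).
    have gE' : gc q = hker q * (eps * Gq).
      rewrite /gc /Gq /gam /Hc (mulrC eps) divfK// mulrBr; congr (_ - _).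
      by rewrite big_distrr/=; apply: eq_bigr => i _; rewrite pzE; ring.
    rewrite /F gE' mulrDr; congr (_ + _); last by field.
    by rewrite big_distrr/=; apply: eq_bigr => i _; rewrite /Hc pzE; ring.
  rewrite mulrC ler_wpM2r//; first by rewrite mulr_ge0 ?hker_ge0// /ml mol_ge0.
  have := nU q; rewrite /nrm2 -/Gq => hn.
  have h1 : \sum_i al i z * pz (U q) ord0 i <= \sum_i (al i z * al i z + pz (U q) ord0 i ^+ 2) / 2.
    by apply: ler_sum => i _; have := sqr_ge0 (al i z - pz (U q) ord0 i); nra.
  have h2 : gm z / eps * Gq <= ((gm z / eps) * (gm z / eps) + Gq ^+ 2) / 2.
    by have := sqr_ge0 (gm z / eps - Gq); nra.
  move: h1; rewrite -big_distrl big_split/= => h1.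
  apply: (le_trans (lerD h1 h2)); rewrite SE.
  move: hn; set a := \sum_i _ ^+ 2; set b := \sum_i _; set c := _ / eps * _; set e := Gq ^+ 2.
  by move=> hn; lra.
(* Integrated against the probability density, the pointwise bound reads S <= (S + 1) / 2. *)
have := I_le Fi (intgZ ((S + 1) / 2) mi) hF.
rewrite FE (IZ _ mi) m1 mulr1 => h; lra.
Qed.

Lemma Testz_ph (A : set V) : K `<=` A -> Testz A ph.
Proof.
move=> KA; split; [exact: ph_C1s| |exact: ph_norm].
exists K; last exact: ph_out.
by split => //; apply: compact_fat; exact: compact_pz.
Qed.

(** Each term is transposed by [kernel_fubini]: the odd derivative of the kernel yields -D_i w, the
    unit mass yields [gc], the first moments yield xi_i at the point itself. The last contribution
    cancels the xi terms inside [gc], and [step_parts] remains. *)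
Lemma zflux_ph : zflux vt ph = I mu1 (fun q => step (ramp q) * divergence U q).
Proof.
rewrite step_parts.
have [B [mB DB]] := mlB.
have cK : compact K by apply: compact_fat; exact: compact_pz.
have mK : measurable (K : set (LebRN R N)) := leb_compact_measurable cK.
have Kfin : (mu K < +oo)%E := leb_compact_fin cK.
have i1K : intg mu \1_K := intg_indic mK Kfin.
have iK i : intg mu (fun z => xi i z * \1_K z).
  have [B' B'0 hB'] := compact_bound cK (@cont_xi i).
  apply: (@intg_bnd _ _ (LebRN R N) mu K B' _ mK Kfin).
    have m1 : measurable_fun setT (fun z : LebRN R N => xi i z) := measurable_continuous (@cont_xi i).
    have m2 : measurable_fun setT (\1_K : LebRN R N -> R) := intg_measurable i1K.
    exact: (measurable_funM m1 m2).
  move=> z; rewrite normrM indicE_asbool; case: asboolP => Kz; rewrite ?normr1 ?normr0 ?mulr1 ?mulr0//.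
  exact: hB'.
have a_fub i := kernel_fubini (C1s_cont_partial i (C1s_mol dl)) (DB i) vti (Hc_intg (lshift 1 i)).
have g_fub := kernel_fubini cml mB i1K gc_intg.
have x_fub i := kernel_fubini cml mB (iK i) (Hc_intg (lshift 1 i)).
have dE z : divz ph z = \sum_i kconv mu1 pz (Hc (lshift 1 i)) (D i ml) z.
  apply: eq_bigr => i _; have [_ <-] := kc (Hc_intg (lshift 1 i)).
  have -> : (fun z => ph z ord0 (lshift 1 i)) = al i by apply/funext => y; rewrite /ph mkl mxE.
  by [].
(* The factor \1_K makes 1 and xi_i integrable, as Fubini requires, and changes nothing because the
   averaged components vanish off [K]. *)
have ptE z : pt (ph z) = \1_K z * kconv mu1 pz gc ml z +
    \sum_i (xi i z * \1_K z) * kconv mu1 pz (Hc (lshift 1 i)) ml z.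
  rewrite indicE_asbool; case: asboolP => Kz.
    rewrite /ph pt_mk mul1r; congr (_ + _).
    by apply: eq_bigr => i _; rewrite mulr1 mulrC.
  by rewrite ph_out// /pt mxE mul0r add0r big1// => i _; rewrite mulr0 mul0r.
have E : (fun z => vt z * divz ph z + pt (ph z)) = (fun z =>
   \sum_i vt z * kconv mu1 pz (Hc (lshift 1 i)) (D i ml) z + (\1_K z * kconv mu1 pz gc ml z +
    \sum_i (xi i z * \1_K z) * kconv mu1 pz (Hc (lshift 1 i)) ml z)).
  by apply/funext => z; rewrite dE ptE big_distrr.
have s1 := intg_sum (index_enum 'I_N) (fun i => (a_fub i).1).
have s2 := intg_sum (index_enum 'I_N) (fun i => (x_fub i).1).
rewrite /zflux E (ID s1 (intgD g_fub.1 s2)) (ID g_fub.1 s2).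
rewrite (Isum (index_enum 'I_N) (fun i => (a_fub i).1)) (Isum (index_enum 'I_N) (fun i => (x_fub i).1)).
have KC q (z : V) : C q -> ml (z - pz q) * \1_K z = ml (z - pz q).
  move=> Cq; have [cz|nc] := pselect (cube dl (z - pz q)).
    by rewrite indicE mem_set ?mulr1//; exists (pz q) => //; exists q.
  by rewrite /ml mol_out ?mul0r ?ltW.
have e1 : I mu1 (fun q => gc q * I mu (fun z : LebRN R N => ml ((z : V) - pz q) * \1_K z)) = I mu1 gc.
  congr I; apply/funext => q; have [Cq|/gc_out ->] := pselect (C q); last by rewrite mul0r.
  have [_ h] := I_mol_shift (pz q) dl0.
  rewrite -[RHS]mulr1 -h; congr (_ * I _ _); apply/funext => z.
  exact: KC.
have e2 i : I mu1 (fun q => Hc (lshift 1 i) q * I mu (fun z : LebRN R N => ml ((z : V) - pz q) * (xi i z * \1_K z))) =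
    I mu1 (fun q => Hc (lshift 1 i) q * xi i (pz q)).
  congr I; apply/funext => q; have [Cq|/(Hc_out (lshift 1 i)) ->] := pselect (C q); last by rewrite !mul0r.
  congr (_ * _); have [h1 h] := mol_moment (pz q) (pm i) dl0.
  rewrite /xi -[in RHS]h -(IZ _ h1); congr I; apply/funext => z.
  by rewrite mulrCA KC// /ml -mulrA; congr (_ * _); exact: mulrC.
have e3 i : I mu1 (fun q => Hc (lshift 1 i) q * I mu (fun z : LebRN R N => D i (mol dl) ((z : V) - pz q) * vt z)) =
    - I mu1 (fun q => Hc (lshift 1 i) q * D i w (pz q)).
  have hi : intg mu1 (fun q => Hc (lshift 1 i) q * D i w (pz q)).
    apply: (intg_supp cC); last by move=> p nC; rewrite Hc_out// mul0r.
    by apply: cont_M; [exact: Hc_cont|exact: (cont_pz (C1s_cont_partial i hw.1))].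
  rewrite -IN//; congr I; apply/funext => q; rewrite -mulrN; congr (_ * _).
  have hi2 : intg mu (fun z : LebRN R N => D i ml (pz q - (z : V)) * vt z).
    exact: (kconv_intg (@measurable_coord R N) vti (C1s_cont_partial i (C1s_mol dl)) (DB i)).
  rewrite hw.2 /kconv -IN//; congr I; apply/funext => z.
  by rewrite -mulNr -D_mol_odd opprB.
transitivity (- (\sum_i I mu1 (fun q => Hc (lshift 1 i) q * D i w (pz q))) +
    (I mu1 gc + \sum_i I mu1 (fun q => Hc (lshift 1 i) q * xi i (pz q)))).
  congr (_ + (_ + _)).
  - by rewrite -sumrN; apply: eq_bigr => i _; exact: (eq_trans (a_fub i).2 (e3 i)).
  - exact: (eq_trans g_fub.2 e1).
  - by apply: eq_bigr => i _; exact: (eq_trans (x_fub i).2 (e2 i)).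
have hD i : intg mu1 (fun q => Hc (lshift 1 i) q * D i w (pz q)).
  apply: (intg_supp cC); last by move=> p nC; rewrite Hc_out// mul0r.
  by apply: cont_M; [exact: Hc_cont|exact: (cont_pz (C1s_cont_partial i hw.1))].
have hX i : intg mu1 (fun q => Hc (lshift 1 i) q * xi i (pz q)).
  apply: (intg_supp cC); last by move=> p nC; rewrite Hc_out// mul0r.
  by apply: cont_M; [exact: Hc_cont|apply: cont_pz; exact: cont_xi].
rewrite /gc (IB (Hc_intg _) (intg_sum _ hX)) (IB (Hc_intg _) (intg_sum _ hD)).
by rewrite (Isum _ hX) (Isum _ hD); ring.
Qed.

End one_step.

End smoothing.

Section tensor.
Context {R : realType} {N : nat}.
Local Notation mu := (lm R N).
Local Notation mu1 := (lm R (N + 1)).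
Local Notation leb := (@lebesgue_measure R).

Lemma pmeas_tensor (f : LebRN R N -> R) (b : R -> R) : measurable_fun setT f -> measurable_fun setT b ->
  pmeas (fun q : 'rV[R]_(N + 1) => f (pz q) * b (pt q)).
Proof.
move=> mf mb; rewrite /pmeas; under eq_fun do rewrite pz_mk pt_mk.
exact: (measurable_funM (measurableT_comp mf measurable_fst) (measurableT_comp mb measurable_snd)).
Qed.

Lemma tensor (f : LebRN R N -> R) (b : R -> R) : intg mu f -> intg leb b ->
  intg mu1 (fun q : LebRN R (N + 1) => f (pz q) * b (pt q)) /\
  I mu1 (fun q : LebRN R (N + 1) => f (pz q) * b (pt q)) = I mu f * I leb b.
Proof.
move=> fi bi.
have pm := pmeas_tensor (intg_measurable fi) (intg_measurable bi).
have gi : intg mu1 (fun q : LebRN R (N + 1) => f (pz q) * b (pt q)).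
  apply: (intg_split pm).2.
  have -> : (fun x : LebRN R N * R => f (pz (mk x.1 x.2)) * b (pt (mk x.1 x.2))) = fun x => f x.1 * b x.2.
    by apply/funext => x; rewrite pz_mk pt_mk.
  exact: (intg_prodM fi bi).
split; first exact: gi.
apply: (eq_trans (I_split1 pm gi)).
rewrite mulrC -(IZ _ fi); congr I; apply/funext => z.
have -> : (fun t : R => f (pz (mk z t)) * b (pt (mk z t))) = fun t => f z * b t.
  by apply/funext => t; rewrite pz_mk pt_mk.
by rewrite (IZ _ bi) mulrC.
Qed.

Lemma intg_itv (k : R) : intg leb \1_(`[- k, k]%classic).
Proof.
apply: intg_indic; first exact: measurable_itv.
have E := @lebesgue_measure_itv R `[- k, k].
by apply: (eq_ind_r (fun x : \bar R => x < +oo)%E _ E); rewrite /=; case: ifP => _; rewrite ?ltry// -EFinD ltry.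
Qed.

Lemma compact_pt (C : set 'rV[R]_(N + 1)) : compact C ->
  exists2 k : R, 0 < k & forall q, C q -> - k <= pt q <= k.
Proof.
move=> cC; have [B B0 hB] := compact_bound cC (@cont_pt R N).
exists (B + 1); first by lra.
by move=> q /hB; rewrite -ler_norml; lra.
Qed.

Lemma tensor_dom (f : 'rV[R]_(N + 1) -> R) (C : set 'rV[R]_(N + 1)) : compact C -> continuous f ->
  (forall p, ~ C p -> f p = 0) ->
  exists B k : R, [/\ 0 <= B, 0 < k & forall q, `|f q| <= B * \1_(`[- k, k]%classic) (pt q)].
Proof.
move=> cC cf f0; have [B B0 hB] := supp_bound cC cf f0; have [k k0 hk] := compact_pt cC.
exists B, k; split => // q; apply: le_trans (hB q) _; rewrite ler_wpM2l// !indicE_asbool.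
case: asboolP => Cq; last by case: asboolP.
by rewrite asboolT//= in_itv/= hk.
Qed.

End tensor.

(** * Removing the smoothing *)

Section smoothing_limit.
Context {R : realType} {N : nat}.
Variables (eps : R) (sg : 'I_N -> R) (pm : 'I_N -> 'I_N).
Hypothesis eps0 : eps != 0.
Local Notation mu := (lm R N).
Local Notation mu1 := (lm R (N + 1)).
Local Notation Hn := 'rV[R]_(N + 1).
Local Notation V := 'rV[R]_N.
Local Notation leb := (@lebesgue_measure R).
Local Notation Test := (Test eps sg pm).
Local Notation Testz := (Testz eps sg pm).
Implicit Types (v : V -> R) (U : Hn -> Hn).

Lemma zflux_loc v (phi : V -> Hn) (K : set V) : compact K -> (forall j, C1s (fun z => phi z ord0 j)) ->
  (forall z, ~ K z -> phi z = 0) -> zflux (fun z => v z * \1_K z) phi = zflux v phi.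
Proof.
move=> cK hphi phi0; rewrite /zflux; congr I; apply/funext => z.
rewrite indicE_asbool; case: asboolP => Kz; first by rewrite mulr1.
have -> : divz phi z = 0; last by rewrite !mulr0.
rewrite /divz big1// => i _.
apply: (D_supp i (rV_compact_closed cK) _ Kz) => y Ky.
by rewrite phi0// mxE.
Qed.

Section limit.
Variables (U : Hn -> Hn) (C : set Hn) (vt : LebRN R N -> R) (X : R).
Hypotheses (hU : C1 U) (cC : compact C) (U0 : forall p, ~ C p -> U p = 0).
Hypothesis vti : intg mu vt.

Definition ramp0 (w : V -> R) (j : R) (q : Hn) : R := step (j * w (pz q) - j * pt q) * divergence U q.

Let pramp0 (w : LebRN R N -> R) (j : R) : measurable_fun setT w -> pmeas (ramp0 w j).
Proof.
move=> mw; apply: (@measurable_funM _ _ _ _ _ _); last exact: (pmeas_continuous (div_cont hU)).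
have ms : measurable_fun setT (@step R) by apply: continuous_measurable_fun; exact: continuous_step.
apply: (measurableT_comp ms).
have -> : (fun x : LebRN R N * R => j * w (pz (mk x.1 x.2)) - j * pt (mk x.1 x.2)) =
    (fun x : LebRN R N * R => j * w x.1 - j * x.2).
  by apply/funext => x; rewrite pz_mk pt_mk.
apply: measurable_funB.
  exact: (measurable_funM (measurable_cst j) (measurableT_comp mw measurable_fst)).
exact: (measurable_funM (measurable_cst j) measurable_snd).
Qed.

Let iramp0 (w : LebRN R N -> R) (j : R) : measurable_fun setT w -> intg mu1 (ramp0 w j).
Proof.
move=> mw; apply: (intg_dom (pmeas_meas (pramp0 j mw)) _ (intg_abs (div_intg hU cC U0))) => q.
rewrite normrM ler_piMl// ger0_norm ?step_ge0//; exact: step_le1.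
Qed.

(** [step] is Lipschitz, so for fixed [j] the smoothed flux is Lipschitz in [w] for the L^1 norm.
    The constant grows with [j], which dictates the order of limits: mollification radius first, [j]
    afterwards. *)
Lemma ramp0_close (w : LebRN R N -> R) (j : R) : 0 < j -> intg mu w ->
  exists2 D : R, 0 <= D & forall w', intg mu w' ->
  `|I mu1 (ramp0 w' j) - I mu1 (ramp0 w j)| <= D * I mu (fun z => `|w' z - w z|).
Proof.
move=> j0 wi.
have [B [k [B0 k0 hB]]] := tensor_dom cC (div_cont hU) (div_supp hU cC U0).
exists (8 * j * B * I leb \1_(`[- k, k]%classic)).
  by rewrite !mulr_ge0 ?I_ge0// ?ltW// => t; rewrite indicE.
move=> w' wi'; have d := intg_abs (intgB wi' wi).
have [ti tE] := tensor d (intg_itv k).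
have i1 := iramp0 j (intg_measurable wi); have i2 := iramp0 j (intg_measurable wi').
rewrite -(IB i2 i1).
have -> : 8 * j * B * I leb \1_(`[- k, k]%classic) * I mu (fun z => `|w' z - w z|) =
   8 * j * B * I mu1 (fun q : LebRN R (N + 1) => `|w' (pz q) - w (pz q)| * \1_(`[- k, k]%classic) (pt q)).
  by rewrite tE; ring.
rewrite -(IZ _ ti); apply: (I_norm_le (intgB i2 i1) (intgZ _ ti)) => q.
rewrite /ramp0 -mulrBl normrM.
have h1 := step_lip (j * w' (pz q) - j * pt q) (j * w (pz q) - j * pt q).
have h2 : `|j * w' (pz q) - j * pt q - (j * w (pz q) - j * pt q)| = j * `|w' (pz q) - w (pz q)|.
  by rewrite -[in RHS](gtr0_norm j0) -normrM; congr (Num.norm _); ring.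
rewrite h2 in h1.
apply: (le_trans (ler_pM _ _ h1 (hB q))) => //.
by rewrite le_eqVlt; apply/orP; left; apply/eqP; ring.
Qed.

(* As [j -> oo], the smoothed indicators converge pointwise to that of [t < vt z]. *)
Lemma ramp0_cvg (E : set Hn) : (forall q, C q -> (E q <-> pt q < vt (pz q))) ->
  (forall j, 0 < j -> I mu1 (ramp0 vt j) <= X) -> measurable (E : set (LebRN R (N + 1))) ->
  flux E U <= X.
Proof.
move=> hE hX mE.
have cvp (q : Hn) : ramp0 vt n.+1%:R q @[n --> \oo] --> divergence U q * \1_E q.
  rewrite /ramp0.
  have [Cq|nC] := pselect (C q); last first.
    by rewrite (div_supp hU cC U0 nC) mul0r; under eq_fun do rewrite mulr0; exact: cvg_cst.
  under eq_fun do rewrite mulrC.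
  apply: cvgM; first exact: cvg_cst.
  rewrite indicE_asbool; case: asboolP => Eq.
    have d0 : 0 < vt (pz q) - pt q by rewrite subr_gt0; apply/(hE q Cq).
    apply: cvg_near_cst.
    near=> n.
    have hn : (vt (pz q) - pt q)^-1 <= n%:R by near: n; exact: nbhs_infty_ger.
    rewrite step1// -mulrBr -ler_pdivrMr// div1r; apply: le_trans hn _.
    by rewrite ler_nat.
  have d0 : vt (pz q) - pt q <= 0.
    by rewrite subr_le0 leNgt; apply/negP => h; apply: Eq; apply/(hE q Cq).
  apply: cvg_near_cst; apply: nearW => n.
  by rewrite step0// -mulrBr mulr_ge0_le0.
have m1 n : measurable_fun setT (ramp0 vt n.+1%:R : LebRN R (N + 1) -> R).
  exact: (pmeas_meas (pramp0 _ (intg_measurable vti))).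
have fi := flux_intg mE hU cC U0.
have ae : {ae mu1, forall q : LebRN R (N + 1), ramp0 vt n.+1%:R q @[n --> \oo] --> divergence U q * \1_E q}.
  by apply/aeW => q; exact: cvp.
have dom n (q : LebRN R (N + 1)) : `|ramp0 vt n.+1%:R q| <= `|divergence U q|.
  rewrite normrM ler_piMl// ger0_norm ?step_ge0//; exact: step_le1.
have cv : I mu1 (ramp0 vt n.+1%:R) @[n --> \oo] --> I mu1 (fun p => divergence U p * \1_E p).
  exact: (I_dct m1 (intg_measurable fi) ae (intg_abs (div_intg hU cC U0)) dom).
rewrite /flux -(cvg_lim _ cv)//.
apply: limr_le; first by apply/cvg_ex; exists (I mu1 (fun p => divergence U p * \1_E p)).
by apply: nearW => n; apply: hX.
Unshelve. all: by end_near. Qed.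

End limit.

(** For fixed [j], the smoothed flux through the subgraph of a mollification of v is some
    [zflux v phi], hence at most [X]; then the radius tends to 0, and finally [j] to infinity. *)
Lemma per_le_zflux (Omt : set V) (v : V -> R) (E : set Hn) (X : R) : open Omt ->
  (forall K, compact K -> K `<=` Omt -> intg mu (fun z => v z * \1_K z)) ->
  (forall q, Omt (pz q) -> (E q <-> pt q < v (pz q))) -> measurable (E : set (LebRN R (N + 1))) ->
  (forall phi, Testz Omt phi -> zflux v phi <= X) ->
  (per eps sg pm E [set q | Omt (pz q)] <= X%:E)%E.
Proof.
move=> oO vloc hE mE hX; apply: per_le => U [hU [[C [cC CO] U0] nU]]; rewrite lee_fin.
have cz := compact_pz cC.
have zO : @pz R N @` C `<=` Omt by move=> _ [q Cq <-]; exact: CO.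
have [d d0 dO] := fat_in_open cz oO zO.
pose K := fat d (@pz R N @` C); have cK : compact K by exact: compact_fat.
pose vt (z : LebRN R N) : R := v z * \1_K z.
have vti : intg mu vt := vloc K cK dO.
apply: (@ramp0_cvg U C vt X hU cC U0 vti E _ _ mE).
  move=> q Cq; rewrite /vt indicE mem_set ?mulr1; first exact: hE (CO _ Cq).
  by apply: sub_fat; [exact: ltW|exists q].
move=> j j0; apply/ler_addgt0Pr => e e0.
have [D D0 hD] := @ramp0_close U C hU cC U0 vt j j0 vti.
have e'0 : 0 < e / (D + 1) by rewrite divr_gt0//; lra.
have [d' d'0 hd'] := kconv_mol_cvg vti e'0.
(* The first bound keeps the support of the averaged field inside [Omt], the second makes the L^1
   error at most e / (D + 1). *)
pose dl := Num.min (d / 2) (d' / 2).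
have dl0 : 0 < dl by rewrite lt_min; apply/andP; split; lra.
have dld : dl <= d by rewrite ge_min; apply/orP; left; lra.
have dld' : dl < d' by rewrite gt_min; apply/orP; right; lra.
pose w := kconv mu id vt (mol dl).
have wi : intg mu w.
  have hw := (kconv_C1s (@measurable_coord R N) vti (C1s_mol dl) (@compact_cube R N dl)
    (fun p => mol_out (ltW dl0))).1.
  apply: (intg_supp (@compact_fat R N dl K cK) (C1s_continuous hw)) => z nK.
  rewrite /w /kconv (_ : (fun q => _) = fun=> 0) ?I0//; apply/funext => q.
  rewrite /vt indicE_asbool; case: asboolP => Kq; last by rewrite !mulr0.
  by rewrite mol_out ?mul0r ?ltW// => cq; apply: nK; exists q.
have h1 : I mu1 (ramp0 U w j) <= X.
  have <- := @zflux_ph R N sg pm U C vt dl j hU cC U0 vti dl0.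
  have fd : fat dl (@pz R N @` C) `<=` K by exact: fat_sub.
  have T := Testz_ph eps0 hU cC U0 nU vti dl0 j0 (subset_trans fd dO).
  rewrite zflux_loc//; [exact: hX|by case: T|].
  move=> z nK; apply: (@ph_out R N sg pm U C vt dl j U0 dl0) => /fd; exact: nK.
have := hD w wi; have := hd' dl dl0 dld'; rewrite -/w.
move=> h2 h3.
have h4 : D * I mu (fun z => `|w z - vt z|) <= e.
  apply: (le_trans (ler_wpM2l D0 h2)); rewrite mulrCA ler_piMr ?(ltW e0)// ler_pdivrMr; lra.
move: h3; rewrite ler_norml => /andP[h3 _].
lra.
Qed.

End smoothing_limit.

(** * Rearrangement *)

Section compact_cyl.
Context {R : realType} {N : nat}.

Lemma compact_slab (K : set 'rV[R]_N) (k : R) : compact K ->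
  compact [set q : 'rV[R]_(N + 1) | K (pz q) /\ - k <= pt q <= k].
Proof.
move=> cK.
have -> : [set q : 'rV[R]_(N + 1) | K (pz q) /\ - k <= pt q <= k] =
    (fun x : 'rV[R]_N * R => mk x.1 x.2) @` (K `*` `[- k, k]%classic).
  apply/seteqP; split => q /=.
    by move=> [Kq hq]; exists (pz q, pt q); [split => //=; rewrite in_itv|rewrite /= mkK].
  by move=> [[z t] [/= Kz]]; rewrite in_itv/= => ht <-; rewrite pz_mk pt_mk.
apply: continuous_compact; last exact: compact_setX cK (@segment_compact R (- k) k).
apply: continuous_subspaceT => x A /rV_nbhs[r r0 hr].
exists ([set p : 'rV[R]_N | forall j, `|x.1 ord0 j - p ord0 j| < r], [set t : R | `|x.2 - t| < r]).
  split; last exact: nbhsx_ballx.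
  by apply/rV_nbhs; exists r.
move=> [p t] [/= hp ht]; apply: hr => j.
by case: (split_ordP j) => i ->; rewrite ?mkl ?mkr.
Qed.

End compact_cyl.

Section pmeas_algebra.
Context {R : realType} {N : nat}.
Local Notation Hn := 'rV[R]_(N + 1).
Implicit Types (f g : Hn -> R).

Lemma pmeas_pz (f : LebRN R N -> R) : measurable_fun setT f -> pmeas (fun q : Hn => f (pz q)).
Proof.
by move=> mf; rewrite /pmeas; under eq_fun do rewrite pz_mk; exact: (measurableT_comp mf measurable_fst).
Qed.

Lemma pmeas_pt (b : R -> R) : measurable_fun setT b -> pmeas (fun q : Hn => b (pt q)).
Proof.
by move=> mb; rewrite /pmeas; under eq_fun do rewrite pt_mk; exact: (measurableT_comp mb measurable_snd).
Qed.

Lemma pmeasM f g : pmeas f -> pmeas g -> pmeas (fun q => f q * g q).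
Proof. exact: measurable_funM. Qed.

Lemma pmeasB f g : pmeas f -> pmeas g -> pmeas (fun q => f q - g q).
Proof. exact: measurable_funB. Qed.

Lemma pmeas_set (F : set Hn) : pmeas (\1_F : Hn -> R) -> measurable (F : set (LebRN R (N + 1))).
Proof.
move=> /pmeas_meas mF.
have -> : F = setT `&` (\1_F : LebRN R (N + 1) -> R) @^-1` [set 1].
  rewrite setTI; apply/seteqP; split => q /=; rewrite indicE_asbool; case: asboolP => //.
  by move=> _ /esym /eqP; rewrite oner_eq0.
by apply: mF => //; exact: measurable_set1.
Qed.

Lemma measurable_indic_compact (K : set 'rV[R]_N) : compact K ->
  measurable_fun setT (\1_K : LebRN R N -> R).
Proof. by move=> cK; apply: measurable_indic; exact: (leb_compact_measurable cK). Qed.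

End pmeas_algebra.

Section height.
Context {R : realType} {N : nat}.
Variables (eps : R) (sg : 'I_N -> R) (pm : 'I_N -> 'I_N).
Hypothesis eps0 : eps != 0.
Local Notation mu := (lm R N).
Local Notation mu1 := (lm R (N + 1)).
Local Notation Hn := 'rV[R]_(N + 1).
Local Notation V := 'rV[R]_N.
Local Notation leb := (@lebesgue_measure R).
Local Notation per := (per eps sg pm).
Local Notation Test := (Test eps sg pm).
Local Notation Testz := (Testz eps sg pm).
Local Notation D i f := ('D_(basisv R i) f).

Definition neg : R -> R := \1_(`]-oo, 0[%classic).

(* [hgt F z] is the height of the subgraph having the same measure on the vertical line over [z] as [F]. *)
Definition hgt (F : set Hn) (z : V) : R := I leb (fun t => \1_F (mk z t) - neg t).

Lemma measurable_neg : measurable_fun setT neg.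
Proof. by apply: measurable_indic; exact: measurable_itv. Qed.

Lemma negE t : neg t = if t < 0 then 1 else 0.
Proof.
by rewrite /neg indicE_asbool; case: asboolP; rewrite /= in_itv/=; case: ltP.
Qed.

(** A C^1 cutoff equal to 1 for |t| <= k and to 0 for |t| >= k + 1; [det] is its derivative. *)
Definition et (k : nat) (t : R) : R := step (t + (k%:R + 1)) - step (t - k%:R).
Definition det (k : nat) (t : R) : R := dstep (t + (k%:R + 1)) - dstep (t - k%:R).

Definition vtest (phi : V -> Hn) (k : nat) (q : Hn) : Hn := et k (pt q) *: phi (pz q).

Lemma et_ge0 k t : 0 <= et k t <= 1.
Proof.
have k0 : 0 <= k%:R :> R by [].
rewrite /et; have [h|h] := leP t k%:R.
  by rewrite (@step0 _ (t - _)) ?subr0 ?step_ge0 ?step_le1//; lra.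
rewrite (@step1 _ (t + _)); last by lra.
by have := step_ge0 (t - k%:R); have := step_le1 (t - k%:R); lra.
Qed.

Lemma et_out k t : ~ (- (k%:R + 1) <= t <= k%:R + 1) -> et k t = 0.
Proof.
have k0 : 0 <= k%:R :> R by [].
move=> h; rewrite /et; have [h1|h1] := ltP t (- (k%:R + 1)).
  by rewrite !step0 ?subrr//; lra.
have h2 : k%:R + 1 < t by rewrite ltNge; apply/negP => h2; apply: h; rewrite h1 h2.
by rewrite !step1 ?subrr//; lra.
Qed.

(** Against the reference half-line t < 0 only the lower edge of the cutoff counts, and its mass is
    1: this produces the vertical term of [zflux]. *)
Lemma det_neg k t : det k t * neg t = 1 * dstep (1 * t + (k%:R + 1)).
Proof.
have k0 : 0 <= k%:R :> R by [].
rewrite !mul1r negE /det; case: ltP => h.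
  by rewrite mulr1 (@dstep_out _ (t - k%:R)) ?subr0//; left; lra.
by rewrite mulr0 dstep_out//; right; lra.
Qed.

Lemma et_cvg t : \forall k \near \oo, et k t = 1 /\ det k t = 0.
Proof.
near=> k.
have hk : `|t| <= k%:R by near: k; exact: nbhs_infty_ger.
move: hk; rewrite ler_norml => /andP[h1 h2].
rewrite /et /det (@step1 _ (t + _)); last by lra.
rewrite step0; last by lra.
rewrite !dstep_out ?subrr ?subr0//; [left|right]; lra.
Unshelve. all: by end_near. Qed.

Section vtest.
Variables (phi : V -> Hn) (Omt K : set V).
Hypotheses (hphi : forall j, C1s (fun z => phi z ord0 j)) (cK : compact K) (KO : K `<=` Omt).
Hypotheses (phi0 : forall z, ~ K z -> phi z = 0) (nphi : forall z, nrm2 eps sg pm z (phi z) <= 1).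

Let hst (c : R) : C1s (fun q : Hn => pt q + c).
Proof. exact: (C1s_D (@C1s_coord R (N + 1) (rshift N ord0)) (@C1s_cst R (N + 1) c)). Qed.

Let Dst (c : R) m q : D m (fun q : Hn => pt q + c) q = (rshift N (ord0 : 'I_1) == m)%:R.
Proof.
apply: (eq_trans (D_D m q (@C1s_coord R (N + 1) (rshift N ord0)) (@C1s_cst R (N + 1) c))).
have [_ h] := is_derive_coord m (rshift N (ord0 : 'I_1)) q.
by rewrite h derive_cst addr0.
Qed.

Let hs (c : R) : C1s (fun q : Hn => step (pt q + c)).
Proof. exact: (C1s_comp (@is_derive_step R) (@continuous_dstep R) (hst c)). Qed.

Let Ds (c : R) m q : D m (fun q : Hn => step (pt q + c)) q =
  dstep (pt q + c) * (rshift N (ord0 : 'I_1) == m)%:R.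
Proof. by apply: (eq_trans (D_comp m q (@is_derive_step R) (hst c))); congr (_ * _); exact: Dst. Qed.

Let etE k : (fun q : Hn => et k (pt q)) = fun q => step (pt q + (k%:R + 1)) + -1 * step (pt q + - k%:R).
Proof. by apply/funext => q; rewrite mulN1r. Qed.

Let hn k : C1s (fun q : Hn => -1 * step (pt q + - k%:R)).
Proof. exact: (C1s_M (@C1s_cst R (N + 1) (-1)) (hs _)). Qed.

Lemma C1s_et k : C1s (fun q : Hn => et k (pt q)).
Proof. by rewrite etE; exact: (C1s_D (hs _) (hn k)). Qed.

Lemma D_et k m q : D m (fun q : Hn => et k (pt q)) q = det k (pt q) * (rshift N (ord0 : 'I_1) == m)%:R.
Proof.
rewrite etE (D_D m q (hs _) (hn k)) (D_M m q (@C1s_cst R (N + 1) (-1)) (hs _)) !Ds derive_cst /det.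
by ring.
Qed.

Let phiz_C1 : C1 (fun q : Hn => phi (pz q)).
Proof. by move=> j; exact: (C1s_pz (hphi j)). Qed.

Lemma div_vtest k q : divergence (vtest phi k) q = et k (pt q) * divz phi (pz q) + det k (pt q) * pt (phi (pz q)).
Proof.
apply: (eq_trans (div_mul q (C1s_et k) phiz_C1)); congr (_ * _ + _).
  rewrite /divergence sum_split (D_pz_r (fun z => phi z ord0 (rshift N ord0))) addr0.
  by apply: eq_bigr => i _; exact: (D_pz_l i q (hphi _)).
rewrite sum_split big1 => [|i _]; last by rewrite D_et eq_rlshift !mulr0.
by rewrite D_et eqxx mulr1 add0r mulrC.
Qed.

Lemma vtest_C1 k : C1 (vtest phi k).
Proof. exact: (C1_mul (C1s_et k) phiz_C1). Qed.

Definition vsupp (k : nat) : set Hn := [set q : Hn | K (pz q) /\ - (k%:R + 1) <= pt q <= k%:R + 1].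

Lemma vtest_out k q : ~ vsupp k q -> vtest phi k q = 0.
Proof.
move=> /not_andP[/phi0 h|/et_out h]; first by rewrite /vtest h scaler0.
by rewrite /vtest h scale0r.
Qed.

Lemma Test_vtest k : Test [set q | Omt (pz q)] (vtest phi k).
Proof.
split; first exact: vtest_C1.
split; last by move=> q; exact: (nrm2_scale eps0 (et_ge0 k (pt q)) (nphi (pz q))).
exists (vsupp k); last exact: vtest_out.
by split; [exact: compact_slab|move=> q [/KO]].
Qed.

Lemma cont_divz : continuous (divz phi).
Proof. by apply: cont_sum => i; exact: (C1s_cont_partial i (hphi _)). Qed.

Lemma divz_out z : ~ K z -> divz phi z = 0.
Proof.
move=> nK; rewrite /divz big1// => i _.
by apply: (D_supp i (rV_compact_closed cK) _ nK) => y /phi0 ->; rewrite mxE.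
Qed.

Lemma pt_out z : ~ K z -> pt (phi z) = 0.
Proof. by move=> /phi0 ->; rewrite /pt mxE. Qed.

Lemma intg_divz : intg mu (divz phi).
Proof. exact: (intg_supp cK cont_divz divz_out). Qed.

Lemma cont_ptphi : continuous (fun z => pt (phi z)).
Proof. exact: (C1s_continuous (hphi _)). Qed.

Lemma intg_ptphi : intg mu (fun z => pt (phi z)).
Proof. exact: (intg_supp cK cont_ptphi pt_out). Qed.

Lemma I_divz0 : I mu (divz phi) = 0.
Proof.
have h i : intg mu (D i (fun z => phi z ord0 (lshift 1 i))).
  apply: (intg_supp cK (C1s_cont_partial i (hphi _))) => z.
  by apply: (D_supp i (rV_compact_closed cK)) => y /phi0 ->; rewrite mxE.
rewrite /divz (Isum _ h) big1// => i _.
by apply: (I_D0 i (hphi _) cK) => y /phi0 ->; rewrite mxE.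
Qed.

Section flux.
Variable F : set Hn.
Hypothesis mF : pmeas (\1_F : Hn -> R).
Hypothesis Floc : intg mu1 (fun q : LebRN R (N + 1) => \1_K (pz q) * (\1_F q - neg (pt q))).
Hypothesis Fsec : forall z, K z -> intg leb (fun t => \1_F (mk z t) - neg t).

Let DK (q : Hn) : R := \1_K (pz q) * (\1_F q - neg (pt q)).
Let G k (q : Hn) : R := (et k (pt q) * divz phi (pz q) + det k (pt q) * pt (phi (pz q))).

Let GK k q : G k q * \1_K (pz q) = G k q.
Proof.
rewrite indicE_asbool; case: asboolP => h; first by rewrite mulr1.
by rewrite /G divz_out// pt_out// !mulr0 addr0.
Qed.

Let intg_et k : intg leb (fun t => et k t * neg t).
Proof.
have m1 c : measurable_fun setT (fun t : R => step (t + c)).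
  apply: continuous_measurable_fun.
  have -> : (fun t : R => step (t + c)) = fun t => step (1 * t + c) by apply/funext => t; rewrite mul1r.
  exact: (@continuous_affine R 1 c _ (@continuous_step R)).
have me : measurable_fun setT (fun t => et k t * neg t).
  exact: (measurable_funM (measurable_funB (m1 (k%:R + 1)) (m1 (- k%:R))) measurable_neg).
have dom (t : R) : `|et k t * neg t| <= \1_(`[- (k%:R + 1), k%:R + 1]%classic) t.
  have n1 : `|neg t| <= 1 by rewrite negE; case: ifP; rewrite ?normr1// normr0.
  rewrite normrM indicE_asbool; case: asboolP => ht.
    have /andP[h1 h2] := et_ge0 k t; rewrite (ger0_norm h1) -[leRHS]mul1r.
    exact: ler_pM.
  by rewrite et_out ?normr0 ?mul0r// => h; apply: ht; rewrite /= in_itv.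
exact: (@intg_dom R _ _ leb _ _ me dom (intg_itv (k%:R + 1))).
Qed.

Let intg_det k : intg leb (fun t => det k t * neg t) /\ I leb (fun t => det k t * neg t) = 1.
Proof.
rewrite (_ : (fun t => _) = fun t => 1 * dstep (1 * t + (k%:R + 1))); last first.
  by apply/funext => t; exact: det_neg.
exact: (I_dstep_up (k%:R + 1) ltr01).
Qed.

(** Split \1_F into \1_F - neg, integrable over K x R, and neg, whose flux is explicit: the [et]
    part vanishes with the integral of div_z phi, and the [det] part has mass 1. *)
Lemma flux_vtest k : flux F (vtest phi k) = I mu1 (fun q => G k q * DK q) + I mu (fun z => pt (phi z)).
Proof.
have [t1 e1] := tensor intg_divz (intg_et k).
have [t2 e2] := tensor intg_ptphi (intg_det k).1.
have i0 : intg mu1 (fun q => divergence (vtest phi k) q * \1_F q).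
  exact: (flux_intg (pmeas_set mF) (vtest_C1 k) (@compact_slab R N K (k%:R + 1) cK) (@vtest_out k)).
have E q : divergence (vtest phi k) q * \1_F q = G k q * DK q +
   (divz phi (pz q) * (et k (pt q) * neg (pt q)) + pt (phi (pz q)) * (det k (pt q) * neg (pt q))).
  have -> : G k q * DK q = G k q * (\1_F q - neg (pt q)) by rewrite /DK mulrA GK.
  rewrite div_vtest /G; ring.
have i1 : intg mu1 (fun q => G k q * DK q).
  have -> : (fun q => G k q * DK q) = fun q => divergence (vtest phi k) q * \1_F q -
   (divz phi (pz q) * (et k (pt q) * neg (pt q)) + pt (phi (pz q)) * (det k (pt q) * neg (pt q))).
    by apply/funext => q; rewrite E; ring.
  exact: (intgB i0 (intgD t1 t2)).
transitivity (I mu1 (fun q => G k q * DK q + (divz phi (pz q) * (et k (pt q) * neg (pt q)) +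
    pt (phi (pz q)) * (det k (pt q) * neg (pt q))))).
  by congr I; apply/funext => q; exact: E.
rewrite (ID i1 (intgD t1 t2)) (ID t1 t2) e1 e2 I_divz0 (intg_det k).2; ring.
Qed.

Lemma flux_vtest_cvg : flux F (vtest phi k) @[k --> \oo] --> zflux (hgt F) phi.
Proof.
pose L (q : Hn) := divz phi (pz q) * DK q.
have [B B0 hB] := supp_bound cK cont_divz divz_out.
have [B' B'0 hB'] := supp_bound cK cont_ptphi pt_out.
have pDK : pmeas DK.
  exact: (pmeasM (pmeas_pz (measurable_indic_compact cK)) (pmeasB mF (pmeas_pt measurable_neg))).
have pL : pmeas L := pmeasM (pmeas_continuous (cont_pz cont_divz)) pDK.
have pG k : pmeas (fun q => G k q * DK q).
  apply: (pmeasM _ pDK); have -> : G k = divergence (vtest phi k).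
    by apply/funext => q; rewrite div_vtest.
  exact: (pmeas_continuous (div_cont (vtest_C1 k))).
have i1K (b : R) z : 0 <= b -> b * \1_K z <= b.
  by move=> b0; rewrite indicE_asbool; case: ifP; rewrite ?mulr1 ?mulr0.
(* [et] is at most 1, and [det], a difference of two values of [dstep], is at most 8 + 8. *)
have dom k (q : LebRN R (N + 1)) : `|G k q * DK q| <= (B + 16 * B') * `|DK q|.
  rewrite normrM ler_wpM2r// /G; apply: (le_trans (ler_normD _ _)); rewrite !normrM; apply: lerD.
    have /andP[h1 h2] := et_ge0 k (pt q); rewrite -[B]mul1r (ger0_norm h1).
    by apply: ler_pM => //; exact: (le_trans (hB _) (i1K _ _ B0)).
  apply: ler_pM => //; last exact: (le_trans (hB' _) (i1K _ _ B'0)).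
  rewrite /det ler_norml; set a := dstep _; set b := dstep _.
  have [a0 a8] : 0 <= a /\ a <= 8 by rewrite dstep_ge0 dstep_le.
  have [b0 b8] : 0 <= b /\ b <= 8 by rewrite dstep_ge0 dstep_le.
  lra.
have ae : {ae mu1, forall q : LebRN R (N + 1), G k q * DK q @[k --> \oo] --> L q}.
  apply/aeW => q; apply: cvg_near_cst; apply: filterS (et_cvg (pt q)) => k [h1 h2].
  by rewrite /G h1 h2 mul1r mul0r addr0.
have cv : I mu1 (fun q => G k q * DK q) @[k --> \oo] --> I mu1 L.
  exact: (I_dct (fun k => pmeas_meas (pG k)) (pmeas_meas pL) ae (intgZ (B + 16 * B') (intg_abs Floc)) dom).
have Li : intg mu1 L.
  apply: (intg_dom (pmeas_meas pL) _ (intgZ B (intg_abs Floc))) => q.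
  by rewrite normrM ler_wpM2r//; exact: (le_trans (hB _) (i1K _ _ B0)).
have inner z : I leb (fun t => L (mk z t)) = hgt F z * divz phi z.
  rewrite /L /DK; under [X in I _ X]eq_fun do rewrite pz_mk pt_mk.
  rewrite indicE_asbool; case: asboolP => Kz; last first.
    rewrite divz_out// mulr0; under [X in I _ X]eq_fun do rewrite mul0r.
    by rewrite I0.
  under [X in I _ X]eq_fun do rewrite mul1r.
  by rewrite (IZ _ (Fsec Kz)) mulrC.
have iz : intg mu (fun z => hgt F z * divz phi z).
  have := intg_I1 ((intg_split pL).1 Li).
  by rewrite (_ : (fun z => _) = fun z => hgt F z * divz phi z)//; apply/funext => z; exact: inner.
have -> : zflux (hgt F) phi = I mu1 L + I mu (fun z => pt (phi z)).
  rewrite /zflux (ID iz intg_ptphi) (I_split1 pL Li); congr (_ + _).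
  by congr I; apply/funext => z; rewrite inner.
under eq_fun do rewrite flux_vtest.
by apply: cvgD => //; exact: cvg_cst.
Qed.

End flux.
End vtest.

(** F is {t < 0} up to an integrable amount over each compact set. The condition on sections is
    asked for every z rather than almost every z, so that [hgt F] is meaningful pointwise. *)
Definition loc_subgraph (Omt : set V) (F : set Hn) : Prop :=
  forall K, compact K -> K `<=` Omt ->
    intg mu1 (fun q : LebRN R (N + 1) => \1_K (pz q) * (\1_F q - neg (pt q))) /\
    forall z, K z -> intg leb (fun t => \1_F (mk z t) - neg t).

(** The truncated fields [vtest phi k] are admissible for every [k], and their fluxes through F tend
    to that of the height function. *)
Lemma zflux_le_per (Omt : set V) (F : set Hn) (phi : V -> Hn) : pmeas (\1_F : Hn -> R) ->
  loc_subgraph Omt F -> Testz Omt phi -> ((zflux (hgt F) phi)%:E <= per F [set q | Omt (pz q)])%E.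
Proof.
move=> mF hF [hphi [K [cK KO] phi0] nphi].
have [Floc Fsec] := hF K cK KO.
have cv := flux_vtest_cvg hphi cK phi0 mF Floc Fsec.
have hk k := per_ub F (Test_vtest hphi cK KO phi0 nphi k).
move: hk; case: (per _ _) => [x hk| |hk]; [|by rewrite leey|by have := hk 0; rewrite leeNy_eq].
rewrite lee_fin -(cvg_lim _ cv)//.
apply: limr_le; first by apply/cvg_ex; exists (zflux (hgt F) phi).
by apply: nearW => k; have := hk k; rewrite lee_fin.
Qed.

Lemma hgt_loc (Omt : set V) (F : set Hn) (K : set V) : pmeas (\1_F : Hn -> R) ->
  loc_subgraph Omt F -> compact K -> K `<=` Omt -> intg mu (fun z => hgt F z * \1_K z).
Proof.
move=> mF hF cK KO; have [Floc Fsec] := hF K cK KO.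
have pmz : pmeas (fun q : Hn => \1_K (pz q) * (\1_F q - neg (pt q))).
  exact: (pmeasM (pmeas_pz (measurable_indic_compact cK)) (pmeasB mF (pmeas_pt measurable_neg))).
have := intg_I1 ((intg_split pmz).1 Floc).
rewrite (_ : (fun z => _) = fun z => hgt F z * \1_K z)//; apply/funext => z /=.
under [X in I _ X]eq_fun do rewrite pz_mk pt_mk.
rewrite indicE_asbool; case: asboolP => Kz; last first.
  by rewrite mulr0; under [X in I _ X]eq_fun do rewrite mul0r; rewrite I0.
by rewrite mulr1; under [X in I _ X]eq_fun do rewrite mul1r.
Qed.

(** [per_le_zflux] bounds P(E) through the fluxes of [hgt F], and [zflux_le_per] bounds those by
    P(F). *)
Lemma per_rearrange (Omt : set V) (E F : set Hn) : open Omt -> pmeas (\1_F : Hn -> R) ->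
  loc_subgraph Omt F -> measurable (E : set (LebRN R (N + 1))) ->
  (forall q, Omt (pz q) -> (E q <-> pt q < hgt F (pz q))) ->
  (per E [set q | Omt (pz q)] <= per F [set q | Omt (pz q)])%E.
Proof.
move=> oO mF hF mE hE; have := @zflux_le_per Omt F _ mF hF; have := per_ge0 eps sg pm F [set q | Omt (pz q)].
case: (per F _) => [x _ hx|_ _|]; [|by rewrite leey|by rewrite leeNy_eq].
apply: (per_le_zflux eps0 oO _ hE mE) => [K cK KO|phi T]; first exact: hgt_loc KO.
by have := hx phi T; rewrite lee_fin.
Qed.

End height.

(** * Cutting along a horizontal hyperplane *)

Section cut.
Context {R : realType} {N : nat}.
Variables (eps : R) (sg : 'I_N -> R) (pm : 'I_N -> 'I_N).
Hypothesis eps0 : eps != 0.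
Local Notation mu := (lm R N).
Local Notation mu1 := (lm R (N + 1)).
Local Notation Hn := 'rV[R]_(N + 1).
Local Notation V := 'rV[R]_N.
Local Notation leb := (@lebesgue_measure R).
Local Notation per := (per eps sg pm).
Local Notation Test := (Test eps sg pm).
Local Notation D i f := ('D_(basisv R i) f).
Implicit Types (E F A : set Hn).

Lemma Test_opp A U : Test A U -> Test A (fun p => - U p).
Proof.
move=> [hU [[C [cC CA] U0] nU]].
have -> : (fun p => - U p) = fun p => (-1 : R) *: U p by apply/funext => p; rewrite scaleN1r.
split; first exact: (C1_mul (@C1s_cst R (N + 1) (-1)) hU).
split; first by exists C => // p /U0 ->; rewrite scaler0.
move=> p.
have -> : nrm2 eps sg pm (pz p) (-1 *: U p) = nrm2 eps sg pm (pz p) (U p); last exact: nU.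
rewrite /nrm2; congr (_ + _).
  by apply: eq_bigr => i _; rewrite !pzE mxE mulN1r sqrrN.
have -> : gam eps sg pm (pz p) (-1 *: U p) = - gam eps sg pm (pz p) (U p); last by rewrite sqrrN.
by have := gam_lin sg pm eps0 (pz p) (U p) (U p) (-1) 0; rewrite scale0r addr0 mul0r addr0 mulN1r.
Qed.

(** The divergence of a compactly supported field has integral 0, so its flux through the complement
    is that of the opposite field through [F]. *)
Lemma per_compl A F : measurable (F : set (LebRN R (N + 1))) -> per (~` F) A = per F A.
Proof.
have le G : measurable (G : set (LebRN R (N + 1))) -> (per (~` G) A <= per G A)%E.
  move=> mG; apply: per_le => U TU; have [hU [[C [cC CA] U0] nU]] := TU.
  have h := per_ub G (Test_opp TU).
  rewrite (_ : flux (~` G) U = flux G (fun p => - U p))//.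
  have di := div_intg hU cC U0.
  have -> : flux G (fun p => - U p) = - flux G U.
    rewrite /flux -IN; last exact: (flux_intg mG hU cC U0).
    congr I; apply/funext => p; rewrite -mulNr; congr (_ * _).
    rewrite /divergence -sumrN; apply: eq_bigr => i _.
    have -> : (fun q => (- U q) ord0 i) = fun q => - (U q ord0 i) by apply/funext => q; rewrite mxE.
    exact: (deriveN (C1s_derivable i p (C1_coord i hU))).
  have fG : intg mu1 (fun p => divergence U p * \1_G p) := flux_intg mG hU cC U0.
  rewrite -[RHS]add0r -(I_div0 hU cC U0) /flux -(IB di fG).
  congr I; apply/funext => p; rewrite -[X in _ = X - _]mulr1 -mulrBr; congr (_ * _).
  by rewrite !indicE_asbool; case: asboolP => h1; case: asboolP => //= h2; rewrite ?subr0 ?subrr.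
move=> mF; apply/eqP; rewrite eq_le (le F mF)/=.
by have := le _ (measurableC mF); rewrite setCK.
Qed.

Section one_cut.
Variables (E1 E2 F A : set Hn) (k M : R) (S : set V).
Hypotheses (mF : measurable (F : set (LebRN R (N + 1)))) (mE1 : measurable (E1 : set (LebRN R (N + 1))))
  (mE2 : measurable (E2 : set (LebRN R (N + 1)))).
Hypotheses (mS : measurable (S : set (LebRN R N))) (Sfin : (mu S < +oo)%E) (M0 : 0 <= M).
Hypothesis F1 : forall q, A q -> pt q < k -> (F q <-> E1 q).
Hypothesis F2 : forall q, A q -> k < pt q -> (F q <-> E2 q).
Hypothesis FS : forall q, A q -> `|pt q - k| < 1 -> F q -> S (pz q).
Hypothesis AM : forall U q, Test A U -> `|pt (U q)| <= M.

Let hA (a b : R) : C1s (fun q : Hn => a * pt q + b).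
Proof.
have h := C1s_M (@C1s_cst R (N + 1) a) (@C1s_coord R (N + 1) (rshift N ord0)).
exact: (C1s_D h (@C1s_cst R (N + 1) b)).
Qed.

Let hS (a b : R) : C1s (fun q : Hn => step (a * pt q + b)).
Proof. exact: (C1s_comp (@is_derive_step R) (@continuous_dstep R) (hA a b)). Qed.

Let DA (a b : R) m q : D m (fun q : Hn => a * pt q + b) q = a * (rshift N (ord0 : 'I_1) == m)%:R.
Proof.
have hp := @C1s_coord R (N + 1) (rshift N ord0); have hc := @C1s_cst R (N + 1) a.
apply: (eq_trans (D_D m q (C1s_M hc hp) (@C1s_cst R (N + 1) b))).
rewrite derive_cst addr0; apply: (eq_trans (D_M m q hc hp)).
have [_ h] := is_derive_coord m (rshift N (ord0 : 'I_1)) q.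
by rewrite h derive_cst mulr0 addr0.
Qed.

Let DS (a b : R) m q : D m (fun q : Hn => step (a * pt q + b)) q =
  dstep (a * pt q + b) * (a * (rshift N (ord0 : 'I_1) == m)%:R).
Proof. by apply: (eq_trans (D_comp m q (@is_derive_step R) (hA a b))); congr (_ * _); exact: DA. Qed.

Let SU (a b : R) (U : Hn -> Hn) (q : Hn) : Hn := step (a * pt q + b) *: U q.

Let div_SU (a b : R) U q : C1 U -> divergence (SU a b U) q =
  step (a * pt q + b) * divergence U q + a * dstep (a * pt q + b) * pt (U q).
Proof.
move=> hU; apply: (eq_trans (div_mul q (hS a b) hU)); congr (_ + _).
rewrite sum_split big1 => [|i _]; last by rewrite DS eq_rlshift !mulr0.
by rewrite DS eqxx add0r /pt mulr1; ring.
Qed.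

Let Test_SU (a b : R) U : Test A U -> Test (A `&` [set q | 0 <= a * pt q + b]) (SU a b U).
Proof.
move=> [hU [[C [cC CA] U0] nU]]; split; first exact: (C1_mul (hS a b) hU).
split; last first.
  move=> q; have h : 0 <= step (a * pt q + b) <= 1 by rewrite step_ge0 step_le1.
  exact: (nrm2_scale eps0 h (nU q)).
have cl : closed [set q : Hn | 0 <= a * pt q + b].
  have h : continuous (fun q : Hn => a * pt q + b) := C1s_continuous (hA a b).
  exact: (@preimage_closed _ _ _ [set x : R | 0 <= x] (fun x _ => h x) (@closed_ge R 0)).
exists (C `&` [set q | 0 <= a * pt q + b]).
  by split; [exact: compact_closedI|move=> q [/CA]].
move=> q /not_andP[/U0 h|/negP]; first by rewrite /SU h scaler0.
by rewrite -ltNge => h; rewrite /SU step0 ?scale0r// ltW.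
Qed.

Let flux_eq (E E' A' : set Hn) U : Test A' U -> (forall q, A' q -> (E q <-> E' q)) -> flux E U = flux E' U.
Proof.
move=> [hU [[C [cC CA] U0] nU]] h; rewrite /flux; congr I; apply/funext => q.
have [/CA/h Cq|nC] := pselect (C q); last by rewrite (div_supp hU cC U0 nC) !mul0r.
by rewrite !indicE_asbool (asbool_equiv_eq Cq).
Qed.

Let plane0 : mu1 [set q : LebRN R (N + 1) | pt q = k] = 0%E.
Proof.
have h := @leb_prod R N (setT `*` [set k]) (measurableX measurableT (measurable_set1 k)).
have e : [set q : LebRN R (N + 1) | pt q = k] = @split_pt R N @^-1` (setT `*` [set k]).
  by apply/seteqP; split => q /=; [move=> ->|case].
rewrite e; apply: (eq_trans h); rewrite product_measure1E//.
exact: (eq_trans (congr1 (mule _) (lebesgue_measure_set1 k)) (mule0 _)).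
Qed.

(** The cutoffs rise between distance 1/J and 2/J from the plane. J >= 3 keeps this layer within
    distance 1, where the hypothesis on [S] applies; the offset 1 in [bu] and [bd] keeps the two
    fields strictly on either side of the plane. *)
Let J (j : nat) : R := j.+3%:R.
Let J3 j : 3 <= J j. Proof. by rewrite ler_nat. Qed.
Let bu j : R := - (J j * k + 1).
Let bd j : R := J j * k - 1.
Let chi j (t : R) : R := step (J j * t + bu j) + step (- J j * t + bd j).
Let dchi j (t : R) : R := J j * dstep (J j * t + bu j) + - J j * dstep (- J j * t + bd j).
Let adchi j (t : R) : R := J j * dstep (J j * t + bu j) + J j * dstep (bd j - J j * t).

Let dchiE j t : dchi j t = J j * dstep (J j * t + bu j) - J j * dstep (bd j - J j * t).
Proof. by rewrite /dchi mulNr; congr (_ - _ * dstep _); ring. Qed.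

Let adchi_intg j : intg leb (adchi j) /\ I leb (adchi j) = 2.
Proof.
have J0 : 0 < J j by have := J3 j; lra.
have [i1 e1] := I_dstep_up (bu j) J0; have [i2 e2] := I_dstep_down (bd j) J0.
split; first exact: (intgD i1 i2).
by rewrite /adchi (ID i1 i2) e1 e2.
Qed.

Let dchi_le j t : `|dchi j t| <= adchi j t.
Proof.
have J0 : 0 < J j by have := J3 j; lra.
rewrite dchiE; apply: (le_trans (ler_normB _ _)).
by rewrite /adchi !ger0_norm// mulr_ge0 ?dstep_ge0// ltW.
Qed.

Let dchi_out j t : ~ `|t - k| < 1 -> dchi j t = 0.
Proof.
have J3' := J3 j.
move=> h; rewrite /dchi /bu /bd.
have [h1|h1] : k + 1 <= t \/ t <= k - 1.
- have [h1|h1] := leP (k + 1) t; first by left.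
  right; rewrite leNgt; apply/negP => h2; apply: h; rewrite ltr_norml; lra.
- rewrite (@dstep_out _ (J j * t + _)); last by right; nra.
  by rewrite dstep_out ?mulr0 ?addr0//; left; nra.
- rewrite (@dstep_out _ (J j * t + _)); last by left; nra.
  by rewrite dstep_out ?mulr0 ?addr0//; right; nra.
Qed.

Let chi_ge0 j t : 0 <= chi j t <= 2.
Proof.
by rewrite /chi addr_ge0 ?step_ge0//= (_ : 2 = 1 + 1)// lerD ?step_le1.
Qed.

Let chi_cvg t : t <> k -> \forall j \near \oo, chi j t = 1.
Proof.
move=> tk; have d0 : 0 < `|t - k| by rewrite normr_gt0 subr_eq0; apply/eqP.
near=> j.
have hj : 2 / `|t - k| <= j%:R by near: j; exact: nbhs_infty_ger.
have hJ : 2 <= J j * `|t - k|.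
  by rewrite -ler_pdivrMr//; apply: (le_trans hj); rewrite ler_nat -addn3 leq_addr.
rewrite /chi /bu /bd; have J3' := J3 j.
have [h|h] := leP k t.
  move: hJ; rewrite ger0_norm ?subr_ge0// => hJ.
  by rewrite (@step1 _ (J j * t + _)) ?(@step0 _ (_ + (J j * k - 1))) ?addr0//; lra.
move: hJ; rewrite ltr0_norm ?subr_lt0// => hJ.
by rewrite (@step0 _ (J j * t + _)) ?(@step1 _ (_ + (J j * k - 1))) ?add0r//; lra.
Unshelve. all: by end_near. Qed.

Let pmeas_chi j : pmeas (fun q : Hn => chi j (pt q)).
Proof.
apply: pmeas_continuous.
exact: (cont_D (C1s_continuous (hS (J j) (bu j))) (C1s_continuous (hS (- J j) (bd j)))).
Qed.

(* The derivative of the cutoff has mass 2 in [t], and [F] is contained in [S] near the plane. *)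
Lemma per_cut : (per F A <= per E1 (A `&` [set q | pt q < k]%R) + per E2 (A `&` [set q | k < pt q]%R) +
  (2 * M * fine (mu S))%:E)%E.
Proof.
set P1 := per E1 _; set P2 := per E2 _.
have P10 : (0 <= P1)%E := per_ge0 eps sg pm _ _.
have P20 : (0 <= P2)%E := per_ge0 eps sg pm _ _.
apply: per_le => U TU.
have : forall W1 W2, Test (A `&` [set q | pt q < k]) W1 -> Test (A `&` [set q | k < pt q]) W2 ->
    ((flux F W1 + flux F W2)%:E <= P1 + P2)%E.
  move=> W1 W2 T1 T2; rewrite EFinD; apply: leeD.
    by rewrite (flux_eq T1 (E' := E1)); [exact: per_ub|move=> q [Aq]; exact: F1].
  by rewrite (flux_eq T2 (E' := E2)); [exact: per_ub|move=> q [Aq]; exact: F2].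
move: (adde_ge0 P10 P20); case: (P1 + P2)%E => [x _ hx|_ _|//]; last by rewrite addye// leey.
rewrite -EFinD lee_fin.
have [hU [[C [cC CA] U0] nU]] := TU.
have T1 j : Test (A `&` [set q | pt q < k]) (SU (- J j) (bd j) U).
  apply: Test_sub (Test_SU (- J j) (bd j) TU) => q [Aq /= h]; split => //=.
  by have := J3 j; rewrite /bd in h; nra.
have T2 j : Test (A `&` [set q | k < pt q]) (SU (J j) (bu j) U).
  apply: Test_sub (Test_SU (J j) (bu j) TU) => q [Aq /= h]; split => //=.
  by have := J3 j; rewrite /bu in h; nra.
have fi (A' : set Hn) W : Test A' W -> intg mu1 (fun q => divergence W q * \1_F q).
  by move=> [hW [[C' [cC' _] W0] _]]; exact: (flux_intg mF hW cC' W0).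
(* [G] carries the divergence of [U], while [B] carries the derivative of the cutoffs and is
   controlled by [M] and the measure of [S]. *)
pose B j (q : Hn) := dchi j (pt q) * pt (U q) * \1_F q.
pose G j (q : Hn) := chi j (pt q) * (divergence U q * \1_F q).
have GB j q : G j q + B j q = divergence (SU (- J j) (bd j) U) q * \1_F q + divergence (SU (J j) (bu j) U) q * \1_F q.
  by rewrite !div_SU// /G /B /chi /dchi; ring.
have Gm j : measurable_fun setT (G j : LebRN R (N + 1) -> R).
  exact: (measurable_funM (pmeas_meas (pmeas_chi j)) (intg_measurable (fi _ _ TU))).
have Gd j (q : LebRN R (N + 1)) : `|G j q| <= 2 * `|divergence U q * \1_F q|.
  have /andP[h1 h2] := chi_ge0 j (pt q).
  by rewrite normrM ler_wpM2r// ger0_norm.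
have Gi j : intg mu1 (G j) := intg_dom (Gm j) (Gd j) (intgZ 2 (intg_abs (fi _ _ TU))).
have Bi j : intg mu1 (B j).
  have -> : B j = fun q => (divergence (SU (- J j) (bd j) U) q * \1_F q + divergence (SU (J j) (bu j) U) q * \1_F q) - G j q.
    by apply/funext => q; rewrite -GB; ring.
  exact: (intgB (intgD (fi _ _ (T1 j)) (fi _ _ (T2 j))) (Gi j)).
have BS j : - (2 * M * fine (mu S)) <= I mu1 (B j).
  have [ti te] := tensor (intg_indic mS Sfin) (adchi_intg j).1.
  have dom (q : LebRN R (N + 1)) : `|B j q| <= M * (\1_S (pz q) * adchi j (pt q)).
    have a0 : 0 <= adchi j (pt q) by apply: le_trans (dchi_le j (pt q)).
    have [Cq|/U0 u0] := pselect (C q); last first.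
      by rewrite /B u0 /pt mxE mulr0 mul0r normr0 !mulr_ge0// indicE.
    have [near_|far] := pselect (`|pt q - k| < 1); last first.
      by rewrite /B dchi_out// !mul0r normr0 !mulr_ge0// indicE.
    rewrite /B (indicE_asbool F); case: asboolP => Fq; last by rewrite mulr0 normr0 !mulr_ge0// indicE.
    rewrite mulr1 indicE mem_set; last exact: FS (CA _ Cq) near_ Fq.
    by rewrite mul1r normrM mulrC; apply: ler_pM => //; exact: AM.
  have := I_norm_le (Bi j) (intgZ M ti) dom.
  rewrite (IZ _ ti) te (adchi_intg j).2 (I_indic mu mS) ler_norml => /andP[h _].
  by apply: le_trans h; rewrite le_eqVlt; apply/orP; left; apply/eqP; ring.
have Gle j : I mu1 (G j) <= x + 2 * M * fine (mu S).
  have := hx _ _ (T1 j) (T2 j); rewrite lee_fin.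
  have -> : flux F (SU (- J j) (bd j) U) + flux F (SU (J j) (bu j) U) = I mu1 (G j) + I mu1 (B j).
    rewrite /flux -(ID (fi _ _ (T1 j)) (fi _ _ (T2 j))) -(ID (Gi j) (Bi j)).
    by congr I; apply/funext => q; rewrite GB.
  by have := BS j; lra.
(* The cutoffs tend to 1 off the plane t = k, which is a null set. *)
have ae : {ae mu1, forall q : LebRN R (N + 1), G j q @[j --> \oo] --> divergence U q * \1_F q}.
  exists [set q : LebRN R (N + 1) | pt q = k]; split.
  - have -> : [set q : LebRN R (N + 1) | pt q = k] = setT `&` (@pt R N : LebRN R (N + 1) -> R) @^-1` [set k].
      by rewrite setTI.
    by apply: (@measurable_coord R (N + 1) (rshift N ord0)); [exact: measurableT|exact: measurable_set1].
  - exact: plane0.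
  - move=> q /= h; apply: contrapT => tk; apply: h.
    apply: cvg_near_cst; apply: filterS (chi_cvg tk) => j h1.
    by rewrite /G h1 mul1r.
have cv : I mu1 (G j) @[j --> \oo] --> flux F U.
  exact: (I_dct Gm (intg_measurable (fi _ _ TU)) ae (intgZ 2 (intg_abs (fi _ _ TU))) Gd).
rewrite -(cvg_lim _ cv)//.
apply: limr_le; first by apply/cvg_ex; exists (flux F U).
by apply: nearW => j; exact: Gle.
Qed.

End one_cut.
End cut.

(** * Subgraphs of BV functions *)

Section ae_tools.
Context {R : realType}.

Lemma integral_ae_eq {d} {T : measurableType d} (m : {measure set T -> \bar R}) (f g : T -> R) :
  measurable_fun setT f -> intg m g -> {ae m, forall x, f x = g x} ->
  (\int[m]_x (f x)%:E = (I m g)%:E)%E.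
Proof.
move=> mf gi fg; rewrite -(intgE gi); apply: ae_eq_integral => //.
- exact/measurable_EFinP.
- exact/measurable_EFinP/(intg_measurable gi).
- by apply: filterS fg => x /= -> _.
Qed.

Lemma ae_pz {N : nat} (P : 'rV[R]_N -> Prop) : {ae lm R N, forall z : LebRN R N, P z} ->
  {ae lm R (N + 1), forall q : LebRN R (N + 1), P (pz q)}.
Proof.
move=> [A [mA A0 hA]].
have mX : measurable (A `*` [set: R]) by exact: measurableX.
exists (@split_pt R N @^-1` (A `*` [set: R])); split.
- by rewrite -[X in measurable X]setTI; apply: (@measurable_split_pt R N) => //; exact: measurableT.
- apply: (eq_trans (leb_prod mX)); rewrite product_measure1E//.
  exact: (eq_trans (congr1 (fun x => mule x _) A0) (mul0e _)).
- by move=> q /= hq; split => //; exact: hA.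
Qed.

Lemma measurable_restr {N : nat} (Om K : set 'rV[R]_N) (f : 'rV[R]_N -> R) : open Om ->
  measurable (K : set (LebRN R N)) -> K `<=` Om ->
  measurable_fun (Om : set (LebRN R N)) (f : LebRN R N -> R) ->
  measurable_fun setT (fun z : LebRN R N => f z * \1_K z).
Proof.
move=> oO mK KO mf.
have mO := measurable_open oO.
have h : measurable_fun setT (fun z : LebRN R N => f z * \1_Om z).
  have := (@measurable_restrict _ _ (LebRN R N) _ Om setT f mO measurableT).1.
  by rewrite setTI patch_indic; apply.
have -> : (fun z : LebRN R N => f z * \1_K z) = fun z => f z * \1_Om z * \1_K z.
  apply/funext => z; rewrite -mulrA; congr (_ * _); rewrite !indicE_asbool.
  case: asboolP => Kz; last by rewrite mulr0.
  by rewrite asboolT ?mulr1//; exact: KO.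
exact: (measurable_funM h (measurable_indic mK)).
Qed.

(** The signed length of the interval between 0 and [s], computed by the sign of [s]; this is why
    [hgt (sub v)] is v. *)
Lemma I_lt_neg (s : R) : intg (@lebesgue_measure R) (fun t => \1_[set t | t < s] t - neg t) /\
  (I (@lebesgue_measure R) (fun t => \1_[set t | t < s] t - neg t) = s /\
   I (@lebesgue_measure R) (fun t => `|\1_[set t | t < s] t - neg t|) = `|s|).
Proof.
have L t : \1_[set t | t < s] t = (if t < s then 1 else 0) :> R by rewrite indicE_asbool /= asboolb.
have Q (a b t : R) : \1_(`[a, b[%classic) t = (if ~~ (t < a) && (t < b) then 1 else 0) :> R.
  by rewrite indicE_asbool /= in_itv/= asboolb leNgt.
have itv (a b : R) : a <= b -> intg (@lebesgue_measure R) \1_(`[a, b[%classic) /\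
    I (@lebesgue_measure R) \1_(`[a, b[%classic) = b - a.
  move=> ab; have mI : measurable (`[a, b[%classic : set R) by exact: measurable_itv.
  have E := @lebesgue_measure_itv R `[a, b[.
  have E' : (@lebesgue_measure R) `[a, b[%classic = (b - a)%:E.
    apply: (eq_trans E); rewrite /= lte_fin; case: ltP => // ba.
    by congr (_%:E); apply/eqP; rewrite eq_sym subr_eq0 eq_le ab ba.
  split; last exact: (eq_trans (@I_indic _ _ _ (@lebesgue_measure R) _ mI) (congr1 fine E')).
  by apply: (@intg_indic _ _ _ (@lebesgue_measure R) _ mI); apply: (eq_ind_r (fun x : \bar R => x < +oo)%E _ E'); rewrite ltry.
have [s0|s0] := leP 0 s.
  have [i e] := itv _ _ s0; rewrite subr0 in e.
  have E : (fun t : R => \1_[set t | t < s] t - neg t) = \1_(`[0, s[%classic).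
    apply/funext => t; rewrite negE L Q.
    by case: (ltP t 0) => h1; case: (ltP t s) => h2 /=; rewrite ?subrr ?subr0//; lra.
  have E2 : (fun t : R => `|\1_[set t | t < s] t - neg t|) = \1_(`[0, s[%classic).
    by apply/funext => t; rewrite -[RHS](congr1 (@^~ t) E) ger0_norm// (congr1 (@^~ t) E) indicE.
  by rewrite E2 E ger0_norm.
have [i e] := itv _ _ (ltW s0); rewrite sub0r in e.
have E : (fun t : R => \1_[set t | t < s] t - neg t) = fun t => - \1_(`[s, 0[%classic) t.
  apply/funext => t; rewrite negE L Q.
  by case: (ltP t 0) => h1; case: (ltP t s) => h2 /=; rewrite ?subrr ?sub0r ?subr0 ?oppr0//; lra.
have E2 : (fun t : R => `|\1_[set t | t < s] t - neg t|) = \1_(`[s, 0[%classic).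
  apply/funext => t; have -> : \1_[set t | t < s] t - neg t = - \1_(`[s, 0[%classic) t.
    exact: (congr1 (@^~ t) E).
  by rewrite normrN ger0_norm// indicE.
by rewrite E2 E (IN i) e opprK ltr0_norm//; split => //; exact: intgN.
Qed.

End ae_tools.

Section subgraphs.
Context {R : realType} {N : nat}.
Variable Omega : set 'rV[R]_N.
Hypothesis oO : open Omega.
Local Notation mu := (lm R N).
Local Notation mu1 := (lm R (N + 1)).
Local Notation Hn := 'rV[R]_(N + 1).
Local Notation V := 'rV[R]_N.
Local Notation leb := (@lebesgue_measure R).
Implicit Types (v H g : V -> R) (K W : set V) (F : set Hn).

Definition sub v : set Hn := [set q | Omega (pz q) /\ pt q < v (pz q)].

Lemma L1loc_intg v K : L1loc Omega v -> compact K -> K `<=` Omega ->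
  intg mu (fun z => v z * \1_K z).
Proof.
move=> [mv hv] cK KO; have mK := leb_compact_measurable cK.
apply: (intgP (measurable_restr oO mK KO mv)).
have := hv K cK KO; rewrite (@integral_on _ _ (LebRN R N) (lebRN R N) K (fun z => `|v z|)).
congr (_ < _)%E; apply: eq_integral => z _.
by rewrite normrM [`|\1_K z|]ger0_norm// indicE.
Qed.

Lemma pmeas_sub v : measurable_fun (Omega : set (LebRN R N)) (v : LebRN R N -> R) ->
  pmeas (\1_(sub v) : Hn -> R).
Proof.
move=> mv; have mO := measurable_open oO.
have m1 : measurable_fun setT (fun z : LebRN R N => v z * \1_Omega z).
  exact: (measurable_restr oO mO (@subset_refl _ Omega) mv).
pose S : set (LebRN R N * R) := (Omega `*` [set: R]) `&`
  (fun x => v x.1 * \1_Omega x.1 - x.2) @^-1` `]0, +oo[%classic.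
have mS : measurable S.
  apply: measurableI.
    exact: (measurableX mO measurableT).
  rewrite -[X in measurable X]setTI.
  have h : measurable_fun setT (fun x : LebRN R N * R => v x.1 * \1_Omega x.1 - x.2).
    exact: (measurable_funB (measurableT_comp m1 measurable_fst) measurable_snd).
  by apply: h => //; exact: measurable_itv.
have E : (fun x : LebRN R N * R => \1_(sub v) (mk x.1 x.2) : R) = \1_S.
  apply/funext => x; rewrite !indicE_asbool; congr (if _ then _ else _); apply: asbool_equiv_eq.
  rewrite /sub /S /= pz_mk pt_mk in_itv/= andbT subr_gt0.
  have i1 : Omega x.1 -> \1_Omega x.1 = 1 :> R by move=> h; rewrite indicE mem_set.
  by split => [[Ox]|[[Ox _]]]; rewrite i1// mulr1.
by rewrite /pmeas E; exact: measurable_indic.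
Qed.

Lemma sub_sec v z : Omega z -> (fun t => \1_(sub v) (mk z t) - neg t) = (fun t : R => \1_[set t | t < v z] t - neg t).
Proof.
move=> Oz; apply/funext => t; congr (_ - _); rewrite !indicE_asbool; congr (if _ then _ else _).
by apply: asbool_equiv_eq; rewrite /sub /= pz_mk pt_mk; split => [[]|].
Qed.

Lemma hgt_sub v z : Omega z -> hgt (sub v) z = v z.
Proof. by move=> Oz; rewrite /hgt sub_sec//; have [_ []] := I_lt_neg (v z). Qed.

Lemma loc_sub v : L1loc Omega v -> loc_subgraph Omega (sub v).
Proof.
move=> Lv K cK KO; split; last by move=> z /KO Oz; rewrite sub_sec//; have [] := I_lt_neg (v z).
have mS := pmeas_sub Lv.1.
have pm : pmeas (fun q : Hn => \1_K (pz q) * (\1_(sub v) q - neg (pt q))).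
  exact: (pmeasM (pmeas_pz (measurable_indic_compact cK)) (pmeasB mS (pmeas_pt measurable_neg))).
have hb (z : LebRN R N) : (\int[leb]_t `|\1_K (pz (mk z t)) * (\1_(sub v) (mk z t) - neg (pt (mk z t)))|%:E <=
    (`|v z * \1_K z|)%:E)%E.
  have -> : (fun t : R => `|\1_K (pz (mk z t)) * (\1_(sub v) (mk z t) - neg (pt (mk z t)))|%:E) =
     fun t : R => (\1_K z * `|\1_(sub v) (mk z t) - neg t|)%:E.
    by apply/funext => t; rewrite pz_mk pt_mk normrM ger0_norm// indicE.
  rewrite !indicE_asbool; case: asboolP => Kz; last first.
    rewrite mulr0 normr0 (_ : (fun t : R => _) = fun=> 0%E); first by rewrite integral0.
    by apply/funext => t; rewrite mul0r.
  rewrite mulr1; have [h1 [_ h3]] := I_lt_neg (v z).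
  have E : (fun t : R => (1 * `|\1_(sub v) (mk z t) - neg t|)%:E) =
      fun t : R => (`|\1_[set t | t < v z] t - neg t|)%:E.
    by apply/funext => t; rewrite mul1r (congr1 (@^~ t) (sub_sec v (KO _ Kz))).
  by rewrite E -h3 (intgE (intg_abs h1)).
have gi := @intg_prod R _ _ _ _ mu leb _ _ pm hb (intg_abs (L1loc_intg Lv cK KO)).
exact: ((intg_split pm).2 gi).
Qed.

(** Weighted by a function of z, the volume of F relative to {t < 0} depends only on the heights;
    hence F and the subgraph of [hgt F] have matching curvature terms. *)
Lemma hgt_vol F K (g : LebRN R N -> R) (M : R) : pmeas (\1_F : Hn -> R) -> loc_subgraph Omega F ->
  compact K -> K `<=` Omega -> measurable_fun setT g -> (forall z, `|g z| <= M) ->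
  intg mu1 (fun q : LebRN R (N + 1) => g (pz q) * (\1_K (pz q) * (\1_F q - neg (pt q)))) /\
  I mu1 (fun q : LebRN R (N + 1) => g (pz q) * (\1_K (pz q) * (\1_F q - neg (pt q)))) =
  I mu (fun z => g z * (hgt F z * \1_K z)).
Proof.
move=> mF lF cK KO mg gM; have [Floc Fsec] := lF K cK KO.
have pm1 : pmeas (fun q : Hn => \1_K (pz q) * (\1_F q - neg (pt q))).
  exact: (pmeasM (pmeas_pz (measurable_indic_compact cK)) (pmeasB mF (pmeas_pt measurable_neg))).
have pm := pmeasM (pmeas_pz mg) pm1.
have gi : intg mu1 (fun q : LebRN R (N + 1) => g (pz q) * (\1_K (pz q) * (\1_F q - neg (pt q)))).
  apply: (intg_dom (pmeas_meas pm) _ (intgZ M (intg_abs Floc))) => q.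
  by rewrite normrM ler_wpM2r.
split; first exact: gi.
apply: (eq_trans (I_split1 pm gi)); congr I; apply/funext => z.
under [X in I _ X]eq_fun do rewrite pz_mk pt_mk.
rewrite indicE_asbool; case: asboolP => Kz; last first.
  by rewrite !mulr0; under [X in I _ X]eq_fun do rewrite mul0r mulr0; rewrite I0.
under [X in I _ X]eq_fun do rewrite mul1r.
by rewrite (IZ _ (Fsec z Kz)) mulr1.
Qed.

(** [H] is measurable only on [Omega] and bounded only almost everywhere on [K]; truncation gives a
    bounded function, measurable on the whole space, that equals [H] almost everywhere on [K]. *)
Lemma Linfloc_clamp H K : Linfloc Omega H -> compact K -> K `<=` Omega ->
  exists (h : LebRN R N -> R) (M : R), [/\ 0 <= M, measurable_fun setT h, forall z, `|h z| <= M &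
    {ae mu, forall z : LebRN R N, K z -> h z = H z}].
Proof.
move=> [mH hH] cK KO; have [M0 hM0] := hH K cK KO.
pose M := Num.max M0 0; have M00 : 0 <= M by rewrite le_max lexx orbT.
have mK := leb_compact_measurable cK.
pose h (z : LebRN R N) : R := Num.max (- M) (Num.min M (H z * \1_K z)).
have mh : measurable_fun setT h.
  exact: (measurable_maxr (measurable_cst (- M)) (measurable_minr (measurable_cst M) (measurable_restr oO mK KO mH))).
have hM z : `|h z| <= M.
  rewrite /h ler_norml; apply/andP; split; first by rewrite le_max lexx.
  by rewrite ge_max ge_min lexx/= andbT; lra.
have hE : {ae mu, forall z : LebRN R N, K z -> h z = H z}.
  have hM1 : {ae mu, forall z : LebRN R N, K z -> `|H z| <= M0} by exact: hM0.
  apply: filterS hM1 => z hz Kz; have {hz} := hz Kz.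
  rewrite /h indicE mem_set// mulr1 => hz.
  have : `|H z| <= M by apply: (le_trans hz); rewrite le_max lexx.
  by rewrite ler_norml => /andP[h1 h2]; rewrite min_r// max_r.
by exists h, M; split; [exact: M00|exact: mh|exact: hM|exact: hE].
Qed.

(** Turns the extended-real curvature term into a real integral with bounded weight, which can be
    moved across an inequality. *)
Lemma integral_Hv H v W K (h : LebRN R N -> R) (M : R) : Linfloc Omega H -> L1loc Omega v ->
  compact K -> K `<=` Omega -> measurable (W : set (LebRN R N)) -> W `<=` K ->
  measurable_fun setT h -> (forall z, `|h z| <= M) -> {ae mu, forall z : LebRN R N, K z -> h z = H z} ->
  intg mu (fun z => h z * (v z * \1_W z)) /\
  (\int[lebRN R N]_(z in W) (H z * v z)%:E = (I mu (fun z => h z * (v z * \1_W z)))%:E)%E.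
Proof.
move=> [mH _] Lv cK KO mW WK mh hM hH; have WO := subset_trans WK KO.
have m1 := measurable_restr oO mW WO mH.
have m2 := measurable_restr oO mW WO Lv.1.
have gi : intg mu (fun z => h z * (v z * \1_W z)).
  apply: (intg_dom (measurable_funM mh m2) _ (intgZ M (intg_abs (L1loc_intg Lv cK KO)))) => z.
  rewrite normrM; apply: ler_pM => //; rewrite !normrM ler_wpM2l// !indicE_asbool.
  case: asboolP => Wz; last by rewrite normr0.
  by rewrite asboolT//; exact: WK.
split; first exact: gi.
rewrite (@integral_on _ _ (LebRN R N) (lebRN R N) W (fun z => H z * v z)).
have E : (fun z => H z * v z * \1_W z) = fun z => (H z * \1_W z) * (v z * \1_W z).
  apply/funext => z; rewrite !indicE_asbool; case: asboolP => _; rewrite ?mulr1 ?mulr0//.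
have mf : measurable_fun setT (fun z : LebRN R N => H z * v z * \1_W z).
  by rewrite E; exact: (measurable_funM m1 m2).
apply: (@integral_ae_eq _ _ (LebRN R N) mu _ _ mf gi).
apply: filterS hH => z hz; rewrite indicE_asbool; case: asboolP => Wz; last by rewrite !mulr0.
by rewrite !mulr1 hz//; exact: WK.
Qed.

Lemma integral_H H S K (h : LebRN R N -> R) (M : R) : Linfloc Omega H ->
  compact K -> K `<=` Omega -> measurable (S : set (LebRN R (N + 1))) -> (mu1 S < +oo)%E ->
  (forall q, S q -> K (pz q)) ->
  measurable_fun setT h -> (forall z, `|h z| <= M) -> {ae mu, forall z : LebRN R N, K z -> h z = H z} ->
  intg mu1 (fun q : LebRN R (N + 1) => h (pz q) * \1_S q) /\
  (\int[lebRN R (N + 1)]_(q in S) (H (pz q))%:E = (I mu1 (fun q : LebRN R (N + 1) => h (pz q) * \1_S q))%:E)%E.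
Proof.
move=> [mH _] cK KO mS Sfin SK mh hM hH.
have mK := leb_compact_measurable cK.
have m1 := pmeas_meas (pmeas_pz (measurable_restr oO mK KO mH)).
have m2 := pmeas_meas (pmeas_pz mh).
have gi : intg mu1 (fun q : LebRN R (N + 1) => h (pz q) * \1_S q).
  apply: (intg_bnd mS Sfin (measurable_funM m2 (measurable_indic mS))) => q.
  by rewrite normrM [`|\1_S q|]ger0_norm ?indicE// ler_wpM2r.
split; first exact: gi.
rewrite (@integral_on _ _ (LebRN R (N + 1)) (lebRN R (N + 1)) S (fun q => H (pz q))).
have E : (fun q : Hn => H (pz q) * \1_S q) = fun q => (H (pz q) * \1_K (pz q)) * \1_S q.
  apply/funext => q; rewrite -mulrA; congr (_ * _); rewrite !indicE_asbool.
  by case: asboolP => Sq; rewrite ?mulr0// asboolT ?mulr1//; exact: SK.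
have mf : measurable_fun setT (fun q : LebRN R (N + 1) => H (pz q) * \1_S q).
  by rewrite E; exact: (measurable_funM m1 (measurable_indic mS)).
apply: (@integral_ae_eq _ _ (LebRN R (N + 1)) mu1 _ _ mf gi).
apply: filterS (ae_pz hH) => q hq; rewrite indicE_asbool; case: asboolP => Sq; last by rewrite !mulr0.
by rewrite !mulr1 hq//; exact: SK.
Qed.

End subgraphs.

(** * Finiteness of perimeter and of total variation *)

Section finiteness.
Context {R : realType} {N : nat}.
Variables (eps : R) (sg : 'I_N -> R) (pm : 'I_N -> 'I_N).
Hypothesis eps0 : eps != 0.
Variable Omega : set 'rV[R]_N.
Hypothesis oO : open Omega.
Local Notation mu := (lm R N).
Local Notation mu1 := (lm R (N + 1)).
Local Notation Hn := 'rV[R]_(N + 1).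
Local Notation V := 'rV[R]_N.
Local Notation per := (per eps sg pm).
Local Notation Testz := (Testz eps sg pm).
Local Notation nrm2 := (nrm2 eps sg pm).
Local Notation xi := (xi sg pm).
Implicit Types (v w : V -> R) (K W : set V) (F : set Hn).

Lemma norm_le1 (x : R) : x ^+ 2 <= 1 -> `|x| <= 1.
Proof. by rewrite -real_normK ?num_real// => h; rewrite -(@expr_le1 _ 2)//. Qed.

(** The vertical component is eps gam + sum a_i xi_i, and every frame coefficient is at most 1 in
    absolute value. *)
Lemma pt_le z (a : Hn) : nrm2 z a <= 1 -> `|pt a| <= `|eps| + \sum_i `|xi i z|.
Proof.
move=> na.
have s0 : 0 <= \sum_i pz a ord0 i ^+ 2 by apply: sumr_ge0 => i _; exact: sqr_ge0.
have g1 : `|gam eps sg pm z a| <= 1.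
  by apply: norm_le1; apply: le_trans na; rewrite /nrm2 lerDr.
have p1 i : `|pz a ord0 i| <= 1.
  apply: norm_le1; apply: le_trans na; rewrite /nrm2 (bigD1 i)//= -addrA lerDl addr_ge0 ?sqr_ge0//.
  by apply: sumr_ge0 => j _; exact: sqr_ge0.
have -> : pt a = eps * gam eps sg pm z a + \sum_i pz a ord0 i * xi i z.
  by rewrite /gam mulrC divfK// subrK.
apply: (le_trans (ler_normD _ _)); apply: lerD.
  by rewrite normrM ler_piMr.
apply: (le_trans (ler_norm_sum _ _ _)); apply: ler_sum => i _.
by rewrite normrM ler_piMl.
Qed.

Lemma xi_bound K : compact K -> exists2 M : R, 0 <= M & forall z, K z ->
  `|eps| + \sum_i `|xi i z| <= M.
Proof.
move=> cK.
have cx : continuous (fun z : V => `|eps| + \sum_i `|xi i z|).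
  by apply: cont_D; [exact: cont_cst|apply: cont_sum => i; apply: cont_abs; exact: cont_xi].
have [M M0 hM] := compact_bound cK cx.
by exists M => // z /hM; apply: le_trans; exact: ler_norm.
Qed.

Lemma I_bound_on K (f : V -> R) (M : R) : compact K -> intg mu f -> 0 <= M ->
  (forall z, `|f z| <= M * \1_K z) -> `|I mu f| <= M * fine (mu K).
Proof.
move=> cK fi M0 hf; have mK := leb_compact_measurable cK.
have iK := intg_indic mK (leb_compact_fin cK).
rewrite -(I_indic mu mK) -(IZ M iK).
exact: (I_norm_le fi (intgZ M iK) hf).
Qed.

Lemma intg_mul_cont w (f : V -> R) K : compact K -> intg mu (fun z => w z * \1_K z) -> continuous f ->
  (forall z, ~ K z -> f z = 0) -> intg mu (fun z => w z * f z).
Proof.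
move=> cK wi cf f0; have [B B0 hB] := supp_bound cK cf f0.
have E : (fun z => w z * f z) = fun z => w z * \1_K z * f z.
  apply/funext => z; rewrite -mulrA; congr (_ * _); rewrite indicE_asbool.
  by case: asboolP => [_|/f0 ->]; rewrite ?mul1r// mulr0.
have m : measurable_fun setT (fun z : LebRN R N => w z * f z).
  by rewrite E; exact: (measurable_funM (intg_measurable wi) (measurable_continuous cf)).
apply: (intg_dom m _ (intgZ B (intg_abs wi))) => z.
rewrite (congr1 (@^~ z) E) normrM mulrC ler_wpM2r//.
by apply: (le_trans (hB z)); rewrite indicE_asbool; case: asboolP; rewrite ?mulr1 ?mulr0.
Qed.

(** The horizontal part of an admissible field is admissible for the total variation, and the
    vertical part contributes at most M times the measure of the closure of W. *)
Lemma fin_per v W : BVloc Omega v -> open W -> compactly_contained W Omega ->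
  (per (sub Omega v) [set q | W (pz q)] < +oo)%E.
Proof.
move=> [Lv TV] oW [cK KO]; have := TV W oW (conj cK KO).
have WO : W `<=` Omega := subset_trans (@subset_closure _ W) KO.
have mS := pmeas_set (pmeas_sub oO Lv.1).
have [M M0 hM] := xi_bound cK.
case ET : (Defs.total_variation v W) => [T| |] // _; last first.
  apply: (@le_lt_trans _ _ 0%:E); last exact: ltry.
  (* The zero field excludes the value -oo. *)
  exfalso; have : (0%:E <= Defs.total_variation v W)%E.
    apply: ereal_sup_ubound; exists (fun=> 0).
      split; first by move=> j; under eq_fun do rewrite mxE; exact: C1s_cst.
      split; first by exists set0 => //; split; [exact: compact0|].
      by move=> z; rewrite /euclid_norm big1 ?sqrtr0// => i _; rewrite mxE expr0n.
    rewrite (@integral_on _ _ (LebRN R N) (lebRN R N) W (fun z => v z * divergence (fun=> 0) z)).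
    rewrite (_ : (fun z => _) = fun=> 0%E); first by rewrite integral0.
    apply/funext => z; rewrite /divergence big1 ?mulr0 ?mul0r// => i _.
    by under eq_fun do rewrite mxE; rewrite derive_cst.
  by rewrite ET.
apply: (@le_lt_trans _ _ (T + M * fine (mu (closure W)))%:E); last exact: ltry.
apply: (per_le_zflux eps0 oW _ _ mS).
- by move=> K cK' KW; exact: (L1loc_intg oO Lv cK' (subset_trans KW WO)).
- by move=> q Wq; split=> [[]|h] //; split => //; exact: WO.
move=> phi [hphi [K [cK' KW] phi0] nphi].
have vK := L1loc_intg oO Lv cK' (subset_trans KW WO).
have i1 : intg mu (fun z => v z * divz phi z).
  exact: (intg_mul_cont cK' vK (cont_divz hphi) (divz_out cK' phi0)).
have i2 := intg_ptphi hphi cK' phi0.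
rewrite /zflux (ID i1 i2); apply: lerD; last first.
  apply: (le_trans (ler_norm _)); apply: (I_bound_on cK i2 M0) => z.
  rewrite indicE_asbool; case: asboolP => cz.
    by rewrite mulr1; apply: (le_trans (pt_le (nphi z))); exact: hM.
  rewrite phi0; first by rewrite /pt mxE normr0 mulr0.
  by move=> /KW /(@subset_closure _ W).
rewrite -lee_fin -ET; apply: ereal_sup_ubound; exists (fun z => pz (phi z)).
  have E i : (fun q => pz (phi q) ord0 i) = fun q => phi q ord0 (lshift 1 i).
    by apply/funext => q; rewrite pzE.
  split; first by move=> i; rewrite E; exact: hphi.
  split; first by exists K => // z /phi0 ->; apply/rowP => i; rewrite pzE !mxE.
  move=> z; rewrite /euclid_norm -[leRHS]sqrtr1 ler_sqrt//.
  by apply: le_trans (nphi z); rewrite /nrm2 lerDl sqr_ge0.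
have dE z : divergence (fun z => pz (phi z)) z = divz phi z.
  apply: eq_bigr => i _.
  by have -> : (fun q => pz (phi q) ord0 i) = fun q => phi q ord0 (lshift 1 i) by apply/funext => q; rewrite pzE.
rewrite (@integral_on _ _ (LebRN R N) (lebRN R N) W (fun z => v z * divergence (fun z => pz (phi z)) z)).
rewrite -(intgE i1); apply: eq_integral => z _; congr (_%:E).
rewrite dE indicE_asbool; case: asboolP => Wz; first by rewrite mulr1.
by rewrite (divz_out cK' phi0) ?mulr0// => /KW.
Qed.

(** A field psi on R^N is lifted with vertical component sum psi_i xi_i, so that [gam] vanishes and
    the norm is the Euclidean one; the lift is then admissible. *)
Lemma tv_fin w A (x : R) : compactly_contained A Omega ->
  (forall K, compact K -> K `<=` A -> intg mu (fun z => w z * \1_K z)) ->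
  (forall phi, Testz A phi -> zflux w phi <= x) -> (Defs.total_variation w A < +oo)%E.
Proof.
move=> [cA AO] wloc hx; have [M M0 hM] := xi_bound cA.
apply: (@le_lt_trans _ _ (x + M * fine (mu (closure A)))%:E); last exact: ltry.
apply: ge_ereal_sup => _ [psi [hpsi [[K [cK KA] psi0] npsi]] <-].
pose s z := \sum_i psi z ord0 i * xi i z.
pose phi (z : V) : Hn := mk (psi z) (s z).
have phi_l i : (fun z => phi z ord0 (lshift 1 i)) = fun z => psi z ord0 i.
  by apply/funext => z; rewrite /phi mkl.
have phi_r i : (fun z => phi z ord0 (rshift N i)) = s by apply/funext => z; rewrite /phi mkr.
have hphi j : C1s (fun z => phi z ord0 j).
  case: (split_ordP j) => i ->; first by rewrite phi_l; exact: hpsi.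
  rewrite phi_r.
  exact: (C1s_sum (index_enum 'I_N) (fun i => C1s_M (C1_coord i hpsi) (@C1s_xi _ _ sg pm i))).
have phi0 z : ~ K z -> phi z = 0.
  move=> nK; apply/rowP => j; rewrite [RHS]mxE; case: (split_ordP j) => i ->.
    by rewrite /phi mkl psi0// mxE.
  by rewrite /phi mkr /s big1// => k _; rewrite psi0// mxE mul0r.
have npsi2 z : \sum_i psi z ord0 i ^+ 2 <= 1.
  by have := npsi z; rewrite /euclid_norm -[leRHS]sqrtr1 ler_sqrt.
have nphi z : nrm2 z (phi z) <= 1.
  rewrite /nrm2 (_ : gam _ _ _ _ _ = 0); first by rewrite expr0n addr0 /phi pz_mk.
  by rewrite /gam /phi pt_mk pz_mk subrr mul0r.
have T : Testz A phi by split => //; exists K.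
have i1 : intg mu (fun z => w z * divz phi z).
  exact: (intg_mul_cont cK (wloc K cK KA) (cont_divz hphi) (divz_out cK phi0)).
have i2 := intg_ptphi hphi cK phi0.
have h := hx _ T; rewrite /zflux (ID i1 i2) in h.
have hb z : `|pt (phi z)| <= M * \1_(closure A) z.
  rewrite indicE_asbool; case: asboolP => cz.
    by rewrite mulr1; apply: (le_trans (pt_le (nphi z))); exact: hM.
  rewrite phi0; first by rewrite /pt mxE normr0 mulr0.
  by move=> /KA /(@subset_closure _ A).
have := I_bound_on cA i2 M0 hb.
rewrite ler_norml => /andP[h2 _].
have dE z : divergence psi z = divz phi z by apply: eq_bigr => i _; rewrite phi_l.
rewrite (@integral_on _ _ (LebRN R N) (lebRN R N) A (fun z => w z * divergence psi z)).
have -> : (\int[lebRN R N]_z (w z * divergence psi z * \1_A z)%:E = (I mu (fun z => w z * divz phi z))%:E)%E.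
  rewrite -(intgE i1); apply: eq_integral => z _; congr (_%:E).
  rewrite dE indicE_asbool; case: asboolP => Wz; first by rewrite mulr1.
  by rewrite (divz_out cK phi0) ?mulr0// => /KA.
rewrite lee_fin; lra.
Qed.

End finiteness.

(** * From minimizing sets to minimizing graphs *)

Section b_to_a.
Context {R : realType} {N : nat}.
Variables (eps : R) (sg : 'I_N -> R) (pm : 'I_N -> 'I_N).
Hypothesis eps0 : eps != 0.
Variable Omega : set 'rV[R]_N.
Hypothesis oO : open Omega.
Local Notation mu := (lm R N).
Local Notation mu1 := (lm R (N + 1)).
Local Notation Hn := 'rV[R]_(N + 1).
Local Notation V := 'rV[R]_N.
Local Notation per := (per eps sg pm).
Local Notation Test := (Test eps sg pm).
Local Notation sub := (sub Omega).
Local Notation cyl W := [set q : Hn | W (pz q)].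
Implicit Types (u v : V -> R) (K W : set V) (A F E : set Hn).

Lemma cc_intro {M : nat} (A B C : set 'rV[R]_M) : compact C -> A `<=` C -> C `<=` B -> compactly_contained A B.
Proof.
move=> cC AC CB; have cl := rV_compact_closed cC.
have h : closure A `<=` C by move=> p /(closureS AC); exact: cl.
split; last exact: subset_trans CB.
exact: (subclosed_compact (@closed_closure _ A) cC h).
Qed.

Lemma leb_fin_sub {M : nat} (A C : set 'rV[R]_M) : compact C -> A `<=` C -> (lm R M A < +oo)%E.
Proof. by move=> cC AC; apply: le_lt_trans (leb_compact_fin cC); exact: le_outer_measure. Qed.

Lemma open_pz W : open W -> open (cyl W).
Proof.
move=> oW; rewrite openE => q /= Wq; apply/rV_nbhs.
have /rV_nbhs[r r0 hr] : nbhs (pz q) W by apply: open_nbhs_nbhs.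
by exists r => // p hp; apply: hr => j; rewrite !pzE.
Qed.

Lemma open_pt (k : R) : open [set q : Hn | `|pt q| < k].
Proof.
have h : continuous (fun q : Hn => `|pt q|) by apply: cont_abs; exact: cont_pt.
by apply: (@open_comp _ _ (fun q : Hn => `|pt q|) [set x : R | x < k]); [move=> x _; exact: h|exact: open_lt].
Qed.

Lemma per_fin E A (x : \bar R) : (per E A <= x)%E -> (x < +oo)%E -> exists r : R, per E A = r%:E.
Proof.
move=> h hx; have := per_ge0 eps sg pm E A; have := le_lt_trans h hx.
by case: (per E A) => [r _ _| |] //; exists r.
Qed.

Lemma indicT (T : Type) (X : set T) x : X x -> \1_X x = 1 :> R.
Proof. by move=> h; rewrite indicE mem_set. Qed.

Lemma indicF (T : Type) (X : set T) x : ~ X x -> \1_X x = 0 :> R.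
Proof. by move=> h; rewrite indicE memNset. Qed.

Variables (H u v : V -> R) (W : set V).
Hypotheses (hH : Linfloc Omega H) (hu : BVloc Omega u) (hv : BVloc Omega v).
Hypotheses (oW : open W) (cW : compactly_contained W Omega).
Hypothesis uv : compactly_contained [set z | Omega z /\ u z <> v z] W.
Hypothesis hb : forall A F, open A -> compactly_contained A (cyl Omega) ->
  measurable (F : set (LebRN R (N + 1))) ->
  compactly_contained ((sub u `\` F) `|` (F `\` sub u)) A ->
  (per (sub u) A + \int[lebRN R (N + 1)]_(p in sub u `&` A) (H (pz p))%:E <=
   per F A + \int[lebRN R (N + 1)]_(p in F `&` A) (H (pz p))%:E)%E.

Let K : set V := closure W.
Let cK : compact K. Proof. exact: cW.1. Qed.
Let KO : K `<=` Omega. Proof. exact: cW.2. Qed.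
Let WK : W `<=` K. Proof. exact: subset_closure. Qed.
Let WO : W `<=` Omega. Proof. exact: (subset_trans WK KO). Qed.
Let mW : measurable (W : set (LebRN R N)). Proof. exact: measurable_open oW. Qed.
Let mu_ : measurable (sub u : set (LebRN R (N + 1))). Proof. exact: pmeas_set (pmeas_sub oO hu.1.1). Qed.
Let mv_ : measurable (sub v : set (LebRN R (N + 1))). Proof. exact: pmeas_set (pmeas_sub oO hv.1.1). Qed.

Let measurable_high (k : R) : measurable (W `&` [set z | k - 1 < `|u z * \1_W z| + `|v z * \1_W z|] : set (LebRN R N)).
Proof.
apply: measurableI; first exact: mW.
have m w : L1loc Omega w -> measurable_fun setT (fun z : LebRN R N => `|w z * \1_W z|).
  by move=> Lw; exact: (measurable_abs (measurable_restr oO mW WO Lw.1)).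
have h := measurable_funD (m _ hu.1) (m _ hv.1).
rewrite (_ : [set z | _] = setT `&` (fun z : LebRN R N => `|u z * \1_W z| + `|v z * \1_W z|) @^-1` `]k - 1, +oo[%classic).
  by apply: h; [exact: measurableT|exact: measurable_itv].
by rewrite setTI; apply/seteqP; split => z /=; rewrite in_itv/= andbT.
Qed.

Section slab.
Variable k : R.

(** [A] reaches one unit beyond the planes t = k and t = -k, the range in which [per_cut] places its
    cutoffs. *)
Let A : set Hn := [set q | W (pz q) /\ `|pt q| < k + 1].
Let B : set Hn := [set q | `|pt q| < k].
Let F : set Hn := (B `&` sub v) `|` (~` B `&` sub u).
(** The cut layers have half-width 1: within them F (or, for the lower plane, its complement) has
    points only over places where |u| + |v| exceeds k - 1. *)
Let S : set V := W `&` [set z | k - 1 < `|u z * \1_W z| + `|v z * \1_W z|].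

Let oA : open A.
Proof. exact: (openI (open_pz oW) (@open_pt (k + 1))). Qed.

Let AC : A `<=` [set q | K (pz q) /\ - (k + 1) <= pt q <= k + 1].
Proof. by move=> q [/WK Kq]; rewrite ltr_norml => /andP[h1 h2]; split => //; rewrite !ltW. Qed.

Let cAC : compact [set q : Hn | K (pz q) /\ - (k + 1) <= pt q <= k + 1].
Proof. exact: compact_slab. Qed.

Let mA : measurable (A : set (LebRN R (N + 1))). Proof. exact: measurable_open oA. Qed.
Let mB : measurable (B : set (LebRN R (N + 1))). Proof. exact: (measurable_open (@open_pt k)). Qed.

Let mF : measurable (F : set (LebRN R (N + 1))).
Proof.
exact: (measurableU _ _ (measurableI _ _ mB mv_) (measurableI _ _ (measurableC mB) mu_)).
Qed.

Let FB q : B q -> (F q <-> sub v q).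
Proof. by move=> Bq; split=> [[[]|[]]|h]//; left. Qed.

Let FnB q : ~ B q -> (F q <-> sub u q).
Proof. by move=> Bq; split=> [[[]|[]]|h]//; right. Qed.

Let diff : compactly_contained ((sub u `\` F) `|` (F `\` sub u)) A.
Proof.
have [cD DW] := uv.
set D := closure _ in cD DW.
apply: (cc_intro (@compact_slab R N D k cD)) => q; last first.
  move=> [/DW Wq /andP[h1 h2]]; split => //; rewrite ltr_norml; lra.
have hB : B q -> - k <= pt q <= k by rewrite /B /= ltr_norml => /andP[h1 h2]; rewrite !ltW.
case=> [[[Oq uq] nF]|[Fq nu]].
  have [Bq|nB] := pselect (B q); last by exfalso; apply: nF; apply/(FnB nB).
  split; last exact: hB.
  apply: subset_closure; split => // e; apply: nF; apply/(FB Bq); split => //; by rewrite -e.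
have [Bq|nB] := pselect (B q); last by exfalso; apply: nu; apply/(FnB nB).
split; last exact: hB.
have [Oq vq] := (FB Bq).1 Fq.
by apply: subset_closure; split => // e; apply: nu; split => //; rewrite e.
Qed.

Let mS : measurable (S : set (LebRN R N)). Proof. exact: measurable_high. Qed.

Let Sfin : (mu S < +oo)%E.
Proof. by apply: (leb_fin_sub cK) => z [/WK]. Qed.

Let SW z (t : R) : W z -> k - 1 < t -> t <= `|u z| + `|v z| -> S z.
Proof.
by move=> Wz h1 h2; split => //=; rewrite indicE mem_set// !mulr1; exact: lt_le_trans h2.
Qed.

(** Minimality bounds P(E_u, A) by P(F, A), which the two cuts split into E_u outside the planes,
    E_v between them, and an error. Superadditivity splits P(E_u, A) from below over the same three
    regions, and the outer pieces cancel. *)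
Lemma slab_compare (h : LebRN R N -> R) (M Mh : R) : measurable_fun setT h -> (forall z, `|h z| <= Mh) ->
  {ae mu, forall z : LebRN R N, K z -> h z = H z} -> 0 <= M ->
  (forall z, K z -> `|eps| + \sum_i `|xi sg pm i z| <= M) ->
  (per (sub u) (A `&` B) <= per (sub v) (cyl W) +
    (2 * (2 * M * fine (mu S)) + I mu1 (fun q => h (pz q) * (\1_(F `&` A) q - \1_(sub u `&` A) q)))%:E)%E.
Proof.
move=> mh hMh hE M0 hM; set e := 2 * M * fine (mu S).
have ccA : compactly_contained A (cyl Omega).
  by apply: (cc_intro cAC AC) => q [/KO].
have pu_fin : (per (sub u) (cyl W) < +oo)%E := fin_per sg pm eps0 oO hu oW cW.
have pA : (per (sub u) A <= per (sub u) (cyl W))%E by apply: per_mono => q [].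
have AM U q : Test A U -> `|pt (U q)| <= M.
  move=> [_ [[C [_ CA] U0] nU]]; have [/CA[/WK Kq _]|/U0 ->] := pselect (C q).
    by apply: (le_trans (pt_le eps0 (nU q))); exact: hM.
  by rewrite /pt mxE normr0.
have hi (E : set Hn) (mE : measurable (E : set (LebRN R (N + 1)))) :=
  @integral_H R N Omega oO H (E `&` A) K h Mh hH cK KO (measurableI _ _ mE mA)
    (leb_fin_sub cAC (subset_trans (@subIsetr _ _ _) AC)) (fun q hq => WK hq.2.1) mh hMh hE.
have := hb oA ccA mF diff.
rewrite (hi _ mu_).2 (hi _ mF).2.
set hu' := I mu1 _; set hF := I mu1 _ => h1.
have dE : I mu1 (fun q => h (pz q) * (\1_(F `&` A) q - \1_(sub u `&` A) q)) = hF - hu'.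
  rewrite /hF /hu' -(IB (hi _ mF).1 (hi _ mu_).1); congr I.
  by apply/funext => q; rewrite mulrBr.
rewrite dE.
pose Lm : set Hn := [set q | pt q < - k]; pose Um : set Hn := [set q | - k < pt q].
pose Lp : set Hn := [set q | pt q < k]; pose Up : set Hn := [set q | k < pt q].
(* Near [t = - k] it is the complement of [F] that is contained in the small set. *)
have cut1 : (per F A <= per (sub u) (A `&` Lm) + per F (A `&` Um) + e%:E)%E.
  rewrite -(per_compl sg pm eps0 A mF) -(per_compl sg pm eps0 (A `&` Lm) mu_)
    -(per_compl sg pm eps0 (A `&` Um) mF).
  apply: (per_cut eps0 (measurableC mF) mS Sfin M0 _ _ _ AM) => //.
    move=> q Aq hq; have nB : ~ B q by rewrite /B /= ltr_norml => /andP[]; lra.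
    by split => nh h2; apply: nh; apply/(FnB nB).
  move=> q [Wq _] hq nF.
  have hq' : pt q < - k + 1 by move: hq; rewrite ltr_norml => /andP[]; lra.
  have [Bq|nB] := pselect (B q).
    apply: (SW (t := - v (pz q)) Wq).
      suff : v (pz q) <= pt q by lra.
      by rewrite leNgt; apply/negP => hv'; apply: nF; apply/(FB Bq); split => //; exact: WO.
    by have := ler_norm (- v (pz q)); rewrite normrN; have := normr_ge0 (u (pz q)); lra.
  apply: (SW (t := - u (pz q)) Wq).
    suff : u (pz q) <= pt q by lra.
    by rewrite leNgt; apply/negP => hv'; apply: nF; apply/(FnB nB); split => //; exact: WO.
  by have := ler_norm (- u (pz q)); rewrite normrN; have := normr_ge0 (v (pz q)); lra.
set A' := A `&` Um.
have cut2 : (per F A' <= per (sub v) (A' `&` Lp) + per (sub u) (A' `&` Up) + e%:E)%E.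
  have AM' U q : Test A' U -> `|pt (U q)| <= M.
    by move=> T; apply: AM; apply: Test_sub T; exact: subIsetl.
  apply: (per_cut eps0 mF mS Sfin M0 _ _ _ AM').
  - move=> q [_ /= h2] h3; apply: FB; rewrite /B /= ltr_norml h2 h3//.
  - move=> q _ hq; apply: FnB; rewrite /B /= ltr_norml => /andP[]; lra.
  - move=> q [[Wq _] _] hq Fq.
    have hq' : k - 1 < pt q by move: hq; rewrite ltr_norml => /andP[]; lra.
    case: Fq => -[_ [_ hlt]].
      apply: (SW (t := v (pz q)) Wq); first by lra.
      by apply: (le_trans (ler_norm _)); rewrite lerDr.
    apply: (SW (t := u (pz q)) Wq); first by lra.
    by apply: (le_trans (ler_norm _)); rewrite lerDl.
have sup1 : (per (sub u) (A `&` Lm) + per (sub u) A' <= per (sub u) A)%E.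
  apply: (per_superadd eps sg pm mu_); [exact: subIsetl|exact: subIsetl|].
  by apply/seteqP; split => // q [[_ h2] [_ h3]]; move: h2 h3; rewrite /Lm /Um /=; lra.
have sup2 : (per (sub u) (A `&` B) + per (sub u) (A' `&` Up) <= per (sub u) A')%E.
  apply: (per_superadd eps sg pm mu_).
  - by move=> q [Aq]; rewrite /B /= ltr_norml => /andP[h2 _]; split.
  - exact: subIsetl.
  - by apply/seteqP; split => // q [[_ Bq] [_ h3]]; move: Bq h3; rewrite /B /Up /= ltr_norml => /andP[]; lra.
have pv : (per (sub v) (A' `&` Lp) <= per (sub v) (cyl W))%E.
  by apply: per_mono => q [[[]]].
have pv_fin : (per (sub v) (cyl W) < +oo)%E := fin_per sg pm eps0 oO hv oW cW.
(* Every piece receives a finite value before anything is cancelled; finiteness of P(F, A) itself is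
   read off the cuts. *)
have monA (X : set Hn) : X `<=` A -> exists r : R, per (sub u) X = r%:E.
  by move=> XA; apply: (per_fin _ pu_fin); apply: (le_trans (per_mono eps sg pm (sub u) XA)).
have [r1 e1] := monA _ (@subIsetl _ A Lm).
have [r2 e2] := monA _ (@subIsetl _ A Um).
have [r3 e3] := monA _ (subset_trans (@subIsetl _ A' Up) (@subIsetl _ A Um)).
have [r4 e4] := monA _ (@subIsetl _ A B).
have [r5 e5] := monA _ (@subset_refl _ A).
have [r6 e6] := per_fin (@le_refl _ _ (per (sub v) (cyl W))) pv_fin.
have [r7 e7] := per_fin pv pv_fin.
move: cut2 sup2 sup1 pv; rewrite -/A' in e2; rewrite e7 e3 e1 e2 e4 e5 e6 -!EFinD !lee_fin => cut2 sup2 sup1 pv.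
have [r8 e8] := per_fin cut2 (ltry _).
move: cut1 cut2; rewrite -/A' e8 e1 -!EFinD => cut1 cut2; rewrite lee_fin in cut2.
have [r9 e9] := per_fin cut1 (ltry _).
move: cut1 h1; rewrite e9 e5 -!EFinD !lee_fin => cut1 h1; lra.
Qed.

End slab.

(** The support of a fixed test field lies in the slab |t| < k for large k, so its flux is bounded
    by the right-hand side of [slab_compare], and the bound passes to the limit. *)
Lemma minimizer_graph : (per (sub u) (cyl W) + \int[lebRN R N]_(z in W) (H z * u z)%:E <=
  per (sub v) (cyl W) + \int[lebRN R N]_(z in W) (H z * v z)%:E)%E.
Proof.
have [h [Mh [Mh0 mh hMh hE]]] := Linfloc_clamp oO hH cK KO.
have [M M0 hM] := xi_bound eps sg pm cK.
have iu := integral_Hv oO hH hu.1 cK KO mW WK mh hMh hE.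
have iv := integral_Hv oO hH hv.1 cK KO mW WK mh hMh hE.
rewrite iu.2 iv.2; set Iu := I mu _; set Iv := I mu _.
have [x ex] := per_fin (@le_refl _ _ (per (sub v) (cyl W))) (fin_per sg pm eps0 oO hv oW cW).
suff : (per (sub u) (cyl W) <= (x + (Iv - Iu))%:E)%E.
  by rewrite ex => /(leeD2r Iu%:E) h2; apply: (le_trans h2); rewrite -!EFinD lee_fin; lra.
apply: per_le => U TU; rewrite lee_fin.
have [hU [[C [cC CW] U0] nU]] := TU.
have [k0 k00 hk0] := compact_pt cC.
(* With k = j + 1 the threshold k - 1 in [S] is j. *)
pose kk (j : nat) : R := j%:R + 1.
pose B k : set Hn := [set q | `|pt q| < k].
pose A k : set Hn := [set q | W (pz q) /\ `|pt q| < k + 1].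
pose S k : set V := W `&` [set z | k - 1 < `|u z * \1_W z| + `|v z * \1_W z|].
pose F k : set Hn := (B k `&` sub v) `|` (~` B k `&` sub u).
pose d k := I mu1 (fun q : LebRN R (N + 1) => h (pz q) * (\1_(F k `&` A k) q - \1_(sub u `&` A k) q)).
have main j : k0 < kk j -> flux (sub u) U <= x + (2 * (2 * M * fine (mu (S (kk j)))) + d (kk j)).
  move=> kj; rewrite -lee_fin EFinD -ex.
  have T : Test (A (kk j) `&` B (kk j)) U.
    split => //; split => //; exists C => //; split => // q Cq.
    have /andP[h1 h2] := hk0 q Cq.
    have Bq : `|pt q| < kk j by rewrite ltr_norml; apply/andP; split; lra.
    by split => //; split; [exact: CW|lra].
  apply: (le_trans (per_ub (sub u) T)).
  exact: (@slab_compare (kk j) h M Mh mh hMh hE M0 hM).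
have Scv : fine (mu (S (kk j))) @[j --> \oo] --> (0 : R).
  have E j : fine (mu (S (kk j))) = I mu (\1_(S (kk j)) : LebRN R N -> R).
    exact: (esym (I_indic mu (measurable_high (kk j)))).
  under eq_fun do rewrite E.
  have ae : {ae mu, forall z : LebRN R N, \1_(S (kk j)) z @[j --> \oo] --> (0 : R)}.
    apply/aeW => z; apply: cvg_near_cst; near=> j; apply: indicF => -[_ /=].
    have : `|u z * \1_W z| + `|v z * \1_W z| <= j%:R by near: j; exact: nbhs_infty_ger.
    by rewrite /kk addrK => h1 h2; lra.
  have dom j (z : LebRN R N) : `|\1_(S (kk j)) z| <= \1_W z :> R.
    have [Sz|nS] := pselect (S (kk j) z); last by rewrite (indicF nS) normr0 indicE.
    by rewrite (indicT Sz) normr1 (indicT Sz.1).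
  have iW : intg mu \1_W := intg_indic mW (leb_fin_sub cK WK).
  have m0 j : measurable_fun setT (\1_(S (kk j)) : LebRN R N -> R).
    exact: measurable_indic (measurable_high (kk j)).
  have m00 : measurable_fun setT (fun _ : LebRN R N => 0 : R) by exact: measurable_cst.
  have cvI := @I_dct _ _ (LebRN R N) mu (fun j => \1_(S (kk j))) (fun=> 0) \1_W m0 m00 ae iW dom.
  by rewrite I0 in cvI; exact: cvI.
have dcv : d (kk j) @[j --> \oo] --> Iv - Iu.
  pose h1 (z : LebRN R N) : R := h z * \1_W z.
  have mh1 : measurable_fun setT h1 := measurable_funM mh (measurable_indic mW).
  have hM1 z : `|h1 z| <= Mh.
    rewrite /h1 normrM; have [Wz|nW] := pselect (W z); first by rewrite (indicT Wz) normr1 mulr1.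
    by rewrite (indicF nW) normr0 mulr0.
  have vol w : L1loc Omega w -> intg mu1 (fun q : LebRN R (N + 1) => h1 (pz q) * (\1_K (pz q) * (\1_(sub w) q - neg (pt q)))) /\
      I mu1 (fun q : LebRN R (N + 1) => h1 (pz q) * (\1_K (pz q) * (\1_(sub w) q - neg (pt q)))) =
      I mu (fun z => h z * (w z * \1_W z)).
    move=> Lw; have [g1 g2] := hgt_vol (pmeas_sub oO Lw.1) (loc_sub oO Lw) cK KO mh1 hM1.
    split; first exact: g1.
    apply: (eq_trans g2); congr I; apply/funext => z; rewrite /h1.
    have [Wz|nW] := pselect (W z); last by rewrite (indicF nW) !mulr0 mul0r.
    by rewrite (indicT Wz) (indicT (WK Wz)) !mulr1 hgt_sub//; exact: WO.
  have [gu eu] := vol u hu.1; have [gv ev] := vol v hv.1.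
  pose G (q : LebRN R (N + 1)) : R := h1 (pz q) * (\1_K (pz q) * (\1_(sub v) q - neg (pt q))) -
    h1 (pz q) * (\1_K (pz q) * (\1_(sub u) q - neg (pt q))).
  have Gi : intg mu1 G := intgB gv gu.
  have EG : Iv - Iu = I mu1 G by rewrite /G (IB gv gu) eu ev.
  (* F equals E_v inside the slab and E_u outside it, so the difference of the curvature terms is
     [G] restricted to the slab. *)
  have Ed j : d (kk j) = I mu1 (fun q => G q * \1_(B (kk j)) q).
    congr I; apply/funext => q; rewrite /G /h1.
    have [Wq|nW] := pselect (W (pz q)); last first.
      have z1 : \1_(F (kk j) `&` A (kk j)) q = 0 :> R by apply: indicF => -[_ []].
      have z2 : \1_(sub u `&` A (kk j)) q = 0 :> R by apply: indicF => -[_ []].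
      by rewrite z1 z2 (indicF nW) !(mulr0, mul0r, subrr).
    rewrite (indicT Wq) (indicT (WK Wq)) mulr1 !mul1r.
    have [Bq|nB] := pselect (B (kk j) q).
      have Aq : A (kk j) q by split => //; move: Bq; rewrite /B /=; lra.
      rewrite (indicT Bq) mulr1 -mulrBr; congr (_ * _).
      have -> : \1_(F (kk j) `&` A (kk j)) q = \1_(sub v) q :> R.
        rewrite !indicE_asbool; congr (if _ then _ else _); apply: asbool_equiv_eq.
        by split => [[[[]|[]]]|hv']//; split => //; left.
      have -> : \1_(sub u `&` A (kk j)) q = \1_(sub u) q :> R.
        rewrite !indicE_asbool; congr (if _ then _ else _); apply: asbool_equiv_eq.
        by split => [[]|].
      by ring.
    rewrite (indicF nB) mulr0.
    have -> : \1_(F (kk j) `&` A (kk j)) q = \1_(sub u `&` A (kk j)) q :> R.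
      rewrite !indicE_asbool; congr (if _ then _ else _); apply: asbool_equiv_eq.
      by split => [[[[]|[_ hu']] Aq]|[hu' Aq]]//; split => //; right.
    by rewrite subrr mulr0.
  under eq_fun do rewrite Ed.
  rewrite EG.
  have mB j : measurable (B (kk j) : set (LebRN R (N + 1))) := measurable_open (@open_pt (kk j)).
  have ae : {ae mu1, forall q : LebRN R (N + 1), G q * \1_(B (kk j)) q @[j --> \oo] --> G q}.
    apply/aeW => q; apply: cvg_near_cst; near=> j; rewrite indicT ?mulr1// /B /= /kk.
    have : `|pt q| <= j%:R by near: j; exact: nbhs_infty_ger.
    by move=> ?; lra.
  have dom j (q : LebRN R (N + 1)) : `|G q * \1_(B (kk j)) q| <= `|G q|.
    rewrite normrM; have [Bq|nB] := pselect (B (kk j) q); first by rewrite (indicT Bq) normr1 mulr1.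
    by rewrite (indicF nB) normr0 mulr0.
  have m0 j : measurable_fun setT (fun q : LebRN R (N + 1) => G q * \1_(B (kk j)) q).
    exact: (measurable_funM (intg_measurable Gi) (measurable_indic (mB j))).
  exact: (I_dct m0 (intg_measurable Gi) ae (intg_abs Gi) dom).
have cv : x + (2 * (2 * M * fine (mu (S (kk j)))) + d (kk j)) @[j --> \oo] --> x + (2 * (2 * M * 0) + (Iv - Iu)).
  apply: cvgD; first exact: cvg_cst.
  apply: cvgD => //; apply: cvgM; first exact: cvg_cst.
  by apply: cvgM => //; exact: cvg_cst.
rewrite !mulr0 add0r in cv.
rewrite -(cvg_lim _ cv)//; apply: limr_ge; first by apply/cvg_ex; exists (x + (Iv - Iu)).
near=> j; apply: main; rewrite /kk.
have : k0 <= j%:R by near: j; exact: nbhs_infty_ger.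
by move=> ?; lra.
Unshelve. all: by end_near. Qed.

End b_to_a.

(** * From minimizing graphs to minimizing sets *)

Section a_to_b.
Context {R : realType} {N : nat}.
Variables (eps : R) (sg : 'I_N -> R) (pm : 'I_N -> 'I_N).
Hypothesis eps0 : eps != 0.
Variable Omega : set 'rV[R]_N.
Hypothesis oO : open Omega.
Local Notation mu := (lm R N).
Local Notation mu1 := (lm R (N + 1)).
Local Notation leb := (@lebesgue_measure R).
Local Notation Hn := 'rV[R]_(N + 1).
Local Notation V := 'rV[R]_N.
Local Notation per := (per eps sg pm).
Local Notation Test := (Test eps sg pm).
Local Notation Testz := (Testz eps sg pm).
Local Notation sub := (sub Omega).
Local Notation cyl W := [set q : Hn | W (pz q)].
Implicit Types (u v : V -> R) (K W : set V) (A F E : set Hn).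

(** Measurability for the product sigma-algebra, the set-level form of [pmeas]; it makes vertical
    sections measurable. *)
Definition pset (E : set Hn) := measurable ((fun x : LebRN R N * R => mk x.1 x.2) @^-1` E).

Lemma pset_pmeas E : pset E -> pmeas (\1_E : Hn -> R).
Proof. by move=> pE; exact: (measurable_indic pE). Qed.

Lemma pmeas_pset E : pmeas (\1_E : Hn -> R) -> pset E.
Proof.
move=> mE; rewrite /pset.
have -> : (fun x : LebRN R N * R => mk x.1 x.2) @^-1` E =
    setT `&` (fun x : LebRN R N * R => \1_E (mk x.1 x.2) : R) @^-1` [set 1].
  rewrite setTI; apply/seteqP; split => x /=; rewrite indicE_asbool; case: asboolP => //.
  by move=> _ /esym /eqP; rewrite oner_eq0.
by apply: mE; [exact: measurableT|exact: measurable_set1].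
Qed.

(** The hull of [leb_hull] has the same finite measure as [E], so it exceeds [E] by a null set. *)
Lemma leb_hull_null E : measurable (E : set (LebRN R (N + 1))) -> (mu1 E < +oo)%E ->
  exists S : set Hn, [/\ E `<=` S, measurable (S : set (LebRN R (N + 1))), pset S &
    mu1 (S `\` E) = 0%E].
Proof.
move=> mE Efin; have [S [ES eS hS]] := leb_hull Efin.
have mS : measurable (S : set (LebRN R (N + 1))) := hS _ (LebRN R (N + 1)) id (@measurable_coord R (N + 1)).
exists S; split => //; first exact: (hS _ _ _ (@measurable_mk R N)).
have eS' : mu1 S = mu1 E by exact: eS.
have Sfin : (mu1 S < +oo)%E by rewrite eS'.
have SE : S `&` E = E by rewrite setIC; apply/setIidl.
have e := measureD (mu := mu1) mS mE Sfin; rewrite SE in e.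
apply: (eq_trans e); apply: (eq_trans (congr1 (fun x => x - _)%E eS')).
by apply: subee; rewrite ge0_fin_numE//; exact: measure_ge0.
Qed.

Lemma per_ae E F X : measurable (E : set (LebRN R (N + 1))) -> measurable (F : set (LebRN R (N + 1))) ->
  {ae mu1, forall q : LebRN R (N + 1), \1_E q = \1_F q :> R} -> per E X = per F X.
Proof.
move=> mE mF EF.
have h U : Test X U -> flux E U = flux F U.
  move=> [hU [[C [cC _] U0] _]]; apply: I_eq_ae.
  - exact: intg_measurable (flux_intg mE hU cC U0).
  - exact: intg_measurable (flux_intg mF hU cC U0).
  - by apply: filterS EF => q ->.
apply/eqP; rewrite eq_le; apply/andP; split; apply: per_le => U TU.
  by rewrite h//; exact: per_ub.
by rewrite -h//; exact: per_ub.
Qed.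

Lemma open_pz_image A : open A -> open (@pz R N @` A).
Proof.
move=> oA; rewrite openE => _ [q Aq <-]; apply/rV_nbhs.
have /rV_nbhs[r r0 hr] : nbhs q A by apply: open_nbhs_nbhs.
exists r => // z hz; exists (mk z (pt q)); last by rewrite pz_mk.
apply: hr => j; case: (split_ordP j) => i ->; first by rewrite mkl -pzE.
by rewrite mkr (ord1 i) /pt subrr normr0.
Qed.

Variables (H u : V -> R).
Hypotheses (hH : Linfloc Omega H) (hu : BVloc Omega u).
Hypothesis ha : forall W v, open W -> compactly_contained W Omega -> BVloc Omega v ->
  compactly_contained [set z | Omega z /\ u z <> v z] W ->
  (per (sub u) (cyl W) + \int[lebRN R N]_(z in W) (H z * u z)%:E <=
   per (sub v) (cyl W) + \int[lebRN R N]_(z in W) (H z * v z)%:E)%E.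

Section competitor.
Variables (A F : set Hn) (D : set Hn).
Hypotheses (oA : open A) (cA : compactly_contained A (cyl Omega)).
Hypotheses (pF : pset F) (cD : compact D) (DA : D `<=` A).
Hypothesis FD : forall q, ~ D q -> (F q <-> sub u q).

Let pu : pmeas (\1_(sub u) : Hn -> R). Proof. exact: (pmeas_sub oO hu.1.1). Qed.
Let pF' : pmeas (\1_F : Hn -> R). Proof. exact: (pset_pmeas pF). Qed.
Let mF : measurable (F : set (LebRN R (N + 1))). Proof. exact: (pmeas_set pF'). Qed.
Let mu_ : measurable (sub u : set (LebRN R (N + 1))). Proof. exact: (pmeas_set pu). Qed.
Let W : set V := @pz R N @` A.
Let oW : open W. Proof. exact: open_pz_image. Qed.
Let K : set V := @pz R N @` closure A.
Let cK : compact K. Proof. exact: compact_pz cA.1. Qed.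
Let KO : K `<=` Omega. Proof. by move=> _ [q /cA.2 Oq <-]. Qed.
Let WK : W `<=` K. Proof. by move=> _ [q Aq <-]; exists q => //; exact: subset_closure. Qed.
Let WO : W `<=` Omega. Proof. exact: subset_trans WK KO. Qed.
Let cW : compactly_contained W Omega. Proof. exact: cc_intro cK WK KO. Qed.
Let mW : measurable (W : set (LebRN R N)). Proof. exact: measurable_open oW. Qed.
Let v := hgt F.
Let PD : set V := @pz R N @` D.
Let cPD : compact PD. Proof. exact: compact_pz. Qed.
Let PDW : PD `<=` W. Proof. by move=> _ [q /DA Aq <-]; exists q. Qed.

Let FuD q : `|\1_F q - \1_(sub u) q| <= \1_D q :> R.
Proof.
have [Dq|nD] := pselect (D q).
  rewrite (indicT Dq) !indicE_asbool; case: asboolP => _; case: asboolP => _;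
    by rewrite ?subrr ?normr0 ?subr0 ?sub0r ?normrN ?normr1.
have -> : \1_F q = \1_(sub u) q :> R.
  by rewrite !indicE_asbool (asbool_equiv_eq (FD nD)).
by rewrite subrr normr0 indicE.
Qed.

(** F and E_u differ only inside the compact [D], which has finite measure and is bounded in t. *)
Let loc : loc_subgraph Omega F.
Proof.
move=> K' cK' KO'; have [l1 l2] := loc_sub oO hu.1 cK' KO'.
have mD := leb_compact_measurable cD.
have pd : pmeas (fun q : Hn => \1_F q - \1_(sub u) q) := pmeasB pF' pu.
split.
  have pk : pmeas (fun q : Hn => \1_K' (pz q) * (\1_F q - \1_(sub u) q)).
    exact: (pmeasM (pmeas_pz (measurable_indic_compact cK')) pd).
  have di : intg mu1 (fun q : LebRN R (N + 1) => \1_K' (pz q) * (\1_F q - \1_(sub u) q)).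
    apply: (intg_dom (pmeas_meas pk) _ (intg_indic mD (leb_compact_fin cD))) => q.
    rewrite normrM -[leRHS]mul1r; apply: ler_pM => //.
    by rewrite ger0_norm indicE//; case: (_ \in _).
  have -> : (fun q : LebRN R (N + 1) => \1_K' (pz q) * (\1_F q - neg (pt q))) =
     fun q => \1_K' (pz q) * (\1_(sub u) q - neg (pt q)) + \1_K' (pz q) * (\1_F q - \1_(sub u) q).
    by apply/funext => q; ring.
  exact: (intgD l1 di).
move=> z Kz; have h1 := l2 z Kz.
have [k k0 hk] := compact_pt cD.
have mt : measurable_fun setT (fun t : R => \1_F (mk z t) - \1_(sub u) (mk z t) : R).
  exact: (measurableT_comp pd (@pair1_measurable _ _ (LebRN R N) R z)).
have dom (t : R) : `|\1_F (mk z t) - \1_(sub u) (mk z t)| <= \1_(`[- k, k]%classic) t :> R.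
  apply: (le_trans (FuD (mk z t))); rewrite !indicE_asbool; case: asboolP => Dq; last by case: asboolP.
  by rewrite asboolT//= in_itv/=; have := hk _ Dq; rewrite pt_mk.
have -> : (fun t : R => \1_F (mk z t) - neg t) = fun t : R => \1_(sub u) (mk z t) - neg t +
    (\1_F (mk z t) - \1_(sub u) (mk z t)).
  by apply/funext => t; ring.
apply: (intgD h1).
exact: (@intg_dom R _ _ leb _ _ mt dom (intg_itv k)).
Qed.

Let vu z : Omega z -> ~ PD z -> v z = u z.
Proof.
move=> Oz nD; rewrite -(hgt_sub u Oz) /v /hgt; congr I; apply/funext => t; congr (_ - _).
rewrite !indicE_asbool; congr (if _ then _ else _); apply: asbool_equiv_eq; apply: FD => Dq.
by apply: nD; exists (mk z t) => //; rewrite pz_mk.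
Qed.

Let Lv : L1loc Omega v.
Proof.
have PDO : PD `<=` Omega := subset_trans PDW WO.
have mO := measurable_open oO.
split.
  have m1 : measurable_fun setT (fun z : LebRN R N => v z * \1_PD z) := intg_measurable (hgt_loc pF' loc cPD PDO).
  have m2 : measurable_fun setT (fun z : LebRN R N => 1 - \1_PD z : R).
    have mc : measurable_fun setT (fun _ : LebRN R N => 1 : R) by exact: measurable_cst.
    have mi : measurable_fun setT (\1_PD : LebRN R N -> R) := measurable_indic_compact cPD.
    exact: (measurable_funB mc mi).
  have m3 : measurable_fun (Omega : set (LebRN R N)) (fun z : LebRN R N => u z * (1 - \1_PD z) + v z * \1_PD z).
    apply: measurable_funD; last exact: measurable_funTS m1.
    by apply: measurable_funM; [exact: hu.1.1|exact: measurable_funTS m2].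
  apply: (eq_measurable_fun _ _ m3) => z /set_mem Oz.
  have [Dz|nD] := pselect (PD z); first by rewrite (indicT Dz) subrr mulr0 add0r mulr1.
  by rewrite (indicF nD) subr0 mulr1 mulr0 addr0 vu.
move=> K' cK' KO'; have hi := intg_abs (hgt_loc pF' loc cK' KO').
rewrite (@integral_on _ _ (LebRN R N) (lebRN R N) K' (fun z => `|v z|)).
have -> : (\int[lebRN R N]_x (`|v x| * \1_K' x)%:E = (I mu (fun z => `|v z * \1_K' z|))%:E)%E.
  rewrite -(intgE hi); apply: eq_integral => z _.
  by rewrite normrM [`|\1_K' z|]ger0_norm// indicE.
exact: ltry.
Qed.

Let diff_v : compactly_contained [set z | Omega z /\ u z <> v z] W.
Proof.
apply: (cc_intro cPD _ PDW) => z [Oz nuv]; apply: contrapT => nD.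
by apply: nuv; rewrite vu.
Qed.

Let glue B : A `<=` B -> (per F B + per (sub u) A <= per F A + per (sub u) B)%E.
Proof.
move=> AB.
exact: (@per_glue R N eps sg pm eps0 (sub u) F A B D mu_ mF oA AB cD DA (fun q nD => iff_sym (FD nD))).
Qed.

(** On the cylinder over W, P(E_u) is compared with P(E_v) by hypothesis and P(E_v) with P(F) by
    rearrangement, where v = hgt F; gluing brings the result down to [A]. *)
Lemma graph_le : (per (sub u) A + \int[lebRN R (N + 1)]_(p in sub u `&` A) (H (pz p))%:E <=
  per F A + \int[lebRN R (N + 1)]_(p in F `&` A) (H (pz p))%:E)%E.
Proof.
have [h [Mh [Mh0 mh hMh hE]]] := Linfloc_clamp oO hH cK KO.
have mA : measurable (A : set (LebRN R (N + 1))) := measurable_open oA.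
have hi (E : set Hn) (mE : measurable (E : set (LebRN R (N + 1)))) :=
  @integral_H R N Omega oO H (E `&` A) K h Mh hH cK KO (measurableI _ _ mE mA)
    (leb_fin_sub cA.1 (subset_trans (@subIsetr _ _ _) (@subset_closure _ A)))
    (fun q hq => WK (imageP _ hq.2)) mh hMh hE.
rewrite (hi _ mu_).2 (hi _ mF).2.
(* If P(F, A) is infinite the inequality is trivial; if it is finite, gluing gives F finite
   perimeter on cylinders. *)
have [[f fE]|nf] := pselect (exists f : R, per F A = f%:E); last first.
  have -> : per F A = +oo%E.
    have := per_ge0 eps sg pm F A; move: nf; case: (per F A) => [r| |] //.
    by move=> nf; exfalso; apply: nf; exists r.
  by rewrite addye// leey.
have AcW : A `<=` cyl W by move=> q Aq; exists q.
have Bfin (A' : set V) : open A' -> compactly_contained A' Omega -> (per F (cyl A') < +oo)%E.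
  (* Adding W makes the cylinder over [B] contain [A], as gluing requires. *)
  move=> oA' [cA' AO']; pose B := A' `|` W.
  have cB : compactly_contained B Omega.
    apply: (cc_intro (compactU cA' cK)) => z [h1|h1].
    - by left; exact: subset_closure.
    - by right; exact: WK.
    - exact: AO'.
    - exact: KO.
  have uB := fin_per sg pm eps0 oO hu (openU oA' oW) cB.
  have g := glue (B := cyl B) (fun q Aq => or_intror (AcW q Aq)).
  apply: (@le_lt_trans _ _ (per F (cyl B))); first by apply: per_mono => q; left.
  apply: (@le_lt_trans _ _ (per F (cyl B) + per (sub u) A)%E); first by rewrite leeDl// per_ge0.
  by apply: (le_lt_trans g); rewrite fE; exact: lte_add_pinfty (ltry _) uB.
have BVv : BVloc Omega v.
  split; first exact: Lv.
  move=> A' oA' cA'; have AO' : A' `<=` Omega := subset_trans (@subset_closure _ A') cA'.2.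
  have [x ex] := per_fin (@le_refl _ _ (per F (cyl A'))) (Bfin A' oA' cA').
  have loc' : loc_subgraph A' F by move=> K' cK' KA'; apply: loc => //; exact: subset_trans KA' AO'.
  apply: (@tv_fin R N eps sg pm eps0 Omega v A' x cA').
    by move=> K' cK' KA'; apply: (hgt_loc pF' loc cK'); exact: subset_trans KA' AO'.
  by move=> phi T; rewrite -lee_fin -ex; exact: (zflux_le_per eps0 pF' loc' T).
have locW : loc_subgraph W F by move=> K' cK' KA'; apply: loc => //; exact: subset_trans KA' WO.
have mv_ : measurable (sub v : set (LebRN R (N + 1))) := pmeas_set (pmeas_sub oO Lv.1).
have rearr : (per (sub v) (cyl W) <= per F (cyl W))%E.
  have hE' q : W (pz q) -> (sub v q <-> pt q < hgt F (pz q)).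
    by move=> Wq; split=> [[]|hq] //; split => //; exact: WO.
  exact: (per_rearrange sg pm eps0 oW pF' locW mv_ hE').
have hW := ha oW cW BVv diff_v.
have g := glue AcW.
have iu := integral_Hv oO hH hu.1 cK KO mW WK mh hMh hE.
have iv := integral_Hv oO hH Lv cK KO mW WK mh hMh hE.
move: hW; rewrite iu.2 iv.2; set Iu := I mu _; set Iv := I mu _ => hW.
set Hu := I mu1 _; set HF := I mu1 _.
(* Off [A] the sets F and E_u coincide, so restricting to [A] or to the cylinder over W gives the
   same difference of weighted volumes. *)
have EI : HF - Hu = Iv - Iu.
  pose h1 (z : LebRN R N) : R := h z * \1_W z.
  have mh1 : measurable_fun setT h1 := measurable_funM mh (measurable_indic mW).
  have hM1 z : `|h1 z| <= Mh.
    rewrite /h1 normrM; have [Wz|nW] := pselect (W z); first by rewrite (indicT Wz) normr1 mulr1.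
    by rewrite (indicF nW) normr0 mulr0.
  have vol (E : set Hn) (w : V -> R) : pmeas (\1_E : Hn -> R) -> loc_subgraph Omega E -> (forall z, Omega z -> hgt E z = w z) ->
      intg mu1 (fun q : LebRN R (N + 1) => h1 (pz q) * (\1_K (pz q) * (\1_E q - neg (pt q)))) /\
      I mu1 (fun q : LebRN R (N + 1) => h1 (pz q) * (\1_K (pz q) * (\1_E q - neg (pt q)))) =
      I mu (fun z => h z * (w z * \1_W z)).
    move=> mE lE Ew; have [g1 g2] := hgt_vol mE lE cK KO mh1 hM1.
    split; first exact: g1.
    apply: (eq_trans g2); congr I; apply/funext => z; rewrite /h1.
    have [Wz|nW] := pselect (W z); last by rewrite (indicF nW) !mulr0 mul0r.
    by rewrite (indicT Wz) (indicT (WK Wz)) !mulr1 Ew//; exact: WO.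
  have [gu eu] := vol _ u pu (loc_sub oO hu.1) (fun z Oz => hgt_sub u Oz).
  have [gv ev] := vol _ v pF' loc (fun z _ => erefl).
  rewrite /Iv /Iu -eu -ev -(IB gv gu) -(IB (hi _ mF).1 (hi _ mu_).1); congr I; apply/funext => q.
  have [Aq|nA] := pselect (A q).
    have Wq : W (pz q) by exact: AcW.
    have e1 (E : set Hn) : \1_(E `&` A) q = \1_E q :> R.
      rewrite !indicE_asbool; congr (if _ then _ else _); apply: asbool_equiv_eq.
      by split=> [[]|].
    by rewrite !e1 /h1 (indicT Wq) (indicT (WK Wq)); ring.
  have z1 : \1_(F `&` A) q = 0 :> R by apply: indicF => -[].
  have z2 : \1_(sub u `&` A) q = 0 :> R by apply: indicF => -[].
  have e1 : \1_F q = \1_(sub u) q :> R.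
    rewrite !indicE_asbool; congr (if _ then _ else _); apply: asbool_equiv_eq; apply: FD.
    by move=> /DA.
  by rewrite z1 z2 e1; ring.
have [r1 e1] := per_fin (@le_refl _ _ (per (sub u) (cyl W))) (fin_per sg pm eps0 oO hu oW cW).
have [r2 e2] := per_fin (@le_refl _ _ (per F (cyl W))) (Bfin W oW cW).
have [r3 e3] := per_fin (per_mono eps sg pm (sub u) AcW) (fin_per sg pm eps0 oO hu oW cW).
have [r4 e4] := per_fin rearr (Bfin W oW cW).
move: hW g rearr; rewrite e1 e2 e3 e4 fE -!EFinD !lee_fin => hW g rearr.
lra.
Qed.

End competitor.

(** Here F is only Lebesgue measurable. Both parts of its symmetric difference with E_u are replaced
    by hulls, which changes F by a null set and so affects neither perimeter nor curvature term. *)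
Lemma graph_minimizer A F : open A -> compactly_contained A (cyl Omega) ->
  measurable (F : set (LebRN R (N + 1))) ->
  compactly_contained ((sub u `\` F) `|` (F `\` sub u)) A ->
  (per (sub u) A + \int[lebRN R (N + 1)]_(p in sub u `&` A) (H (pz p))%:E <=
   per F A + \int[lebRN R (N + 1)]_(p in F `&` A) (H (pz p))%:E)%E.
Proof.
move=> oA cA mF [cD DA]; set D := closure _ in cD DA.
have pu : pmeas (\1_(sub u) : Hn -> R) := pmeas_sub oO hu.1.1.
have mu_ : measurable (sub u : set (LebRN R (N + 1))) := pmeas_set pu.
have D1 : sub u `\` F `<=` D by move=> q hq; apply: subset_closure; left.
have D2 : F `\` sub u `<=` D by move=> q hq; apply: subset_closure; right.
have m1 : measurable (sub u `\` F : set (LebRN R (N + 1))) := measurableD mu_ mF.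
have m2 : measurable (F `\` sub u : set (LebRN R (N + 1))) := measurableD mF mu_.
have [S1 [NS1 mS1 pS1 z1]] := leb_hull_null m1 (leb_fin_sub cD D1).
have [S2 [NS2 mS2 pS2 z2]] := leb_hull_null m2 (leb_fin_sub cD D2).
(* Intersecting the hulls with [D] keeps F' equal to E_u off [D]. *)
pose F' : set Hn := (sub u `&` ~` (S1 `&` D)) `|` (S2 `&` D).
have pD : pset D := measurable_preimage_closed (@measurable_mk R N) (rV_compact_closed cD).
have pF' : pset F'.
  exact: (measurableU _ _ (measurableI _ _ (pmeas_pset pu) (measurableC (measurableI _ _ pS1 pD))) (measurableI _ _ pS2 pD)).
have mF' : measurable (F' : set (LebRN R (N + 1))) := pmeas_set (pset_pmeas pF').
have FD q : ~ D q -> (F' q <-> sub u q).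
  by move=> nD; split=> [[[]|[]]|hq]//; left; split => // -[].
have FF : {ae mu1, forall q : LebRN R (N + 1), \1_F q = \1_F' q :> R}.
  exists ((S1 `\` (sub u `\` F)) `|` (S2 `\` (F `\` sub u))); split.
  - exact: (measurableU _ _ (measurableD mS1 m1) (measurableD mS2 m2)).
  - exact: (eq_trans (measureU0 (mu := mu1) (measurableD mS1 m1) (measurableD mS2 m2) z2) z1).
  - move=> q /= nq; apply: contrapT => /not_orP[/not_andP h1 /not_andP h2]; apply: nq.
    rewrite !indicE_asbool; congr (if _ then _ else _); apply: asbool_equiv_eq; split.
      move=> Fq; have [uq|nu] := pselect (sub u q); last by right; split; [exact: NS2|exact: D2].
      by left; split => // -[S1q _]; case: h1 => // nn; apply: nn => -[].
    move=> [[uq nS]|[S2q Dq]].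
      by apply: contrapT => nF; apply: nS; split; [exact: NS1|exact: D1].
    by case: h2 => // /contrapT[].
have iF : (\int[lebRN R (N + 1)]_(p in F `&` A) (H (pz p))%:E = \int[lebRN R (N + 1)]_(p in F' `&` A) (H (pz p))%:E)%E.
  have mA : measurable (A : set (LebRN R (N + 1))) := measurable_open oA.
  have cK := compact_pz cA.1.
  have KO : @pz R N @` closure A `<=` Omega by move=> _ [q /cA.2 Oq <-].
  have [h [Mh [_ mh hMh hE]]] := Linfloc_clamp oO hH cK KO.
  have hi (E : set Hn) (mE : measurable (E : set (LebRN R (N + 1)))) :=
    @integral_H R N Omega oO H (E `&` A) _ h Mh hH cK KO (measurableI _ _ mE mA)
      (leb_fin_sub cA.1 (subset_trans (@subIsetr _ _ _) (@subset_closure _ A)))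
      (fun q hq => imageP _ (@subset_closure _ A _ hq.2)) mh hMh hE.
  rewrite (hi _ mF).2 (hi _ mF').2; congr (_%:E).
  apply: (I_eq_ae (intg_measurable (hi _ mF).1) (intg_measurable (hi _ mF').1)).
  have I1 (E : set Hn) q : \1_(E `&` A) q = \1_E q * \1_A q :> R by rewrite indicI.
  by apply: filterS FF => q e; rewrite !I1 e.
rewrite (per_ae A mF mF' FF) iF.
exact: (graph_le oA cA pF' cD DA FD).
Qed.

End a_to_b.

(** * The Heisenberg group as an instance of the frame *)

Section heisenberg_frame.
Context {R : realType} {n : nat}.
Variable eps : R.
Hypothesis eps0 : eps != 0.
Local Notation mu1 := (lm R (n + n + 1)).
Local Notation Hn := 'rV[R]_(n + n + 1).

(* With these signs and indices, [xi i] is [y_i] for [X_i] and [- x_i] for [Y_i]. *)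
Definition heis_sg (j : 'I_(n + n)) : R := if fintype.split j is inl _ then 1 else -1.
Definition heis_pm (j : 'I_(n + n)) : 'I_(n + n) :=
  match fintype.split j with inl i => rshift n i | inr i => lshift n i end.

Lemma norm_epsE (p a : Hn) : norm_eps eps p a = Num.sqrt (nrm2 eps heis_sg heis_pm (pz p) a).
Proof.
rewrite /norm_eps /nrm2; congr (Num.sqrt (_ + _ ^+ 2)).
  by rewrite big_split_ord/= -big_split/=; apply: eq_bigr => i _; rewrite !pzE.
rewrite /gam; congr ((_ - _) / _); rewrite big_split_ord/= -big_split/=; apply: eq_bigr => i _.
have hl : fintype.split (lshift n i) = inl i by apply: (can_inj (@unsplitK _ _)); rewrite splitK.
have hr : fintype.split (rshift n i) = inr i by apply: (can_inj (@unsplitK _ _)); rewrite splitK.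
by rewrite /xi /heis_sg /heis_pm hl hr !pzE /hx /hy; ring.
Qed.

(** The admissible fields coincide, because a square root is at most 1 exactly when its argument is,
    and the integrals are finite by compact support. *)
Lemma perimeterE (E A : set Hn) : measurable (E : set (LebRN R (n + n + 1))) ->
  perimeter_eps eps E A = per eps heis_sg heis_pm E A.
Proof.
move=> mE; congr ereal_sup.
have nE (p a : Hn) : (norm_eps eps p a <= 1) = (nrm2 eps heis_sg heis_pm (pz p) a <= 1).
  by rewrite norm_epsE -[X in _ <= X]sqrtr1 ler_sqrt.
have fE (U : Hn -> Hn) (C : set Hn) : C1 U -> compact C -> (forall p, ~ C p -> U p = 0) ->
    (\int[lebRN R (n + n + 1)]_(p in E) (divergence U p)%:E = (flux E U)%:E)%E.
  move=> hU cC U0; rewrite (@integral_on _ _ (LebRN R (n + n + 1)) (lebRN R (n + n + 1)) E (divergence U)).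
  exact: (intgE (flux_intg mE hU cC U0)).
apply/seteqP; split => _ [U [hU [sU nU]] <-].
  have [C [cC CA] U0] := sU; exists U; last by rewrite (fE U C hU cC U0).
  by split => //; split => // p; rewrite -nE.
have [C [cC CA] U0] := sU; exists U; last by rewrite (fE U C hU cC U0).
by split => //; split => // p; rewrite nE.
Qed.

End heisenberg_frame.

Theorem theorem5p5 (R : realType) (n : nat) (eps : R)
    (Omega : set 'rV[R]_(n + n)) (H u : 'rV[R]_(n + n) -> R) :
  (0 < n)%N -> eps != 0 ->
  open Omega -> connected Omega -> bounded_set Omega -> Omega !=set0 ->
  Linfloc Omega H -> BVloc Omega u ->
  (* (a) *)
  ((forall (Omt : set 'rV[R]_(n + n)) (v : 'rV[R]_(n + n) -> R),
      open Omt -> compactly_contained Omt Omega ->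
      BVloc Omega v ->
      compactly_contained [set z | Omega z /\ u z <> v z] Omt ->
      (perimeter_eps eps (subgraph Omega u) (cylinder Omt)
         + \int[lebRN R (n + n)]_(z in Omt) (H z * u z)%:E
       <= perimeter_eps eps (subgraph Omega v) (cylinder Omt)
         + \int[lebRN R (n + n)]_(z in Omt) (H z * v z)%:E)%E)
  <->
  (* (b) : E_u is an H-minimizer in Omega x R, with H(z,t) := H(z) *)
   (forall (A F : set 'rV[R]_(n + n + 1)),
      open A -> compactly_contained A (cylinder Omega) ->
      measurable (F : set (LebRN R (n + n + 1))) ->
      compactly_contained
        ((subgraph Omega u `\` F) `|` (F `\` subgraph Omega u)) A ->
      (perimeter_eps eps (subgraph Omega u) A
         + \int[lebRN R (n + n + 1)]_(p in subgraph Omega u `&` A) (H (hz p))%:E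
       <= perimeter_eps eps F A
         + \int[lebRN R (n + n + 1)]_(p in F `&` A) (H (hz p))%:E)%E)).
Proof.
move=> _ eps0 oO _ _ _ hH hu.
have mS v : BVloc Omega v -> measurable (subgraph Omega v : set (LebRN R (n + n + 1))).
  by move=> hv; exact: (pmeas_set (pmeas_sub oO hv.1.1)).
split => [ha A F oA cA mF dF|hb W v oW cW hv duv].
  rewrite (perimeterE eps A (mS u hu)) (perimeterE eps A mF).
  apply: (graph_minimizer eps0 oO hH hu _ oA cA mF dF) => W v oW cW hv duv.
  have := ha W v oW cW hv duv.
  by rewrite (perimeterE eps _ (mS u hu)) (perimeterE eps _ (mS v hv)).
rewrite (perimeterE eps _ (mS u hu)) (perimeterE eps _ (mS v hv)).
apply: (minimizer_graph eps0 oO hH hu hv oW cW duv) => A F oA cA mF dF.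
have := hb A F oA cA mF dF.
by rewrite (perimeterE eps A (mS u hu)) (perimeterE eps A mF).
Qed.
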